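(* Let $G$ be a rational Carnot group with Carnot metric $d$, and let $Q$ be the Hausdorff dimension of $(G,d)$. Put $\alpha(G):=(Q+1)/Q$. For $\alpha\in\mathbb{R}$ and $g\in G$ consider the inequality $$d(g,\delta_q^{-1}p)<q^{-\alpha},\qquad q\in\mathbb{N},\ p\in G(\mathbb{Z}).\qquad ( * )$$ If $\alpha\le\alpha(G)$, then for almost every $g\in G$ the inequality $( * )$ has infinitely many solutions $(p,q)$. If $\alpha>\alpha(G)$, then the set of $g\in G$ for which $( * )$ has infinitely many solutions has measure zero.
   Context: A connected, simply connected Lie group $G$ with Lie algebra $\mathfrak g$ is a Carnot group if $\mathfrak g=\mathfrak g_1\oplus\cdots\oplus\mathfrak g_s$ with $[\mathfrak g_1,\mathfrak g_i]=\mathfrak g_{i+1}$ for all $i$ (with $\mathfrak g_{s+1}:=0$). Let $n_i=\dim\mathfrak g_i$. Via the exponential map (a bijection) and a choice of basis of each $\mathfrak g_i$, $G$ is given coordinates in $\mathbb{R}^{n_1}\times\cdots\times\mathbb{R}^{n_s}$, and the group law has the form $(x_1,\dots,x_s)*(x_1',\dots,x_s')=(x_1+x_1',x_2+x_2'+p_2,\dots,x_s+x_s'+p_s)$, where $p_i$ is a vector of polynomials in the coordinates of $x_1,\dots,x_{i-1},x_1',\dots,x_{i-1}'$. $G$ is rational if these coordinates can be chosen so that all the polynomials $p_i$ have integer coefficients; such coordinates are fixed. $G(\mathbb{Z})$ is the set of points of $G$ with integer coordinates (it is then a co-compact lattice). For $r>0$ the dilation is $\delta_r(x_1,\dots,x_s)=(rx_1,r^2x_2,\dots,r^sx_s)$.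 The Carnot metric $d$ is the left-invariant sub-Riemannian path metric determined by an inner product on $\mathfrak g_1$. The Hausdorff dimension of $(G,d)$ is $Q=\sum_i i\,n_i$. ''Almost every'' and ''measure'' refer to Lebesgue measure in the coordinates (which is a Haar measure). *)

(* Defs.v *)
From HB Require Import structures.
From mathcomp Require Import all_boot all_order all_algebra.
From mathcomp Require Import all_classical all_reals all_analysis.
(* mpoly's notations clash with those of mathcomp-analysis *)
From mathcomp Require mpoly.

Set Implicit Arguments.
Unset Strict Implicit.
Unset Printing Implicit Defensive.

Import Order.TTheory GRing.Theory Num.Theory numFieldNormedType.Exports.

Local Open Scope classical_set_scope.
Local Open Scope ring_scope.

Section LebesgueTuple.
Context {R : realType}.
Local Notation RT := (measurableTypeR R).

Definition cons_pair (n : nat) (z : RT * n.-tuple RT) : n.+1.-tuple RT :=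
  [tuple of z.1 :: z.2].

Definition uncons_pair (n : nat) (t : n.+1.-tuple RT) : RT * n.-tuple RT :=
  (thead t, [tuple of behead t]).

Lemma measurable_cons_pair (n : nat) :
  measurable_fun [set: RT * n.-tuple RT] (@cons_pair n).
Proof. by apply: measurable_cons. Qed.

Lemma measurable_uncons_pair (n : nat) :
  measurable_fun [set: n.+1.-tuple RT] (@uncons_pair n).
Proof.
apply: measurable_fun_pair; first exact: measurable_tnth.
exact: measurable_behead.
Qed.

Lemma cons_pairK (n : nat) : cancel (@cons_pair n) (@uncons_pair n).
Proof. by case=> x t; congr (_, _); apply/val_inj. Qed.

Lemma uncons_pairK (n : nat) : cancel (@uncons_pair n) (@cons_pair n).
Proof. by move=> t; rewrite [RHS]tuple_eta; apply/val_inj. Qed.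

Section Step.
Local Open Scope ereal_scope.
Variables (n : nat) (m : {sigma_finite_measure set (n.-tuple RT) -> \bar R}).

Definition lebesgue_cons : set (n.+1.-tuple RT) -> \bar R :=
  pushforward (@lebesgue_measure R \x m) (@cons_pair n).

Let preimage_measurable A : measurable A -> measurable (@cons_pair n @^-1` A).
Proof.
by move=> mA; rewrite -[X in measurable X]setTI; exact: measurable_cons_pair.
Qed.

Let lebesgue_cons0 : lebesgue_cons set0 = 0.
Proof. by rewrite /lebesgue_cons /pushforward preimage_set0 measure0. Qed.

Let lebesgue_cons_ge0 A : 0 <= lebesgue_cons A.
Proof. by apply: integral_ge0 => x _; exact: measure_ge0. Qed.

Let lebesgue_cons_sigma_additive : semi_sigma_additive lebesgue_cons.
Proof.
move=> F mF tF mUF; rewrite /lebesgue_cons /pushforward preimage_bigcup.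
apply: measure_semi_sigma_additive.
- by move=> k; exact: preimage_measurable.
- apply/trivIsetP => /= i j _ _ ij; rewrite -preimage_setI.
  by move/trivIsetP : tF => /(_ _ _ _ _ ij) ->//; rewrite preimage_set0.
- by rewrite -preimage_bigcup; exact: preimage_measurable.
Qed.

HB.instance Definition _ := isMeasure.Build _ _ _ lebesgue_cons
  lebesgue_cons0 lebesgue_cons_ge0 lebesgue_cons_sigma_additive.

Let lebesgue_cons_sigma_finite : sigma_finite setT lebesgue_cons.
Proof.
have /sigma_finiteP[F [FT ndF Foo]] := sigma_finiteT (@lebesgue_measure R).
have /sigma_finiteP[G [GT ndG Goo]] := sigma_finiteT m.
have FGT : setT = \bigcup_k (F k `*` G k).
  apply/esym/seteqP; split => // -[x y] _.
  have [i _ Fix] : (\bigcup_k F k) x by rewrite -FT.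
  have [j _ Gjy] : (\bigcup_k G k) y by rewrite -GT.
  exists (maxn i j) => //; split => /=.
  - by move: x Fix; exact/subsetPset/ndF/leq_maxl.
  - by move: y Gjy; exact/subsetPset/ndG/leq_maxr.
exists (fun k => @uncons_pair n @^-1` (F k `*` G k)) => [|k].
  by rewrite -preimage_bigcup -FGT preimage_setT.
have [[mF Fk] [mG Gk]] := (Foo k, Goo k); split.
  rewrite -[X in measurable X]setTI; apply: measurable_uncons_pair => //.
  exact: measurableX.
rewrite /lebesgue_cons /pushforward -comp_preimage.
have -> : @uncons_pair n \o @cons_pair n = id.
  by apply/funext => z; exact: cons_pairK.
by rewrite product_measure1E// lte_mul_pinfty// ge0_fin_numE.
Qed.

HB.instance Definition _ := Measure_isSigmaFinite.Build _ _ _ lebesgue_cons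
  lebesgue_cons_sigma_finite.

End Step.

Fixpoint lebesgue_tuple (n : nat) :
    {sigma_finite_measure set (n.-tuple RT) -> \bar R} :=
  match n with
  | 0%N => dirac ([tuple] : 0.-tuple RT)
  | k.+1 => lebesgue_cons (lebesgue_tuple k)
  end.

End LebesgueTuple.
Arguments lebesgue_tuple : clear implicits.

Section Hausdorff.
Context {R : realType} {T : Type}.
Variable d : T -> T -> \bar R.
Local Open Scope ereal_scope.

(* 0 is added so that the diameter of the empty set is 0. *)
Definition diameter (A : set T) : \bar R :=
  ereal_sup (0 |` [set d z.1 z.2 | z in A `*` A]).

Definition hausdorff_premeasure (s delta : R) (A : set T) : \bar R :=
  ereal_inf [set \sum_(0 <= k <oo) (diameter (U k) `^ s) | U in
    [set U : (set T)^nat | A `<=` \bigcup_k U k /\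
                           forall k, diameter (U k) <= delta%:E]].

Definition hausdorff_measure (s : R) (A : set T) : \bar R :=
  ereal_sup [set hausdorff_premeasure s delta A |
    delta in [set delta | (0 < delta)%R]].

Definition hausdorff_dimension (A : set T) : \bar R :=
  ereal_inf [set s%:E | s in [set s | (0 < s)%R /\ hausdorff_measure s A = 0]].

End Hausdorff.

(* The intersection of all subspaces containing A. *)
Definition linear_span (R : fieldType) (V : vectType R) (A : set V) : set V :=
  [set x | forall U : {vspace V}, (forall y, A y -> y \in U) -> x \in U].

Section CoordinateGroup.
Context {R : realType}.
(* w j is the layer containing the j-th basis vector. *)
Variables (n : nat) (w : 'I_n -> nat).
Variable corr : 'I_n -> mpoly.mpoly (n + n) R.
Local Notation V := 'rV[R]_n.
Implicit Types (x y u v : V).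

Definition group_mul x y : V :=
  \row_j (x 0 j + y 0 j + mpoly.meval (row_mx x y 0) (corr j)).

(* The variables of corr j are the coordinates of the pair (x, y); only those
   lying in layers strictly below that of j may occur. *)
Definition lower_triangular : Prop :=
  forall (j : 'I_n) (m : mpoly.multinom (n + n)) (k : 'I_(n + n)),
    mpoly.mcoeff m (corr j) != 0 -> (0 < mpoly.fun_of_multinom m k)%N ->
    (match fintype.split k with inl i | inr i => w i end < w j)%N.

Definition layer (i : nat) : {vspace V} :=
  <<[seq (delta_mx 0 j : V)%R | j <- enum 'I_n & w j == i]>>%VS.

Definition left_field u : V -> V := fun x => 'D_u (group_mul x) 0.

(* The value at 0 of the commutator of the left-invariant fields extending
   u and v. *)
Definition lie_bracket u v : V :=
  'D_u (left_field v) 0 - 'D_v (left_field u) 0.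

Definition layer_bracket (i k : nat) : set V :=
  linear_span [set lie_bracket z.1 z.2 | z in
                 [set z : V * V | z.1 \in layer i /\ z.2 \in layer k]].

Definition dilation (r : R) x : V := \row_j (r ^+ w j * x 0 j).

End CoordinateGroup.

(* A Carnot group in exponential coordinates adapted to the stratification.
   carnot_exp says that exp is the identity of R^n, i.e. that the lines through
   0 are the one-parameter subgroups; it makes - x the inverse of x. The layers
   are spanned by coordinate vectors, so that their direct sum is R^n, and
   layer carnot_step.+1 is 0. The trivial group, for which (Q + 1) / Q makes no
   sense, is excluded. *)
Record carnotGroup (R : realType) := CarnotGroup {
  carnot_step : nat;
  carnot_dim : nat;
  carnot_weight : 'I_carnot_dim -> nat;
  carnot_corr : 'I_carnot_dim -> mpoly.mpoly (carnot_dim + carnot_dim) R;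
  carnot_dim_gt0 : (0 < carnot_dim)%N;
  carnot_weightP : forall j, (1 <= carnot_weight j <= carnot_step)%N;
  carnot_triangular : lower_triangular carnot_weight carnot_corr;
  carnot_mulA : associative (group_mul carnot_corr);
  carnot_mul0 : left_id 0 (group_mul carnot_corr);
  carnot_mul0r : right_id 0 (group_mul carnot_corr);
  carnot_exp : forall (x : 'rV[R]_carnot_dim) (a b : R),
    group_mul carnot_corr (a *: x) (b *: x) = (a + b) *: x;
  carnot_stratified : forall i, (1 <= i <= carnot_step)%N ->
    layer_bracket carnot_weight carnot_corr 1 i =
    [set x | x \in layer carnot_weight i.+1]
}.

Section CarnotGroup.
Context {R : realType}.
Variable G : carnotGroup R.
Local Notation V := 'rV[R]_(carnot_dim G).

Definition carnot_dilation : R -> V -> V := dilation (@carnot_weight _ G).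

Definition rational_carnot : Prop :=
  forall j, @carnot_corr _ G j \is a mpoly.mpolyOver _ Num.int.

Definition horizontal_space : {vspace V} := layer (@carnot_weight _ G) 1.

Definition carnot_left_field : V -> V -> V := left_field (@carnot_corr _ G).

Definition integer_point (p : V) : Prop := forall j, p 0 j \is a Num.int.

Section Metric.
Variable ip : {dot (subvs_of horizontal_space) for idfun}.

(* A curve of class C^1 on [0, 1] whose derivative at t is the left translate
   of u t to gamma t. The speed may vanish, so a piecewise C^1 horizontal curve
   can be reparametrized to one of this kind, with the same length. *)
Record horizontal_curve (x y : V) (gamma : R -> V)
    (u : R -> subvs_of horizontal_space) : Prop := HorizontalCurve {
  horizontal_start : gamma 0 = x;
  horizontal_end : gamma 1 = y;
  horizontal_continuous : {within `[0, 1], continuous gamma};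
  horizontal_velocity_continuous :
    {within `[0, 1], continuous (fun t => vsval (u t) : V)};
  horizontal_velocity : forall t : R, 0 < t < 1 ->
    is_derive t (1 : R) gamma (carnot_left_field (vsval (u t)) (gamma t))
}.

Definition horizontal_length (u : R -> subvs_of horizontal_space) : \bar R :=
  (\int[@lebesgue_measure R]_(t in `[0%R, 1%R])
     (Num.sqrt (ip (u t) (u t)))%:E)%E.

Definition carnot_dist (x y : V) : \bar R :=
  ereal_inf [set l | exists gamma u,
    horizontal_curve x y gamma u /\ l = horizontal_length u].

Definition carnot_hausdorff_dim : R :=
  fine (hausdorff_dimension carnot_dist [set: V]).

Definition critical_exponent : R :=
  (carnot_hausdorff_dim + 1) / carnot_hausdorff_dim.

Definition approximations (alpha : R) (g : V) : set (V * nat) :=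
  [set z | [/\ integer_point z.1, (0 < z.2)%N &
    (carnot_dist g (carnot_dilation (z.2%:R)^-1 z.1)
       < (z.2%:R `^ (- alpha))%:E)%E]].

End Metric.

Definition point_of_tuple (t : (carnot_dim G).-tuple (measurableTypeR R)) : V :=
  \row_j tnth t j.

End CarnotGroup.

(* Main.v *)
(* Write Q for the sum of the weights, and boxes for the sets |x_j| <= t^(w_j).

   Metric.  In exponential coordinates the structure polynomials are homogeneous
   for the dilations (both delta_r (x * y) and delta_r x * delta_r y are flows of
   left-invariant fields), and every point is a product of a bounded number of
   horizontal exponentials, obtained from iterated commutators.  Hence balls of
   radius t are comparable with boxes of radius t, left translations preserve
   Lebesgue measure, dilations multiply it by r^Q, and the Hausdorff dimension is
   Q.

   Convergence.  A bounded region meets O(q^Q) of the balls of radius q^(-alpha),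
   of measure O(q^(-alpha Q)), so that Borel-Cantelli applies.

   Divergence.  For primes q' < q, and p, p' in a fixed proportion of the box of
   radius q, the balls around delta_q^-1 p and delta_q'^-1 p' can only meet if the
   integer point u = (- delta_q' p) * (delta_q p') is small, and u determines p
   and p' layer by layer because q and q' are coprime.  So the events belonging to
   distinct primes are quasi-independent, and since sum 1/q over primes diverges,
   Bonferroni's inequality gives the limsup set a measure >= kappa in the unit
   cube, where kappa does not depend on the constant c in the radius
   c q^(-(Q+1)/Q).  As the limsup set is invariant under G(Z), and delta_M^-1 maps
   that of a smaller c into it, it has density >= kappa in each tile
   delta_M^-1 (P * cube).  Measurable sets are approximated by unions of tiles, so
   the complement is null. *)
Require Import Defs.
From mathcomp Require Import all_boot all_order all_algebra.
From mathcomp Require Import all_classical all_reals all_analysis.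
From mathcomp Require Import measurable_realfun ring lra zify.
From mathcomp Require mpoly.
Import (canonicals) mpoly.

Set Implicit Arguments.
Unset Strict Implicit.
Unset Printing Implicit Defensive.

Import Order.TTheory GRing.Theory Num.Theory numFieldNormedType.Exports.

Local Open Scope classical_set_scope.
Local Open Scope ring_scope.

(** * Calculus in a Carnot group *)

(** The group law is not assumed to be the Baker-Campbell-Hausdorff formula: only associativity,
    triangularity, [carnot_exp] and the stratification of the bracket at 0 are given. Homogeneity of
    the polynomials has to be derived from differential equations along rays, and everything metric
    rests on it. The exponent (Q+1)/Q is the one for which about q^Q balls of radius q^(-alpha) have
    total volume of order 1/q. Over all q the same points p/q would be met again and again; prime
    denominators avoid these repetitions while the sum of 1/q still diverges. A positive lower bound
    for the limsup set is not enough: it must not shrink with c, because rescaling by M replaces c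
    by c / M^(1/Q). It is uniform because the bounds for volumes and overlaps involve c and q only
    through c^Q / q, and primes beyond any threshold can be chosen for which these numbers add up to
    a fixed size eta. The constant c only decides how far out they lie. *)

Section ChainRule.
Context {R : realType}.

Lemma is_derive_inj (f : R -> R) t a b :
  is_derive t (1 : R) f a -> is_derive t (1 : R) f b -> a = b.
Proof. by move=> [_ <-] [_ <-]. Qed.

Lemma is_derive_inj_ext (f g : R -> R) t a b : f =1 g ->
  is_derive t (1 : R) f a -> is_derive t (1 : R) g b -> a = b.
Proof. by move=> /funext ->; exact: is_derive_inj. Qed.

Lemma is_derive_ext (f g : R -> R) t a b :
  (forall s, f s = g s) -> a = b ->
  is_derive t (1 : R) f a -> is_derive t (1 : R) g b.
Proof. by move=> /funext -> ->. Qed.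

Lemma is_derive_mul (f g : R -> R) t a b :
  is_derive t (1 : R) f a -> is_derive t (1 : R) g b ->
  is_derive t (1 : R) (fun s => f s * g s) (a * g t + f t * b).
Proof.
move=> fa gb; have := is_deriveM fa gb.
by apply: is_derive_ext => //; rewrite addrC mulrC.
Qed.

Lemma is_derive_add (f g : R -> R) t a b :
  is_derive t (1 : R) f a -> is_derive t (1 : R) g b ->
  is_derive t (1 : R) (fun s => f s + g s) (a + b).
Proof. by move=> fa gb; apply: is_deriveD. Qed.

Lemma is_derive_bigsum (I : Type) (r : seq I) (P : pred I) (f : I -> R -> R)
    (d : I -> R) t :
  (forall i, P i -> is_derive t (1 : R) (f i) (d i)) ->
  is_derive t (1 : R) (fun s => \sum_(i <- r | P i) f i s)
    (\sum_(i <- r | P i) d i).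
Proof.
move=> fd; elim: r => [|i r IH].
  by rewrite big_nil; apply: is_derive_ext (is_derive_cst (0 : R) t 1) => // s;
    rewrite big_nil.
rewrite big_cons; case: ifPn => Pi.
  apply: is_derive_ext (is_derive_add (fd _ Pi) IH) => // s.
  by rewrite big_cons Pi.
by apply: is_derive_ext IH => // s; rewrite big_cons (negbTE Pi).
Qed.

(** A predicate on p, so that the chain rule can be proved by closure under constants, variables,
    sums and products. *)
Definition derivable_meval N (p : mpoly.mpoly N R) :=
  forall (z : 'I_N -> R -> R) (dz : 'I_N -> R) t,
  (forall k, is_derive t (1 : R) (z k) (dz k)) ->
  is_derive t (1 : R) (fun s => mpoly.meval (fun k => z k s) p)
    (\sum_k dz k * mpoly.meval (fun k => z k t) (mpoly.mderiv k p)).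

Lemma is_derive_meval N (p : mpoly.mpoly N R) : derivable_meval p.
Proof.
have DC c : derivable_meval (mpoly.mpolyC N c : mpoly.mpoly N R).
  move=> z dz t _; apply: is_derive_ext (is_derive_cst c t 1) => [s|].
    by rewrite mpoly.mevalC.
  by rewrite big1// => k _; rewrite mpoly.mderivC mpoly.meval0 mulr0.
have DD (p1 p2 : mpoly.mpoly N R) : derivable_meval p1 -> derivable_meval p2 ->
    derivable_meval (p1 + p2 : mpoly.mpoly N R).
  move=> d1 d2 z dz t H.
  apply: is_derive_ext (is_derive_add (d1 z dz t H) (d2 z dz t H)) => [s|].
    by rewrite mpoly.mevalD.
  rewrite -big_split; apply: eq_bigr => k _.
  by rewrite mpoly.mderivD mpoly.mevalD mulrDr.
have DM (p1 p2 : mpoly.mpoly N R) : derivable_meval p1 -> derivable_meval p2 ->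
    derivable_meval (p1 * p2 : mpoly.mpoly N R).
  move=> d1 d2 z dz t H.
  apply: is_derive_ext (is_derive_mul (d1 z dz t H) (d2 z dz t H)) => [s|].
    by rewrite mpoly.mevalM.
  rewrite mulr_suml mulr_sumr -big_split; apply: eq_bigr => k _ /=.
  by rewrite mpoly.mderivM mpoly.mevalD !mpoly.mevalM; ring.
have DX i : derivable_meval (mpoly.mpolyX R (mpoly.mnm1 i) : mpoly.mpoly N R).
  move=> z dz t H; apply: is_derive_ext (H i) => [s|].
    by rewrite mpoly.mevalXU.
  rewrite (bigD1 i)//= big1 ?addr0 => [|k ki].
    rewrite mpoly.mderivX mpoly.mnmE eqxx scale1r.
    have -> : mpoly.mnm_sub (mpoly.mnm1 i) (mpoly.mnm1 i) = mpoly.mnm0.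
      by apply/mpoly.mnmP => j; rewrite !mpoly.mnmE subnn.
    by rewrite mpoly.mpolyX0 mpoly.meval1 mulr1.
  by rewrite mpoly.mderivX mpoly.mnmE eq_sym (negbTE ki) scale0r mpoly.meval0 mulr0.
have D0 : derivable_meval (0 : mpoly.mpoly N R) by rewrite -mpoly.mpolyC0.
have D1 : derivable_meval (1 : mpoly.mpoly N R) by rewrite -mpoly.mpolyC1.
rewrite (mpoly.mpolyE p); elim: (mpoly.msupp p) => [|m s IH].
  by rewrite big_nil.
rewrite big_cons; apply: (DD) => //; rewrite -mpoly.mul_mpolyC; apply: (DM) => //.
rewrite mpoly.mpolyXE_id; elim: (index_enum _) => [|i r IHr].
  by rewrite big_nil.
rewrite big_cons; apply: (DM) => //.
elim: (X in _ ^+ X) => [|k IHk]; first by rewrite expr0.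
by rewrite exprS; apply: (DM).
Qed.

End ChainRule.

(** * The left-invariant frame and the Maurer-Cartan equation *)

Section GroupCalculus.
Context {R : realType} (G : carnotGroup R).
Local Notation n := (carnot_dim G).
Local Notation corr := (@carnot_corr _ G).
Local Notation V := 'rV[R]_n.
Local Notation mul := (group_mul corr).
Implicit Types (x y z u v : V) (j k l : 'I_n).

Definition pair_val x y : 'I_(n + n) -> R := row_mx x y 0.

Definition mul_poly j : mpoly.mpoly (n + n) R :=
  mpoly.mpolyX R (mpoly.mnm1 (lshift n j)) +
  mpoly.mpolyX R (mpoly.mnm1 (rshift n j)) + corr j.

Definition ev (p : mpoly.mpoly (n + n) R) x y : R := mpoly.meval (pair_val x y) p.
Local Notation d1 l p := (mpoly.mderiv (lshift n l) p).
Local Notation d2 l p := (mpoly.mderiv (rshift n l) p).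

Lemma group_mulE x y j : mul x y 0 j = ev (mul_poly j) x y.
Proof.
rewrite mxE /ev /mul_poly !mpoly.mevalD !mpoly.mevalXU /pair_val.
by rewrite row_mxEl row_mxEr.
Qed.

Lemma is_derive_ev p (a b : R -> V) (da db : V) t :
  (forall k, is_derive t (1 : R) (fun s => a s 0 k) (da 0 k)) ->
  (forall k, is_derive t (1 : R) (fun s => b s 0 k) (db 0 k)) ->
  is_derive t (1 : R) (fun s => ev p (a s) (b s))
    (\sum_l da 0 l * ev (d1 l p) (a t) (b t) +
     \sum_l db 0 l * ev (d2 l p) (a t) (b t)).
Proof.
move=> Ha Hb.
pose dz : 'I_(n + n) -> R := row_mx da db 0.
have := @is_derive_meval _ (n + n) p (fun i s => row_mx (a s) (b s) 0 i) dz t.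
move=> H; apply: is_derive_ext (H _) => //; last first.
  move=> k; rewrite /dz; case: (split_ordP k) => i ->.
    rewrite row_mxEl; apply: is_derive_ext (Ha i) => // s; by rewrite row_mxEl.
  rewrite row_mxEr; apply: is_derive_ext (Hb i) => // s; by rewrite row_mxEr.
by rewrite big_split_ord /dz /=; congr (_ + _); apply: eq_bigr => i _;
  rewrite ?row_mxEl ?row_mxEr.
Qed.

Lemma is_derive_const (a : R) t : is_derive t (1 : R) (fun=> a) 0.
Proof. exact: is_derive_cst. Qed.

Lemma is_derive_row_const x t k :
  is_derive t (1 : R) (fun s : R => x 0 k) ((0 : V) 0 k).
Proof. by rewrite mxE; exact: is_derive_const. Qed.

Lemma is_derive_line x v t k :
  is_derive t (1 : R) (fun s : R => (x + s *: v) 0 k) (v 0 k).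
Proof.
have h : is_derive t (1 : R) (fun s : R => s) 1 by exact: is_derive_id.
apply: is_derive_ext (is_derive_add (is_derive_const (x 0 k) t)
  (is_derive_mul h (is_derive_const (v 0 k) t))) => [s|].
  by rewrite !mxE.
by rewrite /= add0r mulr0 addr0 mul1r.
Qed.

Lemma is_derive_ray v t k :
  is_derive t (1 : R) (fun s : R => (s *: v) 0 k) (v 0 k).
Proof.
by apply: is_derive_ext (is_derive_line 0 v t k) => // s; rewrite add0r.
Qed.

(** Column k is the left-invariant field extending e_k, evaluated at x; the matrix is the
    differential at 0 of left translation by x. [dframe l] is its partial derivative in x_l. *)
Definition frame x j k : R := ev (d2 k (mul_poly j)) x 0.
Definition dframe l x j k : R := ev (d1 l (d2 k (mul_poly j))) x 0.

Lemma is_derive_frame (a : R -> V) (da : V) t j k :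
  (forall i, is_derive t (1 : R) (fun s => a s 0 i) (da 0 i)) ->
  is_derive t (1 : R) (fun s => frame (a s) j k)
    (\sum_l da 0 l * dframe l (a t) j k).
Proof.
move=> Ha; apply: is_derive_ext
  (is_derive_ev (d2 k (mul_poly j)) Ha (is_derive_row_const 0 t)) => //.
by rewrite [X in _ + X]big1 ?addr0// => i _; rewrite mxE mul0r.
Qed.

Lemma is_derive_mulr x (b : R -> V) (db : V) t j :
  (forall i, is_derive t (1 : R) (fun s => b s 0 i) (db 0 i)) ->
  is_derive t (1 : R) (fun s => mul x (b s) 0 j)
    (\sum_l db 0 l * ev (d2 l (mul_poly j)) x (b t)).
Proof.
move=> Hb; apply: is_derive_ext
  (is_derive_ev (mul_poly j) (is_derive_row_const x t) Hb) => [s|].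
  by rewrite group_mulE.
by rewrite [X in X + _]big1 ?add0r// => i _; rewrite mxE mul0r.
Qed.

Lemma mulA x y z : mul x (mul y z) = mul (mul x y) z.
Proof. exact: carnot_mulA. Qed.
Lemma mul0 x : mul 0 x = x. Proof. exact: carnot_mul0. Qed.
Lemma mulx0 x : mul x 0 = x. Proof. exact: carnot_mul0r. Qed.
Lemma mulD x (a b : R) : mul (a *: x) (b *: x) = (a + b) *: x.
Proof. exact: carnot_exp. Qed.
Lemma mulxV x : mul x (- x) = 0.
Proof. by rewrite -{1}[x]scale1r -[- x]scaleN1r mulD subrr scale0r. Qed.
Lemma mulVx x : mul (- x) x = 0.
Proof. by rewrite -{2}[x]scale1r -[- x]scaleN1r mulD addNr scale0r. Qed.
Lemma mulKx x y : mul (- x) (mul x y) = y.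
Proof. by rewrite mulA mulVx mul0. Qed.
Lemma mulVKx x y : mul x (mul (- x) y) = y.
Proof. by rewrite mulA mulxV mul0. Qed.

(* Differentiate associativity in the last factor at 0. *)
Lemma frame_mul x y j k :
  \sum_l frame y l k * ev (d2 l (mul_poly j)) x y = frame (mul x y) j k.
Proof.
pose e : V := delta_mx 0 k.
have D u i : is_derive (0 : R) (1 : R) (fun s : R => mul u (s *: e) 0 i) (frame u i k).
  apply: is_derive_ext (is_derive_mulr u i (is_derive_ray e 0)) => //.
  rewrite (bigD1 k)//= big1 ?addr0 => [|l lk]; last first.
    by rewrite mxE eqxx (negbTE lk) mul0r.
  by rewrite mxE !eqxx mul1r scale0r.
pose dy : V := \row_l frame y l k.
have Dy i : is_derive (0 : R) (1 : R) (fun s : R => mul y (s *: e) 0 i) (dy 0 i).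
  by rewrite mxE; exact: D.
apply: is_derive_inj (D (mul x y) j).
apply: is_derive_ext (is_derive_mulr x j Dy) => [s|].
  by rewrite mulA.
by apply: eq_bigr => l _; rewrite mxE scale0r mulx0.
Qed.

Lemma frame0 j k : frame 0 j k = (j == k)%:R.
Proof.
pose e : V := delta_mx 0 k.
have D1 : is_derive (0 : R) (1 : R) (fun s : R => mul 0 (s *: e) 0 j) (frame 0 j k).
  apply: is_derive_ext (is_derive_mulr 0 j (is_derive_ray e 0)) => //.
  rewrite (bigD1 k)//= big1 ?addr0 => [|l lk]; last first.
    by rewrite mxE eqxx (negbTE lk) mul0r.
  by rewrite mxE !eqxx mul1r scale0r.
apply: is_derive_inj D1 _; apply: is_derive_ext (is_derive_ray e 0 j) => [s|].
  by rewrite mul0.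
by rewrite mxE eqxx.
Qed.

Lemma is_derive_mulr0 x v j :
  is_derive (0 : R) (1 : R) (fun s : R => mul x (s *: v) 0 j)
    (\sum_k v 0 k * frame x j k).
Proof.
apply: is_derive_ext (is_derive_mulr x j (is_derive_ray v 0)) => //.
by apply: eq_bigr => l _; rewrite scale0r.
Qed.

(** Differentiate [frame_mul] in y along e_i at 0. The second-derivative term is symmetric in i and
    k, so it drops out of the commutator in [maurer_cartan]. *)
Lemma dframe_frame x i j k :
  \sum_l frame x l i * dframe l x j k =
  ev (d2 i (d2 k (mul_poly j))) x 0 + \sum_l dframe i 0 l k * frame x j l.
Proof.
pose e : V := delta_mx 0 i.
pose dm : V := \row_l frame x l i.
have Dm l : is_derive (0 : R) (1 : R) (fun s : R => mul x (s *: e) 0 l) (dm 0 l).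
  apply: is_derive_ext (is_derive_mulr0 x e l) => //.
  rewrite (bigD1 i)//= big1 ?addr0 => [|h hi]; last first.
    by rewrite mxE eqxx (negbTE hi) mul0r.
  by rewrite !mxE !eqxx mul1r.
have DR := is_derive_frame j k Dm.
have DL : forall l, is_derive (0 : R) (1 : R)
    (fun s : R => frame (s *: e) l k * ev (d2 l (mul_poly j)) x (s *: e))
    (dframe i 0 l k * frame x j l + frame 0 l k * ev (d2 i (d2 l (mul_poly j))) x 0).
  move=> l; apply: is_derive_ext (is_derive_mul (is_derive_frame l k (is_derive_ray e 0))
   (is_derive_ev (d2 l (mul_poly j)) (is_derive_row_const x 0) (is_derive_ray e 0))) => //.
  rewrite scale0r; congr (_ * _ + _ * _).
    rewrite (bigD1 i)//= big1 ?addr0 => [|h hi]; last first.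
      by rewrite mxE eqxx (negbTE hi) mul0r.
    by rewrite mxE !eqxx mul1r.
  rewrite big1 ?add0r => [|h _]; last by rewrite mxE mul0r.
  rewrite (bigD1 i)//= big1 ?addr0 => [|h hi]; last first.
    by rewrite mxE eqxx (negbTE hi) mul0r.
  by rewrite mxE !eqxx mul1r.
have DS := is_derive_bigsum (index_enum 'I_n) (P := xpredT) (fun l _ => DL l).
have : is_derive (0 : R) (1 : R) (fun s : R => frame (mul x (s *: e)) j k)
  (\sum_l (dframe i 0 l k * frame x j l + frame 0 l k * ev (d2 i (d2 l (mul_poly j))) x 0)).
  by apply: is_derive_ext DS => // s; rewrite frame_mul.
move=> /(is_derive_inj DR) E.
transitivity (\sum_l dm 0 l * dframe l (mul x (0 *: e)) j k).
  by apply: eq_bigr => l _; rewrite mxE scale0r mulx0.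
rewrite E big_split/= addrC; congr (_ + _).
rewrite (bigD1 k)//= big1 ?addr0 => [|h hi]; last first.
  by rewrite frame0 (negbTE hi) mul0r.
by rewrite frame0 eqxx mul1r.
Qed.

(** The e_l-coordinate of the bracket of e_i and e_k, as [lie_bracketE] confirms. *)
Definition struct_const i k l : R := dframe i 0 l k - dframe k 0 l i.

(** Left-invariant fields are closed under commutators, with the structure constants found at 0;
    here this is the antisymmetric part of [dframe_frame]. *)
Lemma maurer_cartan x i j k :
  \sum_l frame x l i * dframe l x j k - \sum_l frame x l k * dframe l x j i =
  \sum_l frame x j l * struct_const i k l.
Proof.
rewrite !dframe_frame mpoly.mderiv_comm opprD addrACA subrr add0r -sumrB.
by apply: eq_bigr => l _; rewrite /struct_const; ring.
Qed.

(** Rays through 0 are one-parameter subgroups: the product of x and s x is (1 + s) x,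
    differentiated at s = 0. *)
Lemma frame_exp x j : \sum_k x 0 k * frame x j k = x 0 j.
Proof.
apply: is_derive_inj (is_derive_mulr0 x x j) _.
apply: is_derive_ext (is_derive_line x x 0 j) => // s.
by rewrite -{3}[x]scale1r mulD scalerDl scale1r.
Qed.

(** The partial derivative of [frame_exp] in x_i. *)
Lemma dframe_exp x i j : \sum_k x 0 k * dframe i x j k + frame x j i = (j == i)%:R.
Proof.
pose e : V := delta_mx 0 i.
have DL k := is_derive_mul (is_derive_line x e 0 k) (is_derive_frame j k (is_derive_line x e 0)).
have DS := is_derive_bigsum (index_enum 'I_n) (P := xpredT) (fun l _ => DL l).
have : is_derive (0 : R) (1 : R) (fun s => (x + s *: e) 0 j) (e 0 j) by exact: is_derive_line.
move=> /(is_derive_ext (g := fun s => \sum_k (x + s *: e) 0 k * frame (x + s *: e) j k) (fun s => esym (frame_exp _ j)) erefl).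
move=> /is_derive_inj/(_ DS); rewrite {1}mxE eqxx /= => ->.
apply/esym; rewrite big_split/= addrC; congr (_ + _); last first.
  rewrite (bigD1 i)//= big1 ?addr0 => [|h hi]; last first.
    by rewrite mxE eqxx (negbTE hi) mul0r.
  by rewrite mxE !eqxx mul1r scale0r addr0.
apply: eq_bigr => k _; rewrite scale0r addr0; congr (_ * _).
rewrite (bigD1 i)//= big1 ?addr0 => [|h hi]; last first.
  by rewrite mxE eqxx (negbTE hi) mul0r.
by rewrite mxE !eqxx mul1r.
Qed.

(** The matrix of ad x: the e_l-coordinate of [x, e_k]. *)
Definition ad x k l : R := \sum_i x 0 i * struct_const i k l.

(* Contract the Maurer-Cartan equation with x. *)
Lemma frame_radial x j k :
  \sum_l x 0 l * dframe l x j k =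
  frame x j k - \sum_l frame x j l * frame x l k + \sum_l frame x j l * ad x k l.
Proof.
have E : \sum_i x 0 i * (\sum_l frame x l i * dframe l x j k - \sum_l frame x l k * dframe l x j i)
   = \sum_i x 0 i * \sum_l frame x j l * struct_const i k l.
  by apply: eq_bigr => i _; rewrite maurer_cartan.
have E1 : \sum_i x 0 i * \sum_l frame x j l * struct_const i k l = \sum_l frame x j l * ad x k l.
  rewrite /ad; under eq_bigr do rewrite mulr_sumr; rewrite exchange_big/=.
  by apply: eq_bigr => l _; rewrite mulr_sumr; apply: eq_bigr => i _; ring.
have E2 : \sum_i x 0 i * \sum_l frame x l i * dframe l x j k = \sum_l x 0 l * dframe l x j k.
  under eq_bigr do rewrite mulr_sumr; rewrite exchange_big/=.
  apply: eq_bigr => l _; rewrite -[x 0 l in RHS]frame_exp mulr_suml.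
  by apply: eq_bigr => i _; ring.
have E3 : \sum_i x 0 i * \sum_l frame x l k * dframe l x j i =
    frame x j k - \sum_l frame x j l * frame x l k.
  under eq_bigr do rewrite mulr_sumr; rewrite exchange_big/=.
  transitivity (\sum_l frame x l k * ((j == l)%:R - frame x j l)).
    apply: eq_bigr => l _; rewrite -(dframe_exp x l j) addrK mulr_sumr.
    by apply: eq_bigr => i _; ring.
  rewrite -[X in X - _](_ : \sum_l frame x l k * (j == l)%:R = _).
    by rewrite -sumrB; apply: eq_bigr => l _; ring.
  rewrite (bigD1 j)//= big1 ?addr0 => [|h hi]; last first.
    by rewrite eq_sym (negbTE hi) mulr0.
  by rewrite eqxx mulr1.
move: E; rewrite E1 -E2 -E3; under eq_bigr do rewrite mulrBr; rewrite sumrB => <-.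
by rewrite addrC subrK.
Qed.

Lemma sum_delta (f : 'I_n -> R) k : \sum_i (i == k)%:R * f i = f k.
Proof.
rewrite (bigD1 k)//= big1 ?addr0 => [|i ik]; first by rewrite eqxx mul1r.
by rewrite (negbTE ik) mul0r.
Qed.

Lemma sum_delta_mx (f : 'I_n -> R) k : \sum_i (delta_mx 0 k : V) 0 i * f i = f k.
Proof.
by rewrite -[RHS]sum_delta; apply: eq_bigr => i _; rewrite mxE eqxx.
Qed.

(* Half of the bracket, on the coordinate basis. *)
Definition bil h i l : R := dframe h 0 l i.

(** The derivative of [dframe_exp] at 0 along e_h: in exponential coordinates the quadratic part of
    the group law has no symmetric component. *)
Lemma bil_antisym h i j : bil i h j = - bil h i j.
Proof.
pose e : V := delta_mx 0 h.
have DL k := is_derive_mul (is_derive_ray e 0 k)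
  (is_derive_ev (d1 i (d2 k (mul_poly j))) (is_derive_ray e 0) (is_derive_row_const 0 0)).
have DS := is_derive_bigsum (index_enum 'I_n) (P := xpredT) (fun l _ => DL l).
have := is_derive_inj_ext (fun s : R => dframe_exp (s *: e) i j)
  (is_derive_add DS (is_derive_frame j i (is_derive_ray e 0)))
  (is_derive_const (j == i)%:R 0).
move=> H; apply/eqP; rewrite -addr_eq0 -[X in _ == X]H; apply/eqP.
rewrite sum_delta_mx big_split/= [X in _ = _ + X + _]big1 ?addr0 => [|k _]; last first.
  by rewrite scale0r mxE mul0r.
by rewrite sum_delta_mx scale0r.
Qed.

(** Differentiate [maurer_cartan] at 0 for the three cyclic permutations of the indices. The third
    derivatives [T] are symmetric in their first two indices, so they cancel in the sum and leave
    only products of [bil]. *)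
Lemma jacobi_bil h i k j :
  \sum_l (bil h i l * bil l k j + bil i k l * bil l h j + bil k h l * bil l i j) = 0.
Proof.
pose T h i k := ev (d1 h (d1 i (d2 k (mul_poly j)))) 0 0.
have TC a b c : T a b c = T b a c by rewrite /T mpoly.mderiv_comm.
have D a l b : is_derive (0 : R) (1 : R)
    (fun s : R => dframe l (s *: delta_mx 0 a) j b) (T a l b).
  apply: is_derive_ext (is_derive_ev (d1 l (d2 b (mul_poly j)))
    (is_derive_ray _ 0) (is_derive_row_const 0 0)) => //.
  rewrite sum_delta_mx scale0r big1 ?addr0// => m _; by rewrite mxE mul0r.
have F a l b : is_derive (0 : R) (1 : R)
    (fun s : R => frame (s *: delta_mx 0 a) l b) (bil a b l).
  apply: is_derive_ext (is_derive_frame l b (is_derive_ray _ 0)) => //.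
  by rewrite sum_delta_mx scale0r.
have S a b c : is_derive (0 : R) (1 : R)
   (fun s : R => \sum_l frame (s *: delta_mx 0 a) l b * dframe l (s *: delta_mx 0 a) j c)
   (\sum_l bil a b l * bil l c j + T a b c).
  have DS := is_derive_bigsum (index_enum 'I_n) (P := xpredT)
    (fun l _ => is_derive_mul (F a l b) (D a l c)).
  apply: is_derive_ext DS => //; rewrite big_split/=; congr (_ + _).
    by apply: eq_bigr => l _; rewrite scale0r.
  rewrite -(sum_delta (fun l => T a l c)); apply: eq_bigr => l _.
  by rewrite scale0r frame0.
have E a b c : \sum_l bil a b l * bil l c j + T a b c -
    (\sum_l bil a c l * bil l b j + T a c b) =
    \sum_l bil a l j * (bil b c l - bil c b l).
  have DS := is_derive_bigsum (index_enum 'I_n) (P := xpredT)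
    (fun l _ => is_derive_mul (F a j l) (is_derive_const (struct_const b c l) 0)).
  have DN := is_derive_mul (is_derive_const (-1) 0) (S a c b).
  have := is_derive_inj_ext _ (is_derive_add (S a b c) DN) DS.
  rewrite mul0r add0r mulN1r => ->; last by move=> s /=; rewrite mulN1r maurer_cartan.
  by apply: eq_bigr => l _; rewrite mulr0 addr0.
have {}E a b c : \sum_l bil a b l * bil l c j + T a b c -
    (\sum_l bil a c l * bil l b j + T a c b) =
    - (\sum_l bil b c l * bil l a j) *+ 2.
  rewrite E -sumrN -sumrMnl; apply: eq_bigr => l _.
  by rewrite (bil_antisym c b) (bil_antisym a l); ring.
have A a b c : \sum_l bil a b l * bil l c j = - \sum_l bil b a l * bil l c j.
  by rewrite -sumrN; apply: eq_bigr => l _; rewrite (bil_antisym b a); ring.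
have := (E h i k, E i k h, E k h i).
rewrite (A h k i) (A i h k) (A k i h) (TC i h k) (TC k h i) (TC i k h).
rewrite !big_split/=.
move: (\sum_l _) (\sum_l _) (\sum_l _) => a b c [[e1 e2] e3].
lra.
Qed.
End GroupCalculus.

(** * The Jacobi identity in terms of structure constants *)

Section BracketOf.
Context {R : realType} (n : nat) (b : 'I_n -> 'I_n -> 'I_n -> R).
Implicit Types (u v z : 'I_n -> R) (j : 'I_n).

(** The bracket built from half its structure constants, hence the factor 2. It is stated for
    arbitrary arrays [b], so that the Jacobi identity becomes pure index manipulation. *)
Definition bracket_of u v j : R := \sum_i \sum_k u i * v k * b i k j *+ 2.

Lemma sum_exch3 (F : 'I_n -> 'I_n -> 'I_n -> R) :
  \sum_i \sum_j \sum_k F i j k = \sum_j \sum_k \sum_i F i j k.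
Proof. by rewrite exchange_big/=; apply: eq_bigr => j _; rewrite exchange_big. Qed.

Lemma bracket_of_jacobi :
  (forall h i j, b i h j = - b h i j) ->
  (forall h i k j,
    \sum_l (b h i l * b l k j + b i k l * b l h j + b k h l * b l i j) = 0) ->
  forall u v z j, bracket_of (bracket_of u v) z j =
    bracket_of u (bracket_of v z) j - bracket_of v (bracket_of u z) j.
Proof.
move=> b_antisym b_jacobi u v z j.
pose S (F : 'I_n -> 'I_n -> 'I_n -> 'I_n -> R) :=
  \sum_h \sum_i \sum_k \sum_l u h * v i * z k * F h i k l.
have -> : bracket_of (bracket_of u v) z j =
    S (fun h i k l => b h i l * b l k j *+ 4).
  rewrite {1}/bracket_of /S.
  under eq_bigr do under eq_bigr do rewrite /bracket_of !mulr_suml.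
  under [RHS]eq_bigr do under eq_bigr do rewrite exchange_big/=.
  under [RHS]eq_bigr do rewrite exchange_big/=.
  rewrite [RHS]exchange_big/=; apply: eq_bigr => l _.
  rewrite [LHS](_ : _ = \sum_k \sum_h \sum_i
      u h * v i * z k * (b h i l * b l k j *+ 4)); last first.
    apply: eq_bigr => k _; rewrite -sumrMnl; apply: eq_bigr => h _.
    by rewrite !mulr_suml -sumrMnl; apply: eq_bigr => i _; ring.
  by rewrite sum_exch3.
have -> : bracket_of u (bracket_of v z) j =
    S (fun h i k l => - (b i k l * b l h j *+ 4)).
  rewrite {1}/bracket_of /S; apply: eq_bigr => h _.
  rewrite -[RHS]sum_exch3; apply: eq_bigr => l _.
  rewrite /bracket_of mulr_sumr mulr_suml -sumrMnl; apply: eq_bigr => i _.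
  rewrite mulr_sumr mulr_suml -sumrMnl; apply: eq_bigr => k _.
  rewrite (b_antisym l h j); ring.
have -> : bracket_of v (bracket_of u z) j =
    S (fun h i k l => b k h l * b l i j *+ 4).
  rewrite {1}/bracket_of /S [RHS]exchange_big/=; apply: eq_bigr => i _.
  rewrite -[RHS]sum_exch3; apply: eq_bigr => l _.
  rewrite /bracket_of mulr_sumr mulr_suml -sumrMnl; apply: eq_bigr => h _.
  rewrite mulr_sumr mulr_suml -sumrMnl; apply: eq_bigr => k _.
  rewrite (b_antisym l i j) (b_antisym h k l); ring.
apply/eqP; rewrite -subr_eq0 opprB addrA [X in X == _](_ : _ = \sum_h \sum_i \sum_k
   u h * v i * z k * (\sum_l (b h i l * b l k j + b i k l * b l h j +
   b k h l * b l i j)) *+ 4); last first.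
  rewrite /S -big_split/= -sumrB; apply: eq_bigr => h _.
  rewrite -big_split/= -sumrB; apply: eq_bigr => i _.
  rewrite -big_split/= -sumrB; apply: eq_bigr => k _.
  rewrite -big_split/= -sumrB mulr_sumr -sumrMnl; apply: eq_bigr => l _; ring.
rewrite big1// => h _; rewrite big1// => i _; rewrite big1// => k _.
by rewrite b_jacobi mulr0 mul0rn.
Qed.

End BracketOf.

(** * The Lie bracket and its grading *)

Section LieAlgebra.
Context {R : realType} (G : carnotGroup R).
Local Notation n := (carnot_dim G).
Local Notation w := (@carnot_weight _ G).
Local Notation corr := (@carnot_corr _ G).
Local Notation V := 'rV[R]_n.
Local Notation mul := (group_mul corr).
Implicit Types (x y z u v : V) (j k l : 'I_n).

Lemma is_derive_dir (W : normedModType R) (f : V -> W) (a v : V) d :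
  is_derive (0 : R) (1 : R) (fun s : R => f (a + s *: v)) d -> is_derive a v f d.
Proof.
have E : (fun h : R => h^-1 *: ((f \o shift a) (h *: v) - f a)) =
    (fun h : R => h^-1 *: (((fun s : R => f (a + s *: v)) \o shift 0) (h *: (1 : R)) -
       f (a + 0 *: v))).
  apply/funext => h /=; rewrite scale0r !addr0 [h *: v + a]addrC.
  by have -> : h *: (1 : R) = h by exact: mulr1.
move=> [dv <-]; split; first by rewrite /derivable E.
by rewrite /derive E.
Qed.

Lemma is_derive_rV (U : normedModType R) m (f : U -> 'rV[R]_m) (a v : U) (d : 'rV[R]_m) :
  (forall i : 'I_m, is_derive a v (fun b => f b 0 i) (d 0 i)) -> is_derive a v f d.
Proof.
move=> H; have D : derivable f a v.
  by apply/derivable_mxP => i j; rewrite [i]ord1; case: (H j).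
split => //; rewrite derive_mx//; apply/rowP => j; rewrite mxE.
by case: (H j).
Qed.

Lemma is_derive_coord (U : normedModType R) m (f : U -> 'rV[R]_m) (a v : U) (d : 'rV[R]_m) (j : 'I_m) :
  is_derive a v f d -> is_derive a v (fun b => f b 0 j) (d 0 j).
Proof.
move=> [D <-]; split; first by move/derivable_mxP : D; apply.
by rewrite derive_mx// mxE.
Qed.

Lemma left_fieldE u x j : left_field corr u x 0 j = \sum_k u 0 k * frame x j k.
Proof.
rewrite /left_field.
have -> : 'D_u (mul x) 0 = \row_j \sum_k u 0 k * frame x j k.
  apply: derive_val; apply: is_derive_rV => i; apply: is_derive_dir; rewrite mxE.
  by apply: is_derive_ext (is_derive_mulr0 x u i) => // s; rewrite add0r.
by rewrite mxE.
Qed.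

Lemma lie_bracketE u v j :
  lie_bracket corr u v 0 j = \sum_i \sum_k u 0 i * v 0 k * struct_const i k j.
Proof.
pose r (a b : V) : V := \row_l \sum_i \sum_k a 0 i * b 0 k * dframe i 0 l k.
have D a b : 'D_a (left_field corr b) (0 : V) = r a b.
  apply: derive_val; apply: is_derive_rV => l; apply: is_derive_dir; rewrite mxE.
  have DS := is_derive_bigsum (index_enum 'I_n) (P := xpredT) (fun k _ =>
    is_derive_mul (is_derive_const (b 0 k) 0) (is_derive_frame l k (is_derive_ray a 0))).
  apply: is_derive_ext DS => [s|]; first by rewrite left_fieldE add0r.
  rewrite [RHS]exchange_big/=; apply: eq_bigr => k _.
  rewrite mul0r add0r mulr_sumr; apply: eq_bigr => i _; by rewrite scale0r mulrCA mulrA.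
have -> : lie_bracket corr u v = r u v - r v u.
  exact: (congr2 (fun p q : V => p - q) (D u v) (D v u)).
rewrite 2!mxE [X in _ + X]mxE [X in _ - X]mxE [X in _ - X]exchange_big -sumrB.
apply: eq_bigr => i _; rewrite -sumrB; apply: eq_bigr => k _.
by rewrite /struct_const; ring.
Qed.

Local Opaque lie_bracket frame dframe ev.

Lemma layerP i x : reflect (forall j, w j != i -> x 0 j = 0) (x \in layer w i).
Proof.
apply: (iffP idP) => [|H].
  rewrite /layer; set s := [seq _ | _ <- _ & _].
  rewrite -[s]/(val (in_tuple s)) => /coord_span -> j ji; rewrite summxE big1// => k _.
  rewrite mxE; have : (in_tuple s)`_k \in s by exact: mem_nth.
  case/mapP => l; rewrite mem_filter => /andP[/eqP wl _] ->.
  by rewrite mxE eqxx/=; case: eqP => [jl|]; rewrite ?mulr0//; rewrite jl wl eqxx in ji.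
rewrite (row_sum_delta x); apply: memv_suml => j _.
have [wj|/H ->] := eqVneq (w j) i; last by rewrite scale0r mem0v.
apply: memvZ; apply: memv_span; apply/mapP; exists j => //.
by rewrite mem_filter wj eqxx mem_enum.
Qed.

Lemma struct_const_bil i k l : struct_const i k l = bil i k l *+ 2.
Proof.
rewrite /struct_const -/(bil i k l) -/(bil k i l) (bil_antisym i k) opprK.
by rewrite mulr2n.
Qed.

Lemma lie_bracket0l v : lie_bracket corr 0 v = 0.
Proof.
apply/rowP => j; rewrite lie_bracketE mxE big1// => i _.
by rewrite big1// => k _; rewrite mxE !mul0r.
Qed.

Lemma lie_bracket_row u v :
  lie_bracket corr u v = \row_j bracket_of (@bil _ G) (u 0) (v 0) j.
Proof.
apply/rowP => j; rewrite lie_bracketE mxE; apply: eq_bigr => i _.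
by apply: eq_bigr => k _; rewrite struct_const_bil mulrnAr.
Qed.

Lemma lie_jacobi u v z :
  lie_bracket corr (lie_bracket corr u v) z =
  lie_bracket corr u (lie_bracket corr v z) - lie_bracket corr v (lie_bracket corr u z).
Proof.
have E a b : lie_bracket corr a b 0 = bracket_of (@bil _ G) (a 0) (b 0).
  by apply/funext => j; rewrite lie_bracket_row mxE.
have J := bracket_of_jacobi (@bil_antisym _ G) (@jacobi_bil _ G) (u 0) (v 0) (z 0).
rewrite -(E u v) -(E v z) -(E u z) -(E (lie_bracket corr u v) z)
  -(E u (lie_bracket corr v z)) -(E v (lie_bracket corr u z)) in J.
by apply/rowP => j; rewrite [RHS]mxE [X in _ = _ + X]mxE; exact: J.
Qed.

(** By induction on m, brackets of layers m and p lie in layer m + p: layer m + 1 is spanned by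
    brackets of layers 1 and m, and the Jacobi identity moves the outer bracket inside. Layers
    outside the range from 1 to the step are 0. *)
Lemma struct_const_graded i k l : struct_const i k l != 0 -> w l = (w i + w k)%N.
Proof.
have br a b c : lie_bracket corr (delta_mx 0 a) (delta_mx 0 b) 0 c = struct_const a b c.
  rewrite lie_bracketE (bigD1 a)//= [X in _ + X]big1 ?addr0 => [|h ha]; last first.
    by rewrite big1// => m _; rewrite mxE eqxx (negbTE ha) !mul0r.
  rewrite (bigD1 b)//= big1 ?addr0 => [|h hb]; last first.
    by rewrite [X in _ * X * _]mxE eqxx (negbTE hb) mulr0 mul0r.
  by rewrite !mxE !eqxx !mul1r.
pose P (u v : V) m := lie_bracket corr u v \in layer w m.
have L1 (u v : V) m : u \in layer w 1 -> v \in layer w m -> P u v m.+1.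
  move=> u1 vm; have [mok|mnok] := boolP (1 <= m <= carnot_step G)%N.
    have /seteqP[H _] := @carnot_stratified _ G m mok; apply: H => U HU.
    by apply: HU; exists (u, v).
  have v0 : v = 0.
    apply/rowP => j; rewrite mxE; move/layerP : vm; apply.
    by apply: contra mnok => /eqP <-; exact: carnot_weightP.
  apply/layerP => j _; rewrite lie_bracketE big1// => a _; rewrite big1// => b _.
  by rewrite v0 mxE mulr0 mul0r.
have P0 u m : ~~ (1 <= m <= carnot_step G)%N -> u \in layer w m -> u = 0.
  move=> m0 um; apply/rowP => j; rewrite mxE; move/layerP : um; apply.
  by apply: contra m0 => /eqP <-; exact: carnot_weightP.
have Pz v m : P 0 v m by rewrite /P lie_bracket0l mem0v.
suff main m : forall u v p, u \in layer w m -> v \in layer w p -> P u v (m + p)%N.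
  move=> ne; have := main (w i) (delta_mx 0 i) (delta_mx 0 k) (w k).
  have dl a : (delta_mx 0 a : V) \in layer w (w a).
    by apply/layerP => b; rewrite mxE eqxx /=; case: (eqVneq b a) => [->|//]; rewrite eqxx.
  move=> /(_ (dl i) (dl k)); rewrite /P => /layerP/(_ l); rewrite br => H.
  by apply/eqP; apply: contraNT ne => /H ->.
elim: m => [|m IH] u v p um vp.
  by rewrite (P0 _ _ _ um)//.
have [mok|mnok] := boolP (1 <= m.+1 <= carnot_step G)%N; last by rewrite (P0 _ _ mnok um).
case: m => [|m] in IH um mok *; first exact: L1.
have mok' : (1 <= m.+1 <= carnot_step G)%N by move: mok => /andP[_ /ltnW ->].
have /seteqP[_ /(_ u um)] := @carnot_stratified _ G m.+1 mok'.
pose M : 'M[R]_n := \matrix_(h, l) \sum_b v 0 b * struct_const h b l.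
have ME z : lie_bracket corr z v = linfun (mulmxr M) z.
  apply/rowP => c; rewrite lfunE/= lie_bracketE [RHS]mxE; apply: eq_bigr => h _.
  by rewrite mxE mulr_sumr; apply: eq_bigr => b _; rewrite mulrA.
(* The span is the intersection of all subspaces containing the brackets; it is tested on the
   preimage of the target layer under z -> [z, v]. *)
move=> /(_ (linfun (mulmxr M) @^-1: layer w (m.+2 + p))%VS).
rewrite -memv_preim -ME; apply => _ [[a b]/= [a1 bm] <-].
rewrite -memv_preim -ME lie_jacobi memvB//.
  by have := L1 _ _ _ a1 (IH _ _ _ bm vp).
by have := IH _ _ _ bm (L1 _ _ _ a1 vp); rewrite /P addnS.
Qed.

End LieAlgebra.

(** * Dilations are automorphisms of the group *)

Section Homogeneity.
Context {R : realType} (G : carnotGroup R).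
Local Notation n := (carnot_dim G).
Local Notation w := (@carnot_weight _ G).
Local Notation corr := (@carnot_corr _ G).
Local Notation V := 'rV[R]_n.
Local Notation mul := (group_mul corr).
Local Notation d2 l p := (mpoly.mderiv (rshift n l) p).
Implicit Types (x y z u v : V) (j k l : 'I_n).

Lemma is_derive_eq0 (f : R -> R) : (forall t, is_derive t (1 : R) f 0) ->
  forall s t, f s = f t.
Proof. by move=> H s t; exact: is_derive_0_is_cst. Qed.

Lemma meval_dep N (p : mpoly.mpoly N R) (S : pred 'I_N) (a b : 'I_N -> R) :
  (forall (m : mpoly.multinom N) i, mpoly.mcoeff m p != 0 ->
     (0 < mpoly.fun_of_multinom m i)%N -> S i) ->
  (forall i, S i -> a i = b i) -> mpoly.meval a p = mpoly.meval b p.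
Proof.
move=> H ab; rewrite !mpoly.mevalE; apply: eq_big_seq => m mp; congr (_ * _).
apply: eq_bigr => i _; have [->|i0] := posnP (mpoly.fun_of_multinom m i).
  by rewrite !expr0.
by congr (_ ^+ _); apply/ab/(H m) => //; rewrite -mpoly.mcoeff_msupp.
Qed.

Lemma mderiv_dep N (p : mpoly.mpoly N R) (S : pred 'I_N) (k : 'I_N) :
  (forall (m : mpoly.multinom N) i, mpoly.mcoeff m p != 0 ->
     (0 < mpoly.fun_of_multinom m i)%N -> S i) ->
  (forall (m : mpoly.multinom N) i, mpoly.mcoeff m (mpoly.mderiv k p) != 0 ->
     (0 < mpoly.fun_of_multinom m i)%N -> S i) /\
  (~~ S k -> mpoly.mderiv k p = 0).
Proof.
move=> H; split=> [m i|Sk].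
  rewrite mpoly.mcoeff_mderiv => mp mi; apply: (H (mpoly.mnm_add m (mpoly.mnm1 k))).
    by apply: contra mp => /eqP ->; rewrite mul0rn.
  by rewrite mpoly.mnmE addn_gt0 mi.
apply/mpoly.mpolyP => m; rewrite mpoly.mcoeff_mderiv mpoly.mcoeff0.
apply/eqP; apply: contraNT Sk => mp; apply: (H (mpoly.mnm_add m (mpoly.mnm1 k))).
  by apply: contra mp => /eqP ->; rewrite mul0rn.
by rewrite !mpoly.mnmE eqxx addn1.
Qed.

Definition low j : pred 'I_(n + n) :=
  [pred i | match fintype.split i with inl i | inr i => w i end < w j]%N.

Lemma low_lshift j i : low j (lshift n i) = (w i < w j)%N.
Proof. by rewrite /low/= (unsplitK (inl i)). Qed.

Lemma low_rshift j i : low j (rshift n i) = (w i < w j)%N.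
Proof. by rewrite /low/= (unsplitK (inr i)). Qed.

Let corr_low j (m : mpoly.multinom (n + n)) (i : 'I_(n + n)) :
  mpoly.mcoeff m (corr j) != 0 -> (0 < mpoly.fun_of_multinom m i)%N -> low j i.
Proof. exact: carnot_triangular. Qed.

Lemma pair_val_dep j x x' y y' :
  (forall i, (w i < w j)%N -> x 0 i = x' 0 i) ->
  (forall i, (w i < w j)%N -> y 0 i = y' 0 i) ->
  forall i, low j i -> pair_val x y i = pair_val x' y' i.
Proof.
move=> hx hy i; rewrite /pair_val; case: (split_ordP i) => l ->.
  by rewrite low_lshift !row_mxEl; exact: hx.
by rewrite low_rshift !row_mxEr; exact: hy.
Qed.

Lemma corr_dep j x x' y y' :
  (forall i, (w i < w j)%N -> x 0 i = x' 0 i) ->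
  (forall i, (w i < w j)%N -> y 0 i = y' 0 i) ->
  ev (corr j) x y = ev (corr j) x' y'.
Proof. by move=> hx hy; apply: meval_dep (@corr_low j) (pair_val_dep hx hy). Qed.

Lemma mul_coord x y j : mul x y 0 j = x 0 j + y 0 j + ev (corr j) x y.
Proof. by rewrite mxE. Qed.

Lemma mderivXU N (k l : 'I_N) :
  mpoly.mderiv k (mpoly.mpolyX R (mpoly.mnm1 l)) = mpoly.mpolyC N (l == k)%:R.
Proof.
rewrite mpoly.mderivX mpoly.mnmE; case: eqP => [->|]; last first.
  by rewrite scale0r mpoly.mpolyC0.
rewrite scale1r (_ : mpoly.mnm_sub _ _ = mpoly.mnm0) ?mpoly.mpolyX0 ?mpoly.mpolyC1//.
by apply/mpoly.mnmP => j; rewrite !mpoly.mnmE subnn.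
Qed.

Lemma d2_mul_poly j k : d2 k (mul_poly j) = mpoly.mpolyC (n + n) (j == k)%:R + d2 k (corr j).
Proof.
rewrite /mul_poly !mpoly.mderivD !mderivXU eq_lrshift mpoly.mpolyC0 add0r.
by rewrite eq_rshift.
Qed.

Lemma frameE x j k : frame x j k = (j == k)%:R + ev (d2 k (corr j)) x 0.
Proof. by rewrite /frame d2_mul_poly /ev mpoly.mevalD mpoly.mevalC. Qed.

Lemma frame_high x j k : (w j <= w k)%N -> frame x j k = (j == k)%:R.
Proof.
move=> jk; rewrite frameE; have [_ ->] := mderiv_dep (rshift n k) (@corr_low j).
  by rewrite /ev mpoly.meval0 addr0.
by rewrite low_rshift -leqNgt.
Qed.

Lemma frame_dep x y j k : (forall i, (w i < w j)%N -> x 0 i = y 0 i) ->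
  frame x j k = frame y j k.
Proof.
move=> hx; rewrite !frameE; congr (_ + _).
have [H _] := mderiv_dep (rshift n k) (@corr_low j).
by apply: meval_dep H _; exact: pair_val_dep.
Qed.

Local Opaque frame dframe ev.

Local Notation dil r := (carnot_dilation (G := G) r).

Lemma dilE r x j : dil r x 0 j = r ^+ w j * x 0 j.
Proof. by rewrite mxE. Qed.

Lemma ad_dil r x k l : r != 0 -> ad (dil r x) k l * r ^+ w k = r ^+ w l * ad x k l.
Proof.
move=> r0; rewrite /ad mulr_suml mulr_sumr; apply: eq_bigr => i _.
have [->|/struct_const_graded ->] := eqVneq (struct_const i k l) 0.
  by rewrite !(mulr0, mul0r).
by rewrite dilE exprD; ring.
Qed.

Lemma ad_low x k l : (w l <= w k)%N -> ad x k l = 0.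
Proof.
move=> lk; rewrite /ad big1// => i _.
have [->|/struct_const_graded wl] := eqVneq (struct_const i k l) 0.
  by rewrite mulr0.
have /andP[wi _] := @carnot_weightP _ G i; lia.
Qed.

(* Both sides solve the radial equation t f' = f - f^2 + t f ad with the same
   nilpotent ad; entrywise the difference D satisfies (t D)' = 0, by induction
   on the difference of the weights. *)
Lemma frame_dil r x j k : r != 0 ->
  frame (dil r x) j k * r ^+ w k = r ^+ w j * frame x j k.
Proof.
(* The parameter t runs along the ray through x, on which the radial equation becomes an ordinary
   differential equation in t. *)
move=> r0; suff H : forall m t j k, (w j <= w k + m)%N ->
    frame (t *: dil r x) j k * r ^+ w k = r ^+ w j * frame (t *: x) j k.
  by have := H (w j) 1 j k; rewrite !scale1r; apply; rewrite leq_addl.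
elim=> [|m IH] t {}j {}k jk.
  rewrite addn0 in jk; rewrite !frame_high//; case: eqP => [->|_].
    by rewrite mulr1 mul1r.
  by rewrite mulr0 mul0r.
have [jk0|jk0] := leqP (w j) (w k).
  by rewrite !frame_high//; case: eqP => [->|_]; rewrite !(mulr1, mul1r, mulr0, mul0r).
have njk : j != k by apply: contraTneq jk0 => ->; rewrite ltnn.
pose D t := frame (t *: dil r x) j k * r ^+ w k - r ^+ w j * frame (t *: x) j k.
have radial y s : s * (\sum_l y 0 l * dframe l (s *: y) j k) =
    frame (s *: y) j k - \sum_l frame (s *: y) j l * frame (s *: y) l k
    + \sum_l frame (s *: y) j l * (s * ad y k l).
  have -> : s * (\sum_l y 0 l * dframe l (s *: y) j k) =
      \sum_l (s *: y) 0 l * dframe l (s *: y) j k.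
    by rewrite mulr_sumr; apply: eq_bigr => l _; rewrite mxE mulrA.
  rewrite frame_radial; congr (_ + _); apply: eq_bigr => l _; congr (_ * _).
  by rewrite /ad mulr_sumr; apply: eq_bigr => i _; rewrite mxE mulrA.
have dD s : is_derive s (1 : R) D
    ((\sum_l dil r x 0 l * dframe l (s *: dil r x) j k) * r ^+ w k
     - r ^+ w j * (\sum_l x 0 l * dframe l (s *: x) j k)).
  have h1 := is_derive_mul (is_derive_frame j k (is_derive_ray (dil r x) s))
    (is_derive_const (r ^+ w k) s).
  have h2 := is_derive_mul (is_derive_const (- r ^+ w j) s)
    (is_derive_frame j k (is_derive_ray x s)).
  by apply: is_derive_ext (is_derive_add h1 h2) => [a|];
    rewrite ?mulr0 ?addr0 ?mul0r ?add0r mulNr.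
have tD0 : forall s, s * ((\sum_l dil r x 0 l * dframe l (s *: dil r x) j k) * r ^+ w k
     - r ^+ w j * (\sum_l x 0 l * dframe l (s *: x) j k)) = - D s.
  move=> s.
  have -> : forall a b c d : R, s * (a * b - c * d) = (s * a) * b - c * (s * d).
    by move=> a b c d; ring.
  rewrite !radial.
  (* The terms l = j and l = k give twice the entry itself, so f - f^2 contributes -f; every other l
     lies strictly between and has smaller weight gaps, covered by the induction. *)
  have quad y : \sum_l frame (s *: y) j l * frame (s *: y) l k =
      frame (s *: y) j k *+ 2 +
      \sum_(l | (w k < w l < w j)%N) frame (s *: y) j l * frame (s *: y) l k.
    rewrite (bigD1 j)//= (bigD1 k)//=; last by rewrite eq_sym.
    rewrite (frame_high _ (leqnn (w j))) (frame_high _ (leqnn (w k))) !eqxx.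
    rewrite mul1r mulr1 addrA mulr2n; congr (_ + _).
    rewrite (bigID (fun l => w k < w l < w j)%N)/= [X in _ + X]big1 ?addr0.
      apply: eq_bigl => l; case H : (w k < w l < w j)%N; rewrite ?andbF//.
      by move/andP: H => [a b]; rewrite andbT; apply/andP; split;
        [apply: contraTneq b => ->|apply: contraTneq a => ->]; rewrite ltnn.
    move=> l /andP[/andP[lj lk]]; rewrite negb_and -!leqNgt => /orP[h|h].
      by rewrite (frame_high _ h) (negbTE lk) mulr0.
    by rewrite (frame_high _ h) eq_sym (negbTE lj) mul0r.
  have lin y : \sum_l frame (s *: y) j l * (s * ad y k l) =
      \sum_(l | (w k < w l)%N) frame (s *: y) j l * (s * ad y k l).
    rewrite (bigID (fun l => w k < w l)%N)/= [X in _ + X]big1 ?addr0// => l.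
    by rewrite -leqNgt => h; rewrite ad_low// !mulr0.
  rewrite !quad !lin.
  have -> : \sum_(l | (w k < w l < w j)%N) frame (s *: dil r x) j l * frame (s *: dil r x) l k
    = \sum_(l | (w k < w l < w j)%N) r ^+ w j * frame (s *: x) j l * frame (s *: x) l k / r ^+ w k.
    apply: eq_bigr => l /andP[kl lj].
    have e1 : frame (s *: dil r x) j l * r ^+ w l = r ^+ w j * frame (s *: x) j l.
      by apply: IH; lia.
    have e2 : frame (s *: dil r x) l k * r ^+ w k = r ^+ w l * frame (s *: x) l k.
      by apply: IH; lia.
    have rk : r ^+ w k != 0 by rewrite expf_neq0.
    have rl : r ^+ w l != 0 by rewrite expf_neq0.
    apply: (mulIf rk); rewrite mulfVK// -e1 -[LHS]mulrA e2; ring.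
  have -> : \sum_(l | (w k < w l)%N) frame (s *: dil r x) j l * (s * ad (dil r x) k l) =
     \sum_(l | (w k < w l)%N) r ^+ w j * frame (s *: x) j l * (s * ad x k l) / r ^+ w k.
    apply: eq_bigr => l kl.
    have e1 : frame (s *: dil r x) j l * r ^+ w l = r ^+ w j * frame (s *: x) j l.
      by apply: IH; lia.
    have rk : r ^+ w k != 0 by rewrite expf_neq0.
    by apply: (mulIf rk); rewrite mulfVK// -e1 -!mulrA ad_dil//; ring.
  rewrite -!mulr_suml /D.
  have rk : r ^+ w k != 0 by rewrite expf_neq0.
  rewrite mulrDl mulrBl mulrDl !mulfVK//.
  rewrite [X in _ - (_ + X) + _](_ : _ = r ^+ w j * 
    \sum_(l | (w k < w l < w j)%N) frame (s *: x) j l * frame (s *: x) l k); last first.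
    by rewrite mulr_sumr; apply: eq_bigr => l _; rewrite mulrA.
  rewrite [X in _ - (_ + _) + X - _](_ : _ = r ^+ w j * 
    \sum_(l | (w k < w l)%N) frame (s *: x) j l * (s * ad x k l)); last first.
    by rewrite mulr_sumr; apply: eq_bigr => l _; rewrite !mulrA.
  ring.
have cst : forall s s', s * D s = s' * D s'.
  apply: is_derive_eq0 => s.
  have hid : is_derive s (1 : R) (fun a : R => a) 1 by exact: is_derive_id.
  by apply: is_derive_ext (is_derive_mul hid (dD s)) => //=; rewrite mul1r tD0 subrr.
have [->|t0] := eqVneq t 0.
  by rewrite !scale0r !frame0 (negbTE njk) mulr0 mul0r.
apply/eqP; rewrite -subr_eq0 -/(D t); have /eqP := cst t 0.
by rewrite mul0r mulf_eq0 (negbTE t0).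
Qed.

(** The curve is an integral curve of the left-invariant field of u at every time, not only at 0,
    because that field has the constant value u along its own ray ([frame_exp]). *)
Lemma is_derive_flow z u l s : is_derive s (1 : R) (fun a : R => mul z (a *: u) 0 l)
  (\sum_k u 0 k * frame (mul z (s *: u)) l k).
Proof.
apply: is_derive_ext (is_derive_mulr z l (is_derive_ray u s)) => //.
under [RHS]eq_bigr do rewrite -frame_mul mulr_sumr.
rewrite exchange_big/=; apply: eq_bigr => i _.
transitivity ((\sum_k u 0 k * frame (s *: u) i k) * ev (d2 i (mul_poly l)) z (s *: u)).
  congr (_ * _); have [->|s0] := eqVneq s 0.
    rewrite scale0r -[LHS](sum_delta (fun k => u 0 k)); apply: eq_bigr => k _.
    by rewrite frame0 eq_sym mulrC.
  apply: (mulfI s0); rewrite mulr_sumr; transitivity ((s *: u) 0 i); first by rewrite mxE.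
  by rewrite -[LHS]frame_exp; apply: eq_bigr => k _; rewrite mxE mulrA.
by rewrite mulr_suml; apply: eq_bigr => k _; rewrite mulrA.
Qed.

(* Both sides, as functions of the length of y, are integral curves of the same
   left-invariant field. *)
Lemma mul_dil r x y : r != 0 -> mul (dil r x) (dil r y) = dil r (mul x y).
Proof.
move=> r0; suff H m t j : (w j <= m)%N ->
    mul (dil r x) (t *: dil r y) 0 j = r ^+ w j * mul x (t *: y) 0 j.
  by apply/rowP => j; rewrite dilE -(scale1r (dil r y)) (H (w j))// scale1r.
elim: m t j => [|m IH] t j jm.
  by have /andP[] := @carnot_weightP _ G j; rewrite lt0n; move: jm; rewrite leqn0 => /eqP ->.
pose D s := mul (dil r x) (s *: dil r y) 0 j - r ^+ w j * mul x (s *: y) 0 j.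
have cst : forall s s', D s = D s'.
  apply: is_derive_eq0 => s.
  apply: is_derive_ext (is_derive_add (is_derive_flow (dil r x) (dil r y) j s)
     (is_derive_mul (is_derive_const (- r ^+ w j) s) (is_derive_flow x y j s))) => [a|].
    by rewrite mulNr.
  rewrite mul0r add0r mulr_sumr -big_split big1//= => k _.
  have -> : frame (mul (dil r x) (s *: dil r y)) j k = frame (dil r (mul x (s *: y))) j k.
    by apply: frame_dep => i ij; rewrite dilE IH//; lia.
  rewrite dilE mulrAC -[_ * _ * y 0 k](_ : frame (dil r (mul x (s *: y))) j k * r ^+ w k * y 0 k = _).
    by rewrite frame_dil//; ring.
  by ring.
have := cst t 0; rewrite /D !scale0r !mulx0 dilE subrr => /eqP.
by rewrite subr_eq0 => /eqP.
Qed.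

End Homogeneity.

(** * Commutators and horizontal words *)

Section Commutators.
Context {R : realType} (G : carnotGroup R).
Local Notation n := (carnot_dim G).
Local Notation w := (@carnot_weight _ G).
Local Notation corr := (@carnot_corr _ G).
Local Notation V := 'rV[R]_n.
Local Notation mul := (group_mul corr).
Local Notation dil r := (carnot_dilation (G := G) r).
Implicit Types (x y z u v a b : V) (j k l : 'I_n).
Local Opaque frame dframe ev lie_bracket.

(** In coordinates, the i-th term of the lower central series. *)
Definition tail (i : nat) x : Prop := forall j, (w j < i)%N -> x 0 j = 0.
Definition bnd (M : R) x : Prop := forall j, `|x 0 j| <= M.

Lemma weight_gt0 j : (0 < w j)%N.
Proof. by have /andP[] := @carnot_weightP _ G j. Qed.

Lemma corr0r j x : ev (corr j) x 0 = 0.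
Proof. by have := mul_coord x 0 j; rewrite mulx0 mxE addr0 -[LHS]addr0 => /addrI. Qed.

Lemma corr0l j x : ev (corr j) 0 x = 0.
Proof. by have := mul_coord 0 x j; rewrite mul0 mxE add0r -[LHS]addr0 => /addrI. Qed.

(** The correction of a coordinate of weight at most i only sees coordinates of smaller weight,
    where y vanishes, and [ev (corr j) x 0] is 0. *)
Lemma mul_tailr i x y j : tail i y -> (w j <= i)%N -> mul x y 0 j = x 0 j + y 0 j.
Proof.
move=> ty ji; rewrite mul_coord -[X in _ + X](_ : 0 = _) ?addr0//.
rewrite -(corr0r j x); apply: corr_dep => // l lj; rewrite mxE ty//.
exact: leq_trans lj ji.
Qed.

Lemma mul_inv x y : mul (- y) (- x) = - mul x y.
Proof.
have h : mul (mul x y) (mul (- y) (- x)) = 0.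
  by rewrite mulA -(mulA x) mulxV mulx0 mulxV.
by rewrite -[LHS](mulKx (mul x y)) h mulx0.
Qed.

(** Write y as the product of x and the quotient, and apply [mul_tailr] one weight at a time. *)
Lemma mul_sub_tail m x y : (forall j, (w j <= m)%N -> x 0 j = y 0 j) ->
  tail m.+1 (mul (- x) y) /\
  forall j, w j = m.+1 -> mul (- x) y 0 j = y 0 j - x 0 j.
Proof.
move=> xy; have T : tail m.+1 (mul (- x) y).
  move=> j; move: {2}(w j) (leqnn (w j)) => p; elim: p => [|p IH] in j *.
    by rewrite leqn0 -[_ == _]negbK -lt0n weight_gt0.
  rewrite leq_eqVlt => /predU1P[wj|]; last by rewrite ltnS => /IH.
  rewrite wj ltnS => pm.
  have tz : tail p.+1 (mul (- x) y).
    by move=> l lp; apply: IH; lia.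
  have := mul_tailr (j := j) x tz; rewrite wj leqnn mulVKx => /(_ isT).
  by rewrite xy ?wj// => e; apply: (addrI (y 0 j)); rewrite addr0 -e.
split => // j wj; have := mul_tailr (j := j) x T; rewrite wj leqnn mulVKx => /(_ isT).
by move=> ->; rewrite addrC addKr.
Qed.

Lemma dil0 x : dil 0 x = 0.
Proof.
by apply/rowP => j; rewrite dilE mxE expr0n eqn0Ngt weight_gt0 mul0r.
Qed.

Lemma is_derive_exp0 m : (0 < m)%N ->
  is_derive (0 : R) (1 : R) (fun r : R => r ^+ m) (m == 1%N)%:R.
Proof.
case: m => // m _; have h : is_derive (0 : R) (1 : R) (fun r : R => r) 1.
  exact: is_derive_id.
have [d hd] : exists d, is_derive (0 : R) (1 : R) (fun r : R => r ^+ m) d.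
  elim: m => [|m [d hd]]; first by exists 0; exact: is_derive_const.
  exists (1 * 0 ^+ m + 0 * d); apply: is_derive_ext (is_derive_mul h hd) => // r.
  by rewrite exprS.
apply: is_derive_ext (is_derive_mul h hd) => [r|]; first by rewrite exprS.
by rewrite mul0r addr0 mul1r expr0n.
Qed.

(** This entry is homogeneous of degree 1 under dilations, hence equal to its derivative along r ->
    [dil r x] at r = 0, which only sees the coordinates of weight 1. *)
Lemma frame_next x j k : w j = (w k).+1 -> frame x j k = \sum_l x 0 l * bil l k j.
Proof.
move=> jk; have njk : j != k by apply: contra_eqN jk => /eqP ->; rewrite -[X in X == _]addn0 -addn1 eqn_add2l.
have lin r : frame (dil r x) j k = r * frame x j k.
  have [->|r0] := eqVneq r 0; first by rewrite dil0 frame0 (negbTE njk) mul0r.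
  have rk : r ^+ w k != 0 by rewrite expf_neq0.
  by apply: (mulIf rk); rewrite frame_dil// jk exprS; ring.
have h1 : is_derive (0 : R) (1 : R) (fun r : R => frame (dil r x) j k) (frame x j k).
  have hid : is_derive (0 : R) (1 : R) (fun r : R => r) 1 by exact: is_derive_id.
  apply: is_derive_ext (is_derive_mul hid (is_derive_const (frame x j k) 0)) => [r|].
    by rewrite lin.
  by rewrite mul1r mulr0 addr0.
pose y : V := \row_l ((w l == 1%N)%:R * x 0 l).
have h2 : forall l, is_derive (0 : R) (1 : R) (fun r : R => dil r x 0 l) (y 0 l).
  move=> l; apply: is_derive_ext (is_derive_mul (is_derive_exp0 (weight_gt0 l))
    (is_derive_const (x 0 l) 0)) => [r|]; first by rewrite dilE.
  by rewrite mulr0 addr0 mxE.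
rewrite (is_derive_inj h1 (is_derive_frame j k h2)) dil0; apply: eq_bigr => l _.
rewrite mxE -/(bil l k j); case: eqP => [_|wl]; first by rewrite mul1r.
have [->|ne] := eqVneq (bil l k j) 0; first by rewrite !mulr0.
have := @struct_const_graded _ _ l k j; rewrite struct_const_bil mulrn_eq0/= ne.
by move=> /(_ isT); rewrite jk -add1n => /addIn /esym.
Qed.

Lemma bil_graded l k j : bil l k j != 0 -> w j = (w l + w k)%N.
Proof.
move=> ne; have := @struct_const_graded _ _ l k j.
by rewrite struct_const_bil mulrn_eq0/= ne; exact.
Qed.

(** The first commutator term of the Baker-Campbell-Hausdorff formula, found by integrating the flow
    of b from a. The velocity depends on the time s only through a form quadratic in b, which
    vanishes because [bil] is antisymmetric. *)
Lemma mul_next i a b j : tail i b -> w j = i.+1 ->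
  mul a b 0 j = a 0 j + b 0 j + \sum_k \sum_l a 0 l * b 0 k * bil l k j.
Proof.
move=> tb wj; set B := \sum_k _.
have dB s : \sum_k b 0 k * frame (mul a (s *: b)) j k = b 0 j + B.
  have tsb : tail i (s *: b) by move=> l li; rewrite mxE tb// mulr0.
  transitivity (\sum_k b 0 k * ((j == k)%:R + \sum_l (a 0 l + s * b 0 l) * bil l k j)).
    apply: eq_bigr => k _; have [ki|ik|ki] := ltngtP (w k) i.
    - by rewrite tb// !mul0r.
    - rewrite frame_high ?wj//; congr (_ * _).
      rewrite big1 ?addr0// => l _; have [->|/bil_graded] := eqVneq (bil l k j) 0.
        by rewrite mulr0.
      by rewrite wj => e; have := weight_gt0 l; lia.
    - congr (_ * _); rewrite frame_next ?wj ?ki//.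
      rewrite (_ : (j == k) = false) ?add0r; last first.
        by apply/negbTE; apply: contra_eqN wj => /eqP ->; rewrite ki; lia.
      apply: eq_bigr => l _; have [->|/bil_graded] := eqVneq (bil l k j) 0.
        by rewrite !mulr0.
      rewrite wj ki => e; congr (_ * _); rewrite (mul_tailr _ tsb) ?mxE//.
      have := weight_gt0 k; lia.
  transitivity (b 0 j + B + s * \sum_k \sum_l b 0 l * b 0 k * bil l k j).
    rewrite /B -addrA mulr_sumr -big_split/=.
    rewrite -[X in X + _](sum_delta (fun l => b 0 l)) -big_split/=.
    apply: eq_bigr => k _; rewrite mulrDr eq_sym mulrC; congr (_ + _).
    rewrite !mulr_sumr -big_split/=; apply: eq_bigr => l _; ring.
  suff -> : \sum_k \sum_l b 0 l * b 0 k * bil l k j = 0 by rewrite mulr0 addr0.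
  have E : \sum_k \sum_l b 0 l * b 0 k * bil l k j =
      - \sum_k \sum_l b 0 l * b 0 k * bil l k j.
    rewrite {1}exchange_big -sumrN; apply: eq_bigr => k _ /=; rewrite -sumrN.
    by apply: eq_bigr => l _; rewrite bil_antisym; ring.
  lra.
pose D s := mul a (s *: b) 0 j - s * (b 0 j + B).
have cst : forall s s', D s = D s'.
  apply: is_derive_eq0 => s.
  have hid : is_derive s (1 : R) (fun r : R => r) 1 by exact: is_derive_id.
  apply: is_derive_ext (is_derive_add (is_derive_flow a b j s)
    (is_derive_mul hid (is_derive_const (- (b 0 j + B)) s))) => [r|].
    by rewrite mulrN.
  by rewrite dB mul1r mulr0 addr0 subrr.
have := cst 1 0; rewrite /D scale1r scale0r mulx0 mul1r mul0r subr0 => <-.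
by rewrite -addrA subrK.
Qed.

(** In weight i + 1 the half-brackets of ab and ba have opposite signs, so their difference is the
    full bracket. The product ba is written as the inverse of (-a)(-b), to have the tail factor on
    the right again. *)
Lemma commutator_tail i a b : tail i b ->
  tail i.+1 (mul (- mul b a) (mul a b)) /\
  forall j, w j = i.+1 ->
    mul (- mul b a) (mul a b) 0 j = lie_bracket corr a b 0 j.
Proof.
move=> tb; have tnb : tail i (- b) by move=> j ji; rewrite mxE tb// oppr0.
have bal j : (w j <= i)%N -> mul b a 0 j = b 0 j + a 0 j.
  move=> ji; rewrite -[mul b a]opprK -mul_inv mxE (mul_tailr _ tnb)// !mxE.
  by rewrite opprD !opprK addrC.
have [T E] : tail i.+1 (mul (- mul b a) (mul a b)) /\
    forall j, w j = i.+1 -> mul (- mul b a) (mul a b) 0 j = mul a b 0 j - mul b a 0 j.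
  by apply: mul_sub_tail => j ji; rewrite bal// (mul_tailr _ tb)// addrC.
split => // j wj; rewrite E//.
rewrite -[mul b a]opprK -mul_inv [X in _ - X]mxE (mul_next _ tb wj) (mul_next _ tnb wj).
rewrite lie_bracketE.
have -> : \sum_k \sum_l (- a) 0 l * (- b) 0 k * bil l k j =
    \sum_k \sum_l a 0 l * b 0 k * bil l k j.
  by apply: eq_bigr => k _; apply: eq_bigr => l _; rewrite !mxE; ring.
have -> : \sum_l \sum_k a 0 l * b 0 k * struct_const l k j =
    (\sum_k \sum_l a 0 l * b 0 k * bil l k j) *+ 2.
  rewrite exchange_big -sumrMnl; apply: eq_bigr => k _ /=; rewrite -sumrMnl.
  by apply: eq_bigr => l _; rewrite struct_const_bil mulrnAr.
rewrite !mxE; ring.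
Qed.
End Commutators.

(** * Points as bounded products of horizontal elements *)

Section Words.
Context {R : realType} (G : carnotGroup R).
Local Notation n := (carnot_dim G).
Local Notation w := (@carnot_weight _ G).
Local Notation corr := (@carnot_corr _ G).
Local Notation V := 'rV[R]_n.
Local Notation mul := (group_mul corr).
Local Notation dil r := (carnot_dilation (G := G) r).
Implicit Types (x y z u v a b : V) (j k l : 'I_n).
Local Opaque frame dframe ev lie_bracket.

Definition word_eval (s : seq V) : V := foldr (fun x y => mul x y) 0 s.
Definition hword (s : seq V) : Prop := forall x, x \in s -> x \in layer w 1.

Lemma word_eval_cat s t : word_eval (s ++ t) = mul (word_eval s) (word_eval t).
Proof.
elim: s => [|x s IH]; first by rewrite mul0.
by rewrite /= IH mulA.
Qed.

Lemma word_eval_opp s : word_eval (rev (map -%R s)) = - word_eval s.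
Proof.
elim: s => [|x s IH]; first by rewrite /= oppr0.
by rewrite map_cons rev_cons -cats1 word_eval_cat IH /= mulx0 mul_inv.
Qed.

Lemma word_eval_dil r s : r != 0 ->
  word_eval (map (fun x => dil r x) s) = dil r (word_eval s).
Proof.
move=> r0; elim: s => [|x s IH] /=.
  by apply/rowP => j; rewrite dilE mxE mulr0.
by rewrite IH mul_dil.
Qed.

Lemma dil_layer1 r x : x \in layer w 1 -> dil r x = r *: x.
Proof.
move=> /layerP x1; apply/rowP => j; rewrite dilE mxE.
by have [->|/x1 ->] := eqVneq (w j) 1%N; rewrite ?expr1// !mulr0.
Qed.

Lemma hword_cat s t : hword s -> hword t -> hword (s ++ t).
Proof. by move=> hs ht x; rewrite mem_cat => /orP[/hs|/ht]. Qed.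

Lemma hword_opp s : hword s -> hword (rev (map -%R s)).
Proof. by move=> hs x; rewrite mem_rev => /mapP[y /hs ys ->]; rewrite memvN. Qed.

Lemma hword_dil r s : hword s -> hword (map (fun x => dil r x) s).
Proof. by move=> hs x /mapP[y /hs ys ->]; rewrite dil_layer1// memvZ. Qed.

Lemma rootn (c : R) i : (0 < i)%N -> 0 < c -> exists2 r, 0 < r & r ^+ i = c.
Proof.
move=> i0 c0; exists (expR (ln c / i%:R)); first exact: expR_gt0.
rewrite -expRM_natl mulrC divfK ?lnK// pnatr_eq0; lia.
Qed.

(** Only the leading layer of the word is prescribed; the heavier coordinates are left free. This
    makes the reachable x closed under sums, scalars and brackets with layer 1, and [word_peel]
    later corrects the remainder. *)
Definition hit i x : Prop := exists s, [/\ hword s, tail i (word_eval s) &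
  forall j, w j = i -> word_eval s 0 j = x 0 j].

Lemma hit0 i : hit i 0.
Proof. by exists [::]; split => // j _; rewrite mxE. Qed.

Lemma hitD i x y : hit i x -> hit i y -> hit i (x + y).
Proof.
move=> [s [hs ts es]] [t [ht tt et]]; exists (s ++ t); rewrite word_eval_cat.
split; first exact: hword_cat.
  by move=> j ji; rewrite (mul_tailr _ tt) ?(ltnW ji)// ts// tt// addr0.
by move=> j ji; rewrite (mul_tailr _ tt) ?ji// es// et// mxE.
Qed.

(** A positive scalar c is realised by the dilation of ratio c^(1/i), which multiplies layer i by c;
    signs come from inverting the word. *)
Lemma hitZ i c x : (0 < i)%N -> hit i x -> hit i (c *: x).
Proof.
move=> i0; have pos e y : 0 < e -> hit i y -> hit i (e *: y).
  move=> e0 [s [hs ts es]]; have [r r0 re] := rootn i0 e0.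
  exists (map (fun x => dil r x) s); rewrite word_eval_dil ?gt_eqF//.
  split; first exact: hword_dil.
    by move=> j ji; rewrite dilE ts// mulr0.
  by move=> j ji; rewrite dilE ji re es// mxE.
move=> hx; have [c0|c0|->] := ltgtP c 0; last by rewrite scale0r; exact: hit0.
  rewrite -[c]opprK scaleNr -scalerN; apply: pos; first by rewrite oppr_gt0.
  have [s [hs ts es]] := hx; exists (rev (map -%R s)); rewrite word_eval_opp.
  split; first exact: hword_opp.
    by move=> j ji; rewrite mxE ts// oppr0.
  by move=> j ji; rewrite !mxE es.
exact: pos.
Qed.

Lemma hit_bracket i a b : a \in layer w 1 -> hit i b ->
  exists2 y, hit i.+1 y & forall j, w j = i.+1 -> y 0 j = lie_bracket corr a b 0 j.
Proof.
move=> a1 [s [hs ts es]]; set b' := word_eval s in ts es.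
have [T E] := commutator_tail a ts.
exists (mul (- mul b' a) (mul a b')).
  exists (rev (map -%R (s ++ [:: a])) ++ (a :: s)); split.
  - apply: hword_cat; first apply: hword_opp; first apply: hword_cat => //.
      by move=> z; rewrite inE => /eqP ->.
    by move=> z; rewrite inE => /predU1P[->//|/hs].
  - by rewrite word_eval_cat word_eval_opp word_eval_cat/= mulx0.
  - by move=> j _; rewrite word_eval_cat word_eval_opp word_eval_cat/= mulx0.
move=> j wj; rewrite (E j wj) [LHS]lie_bracketE [RHS]lie_bracketE.
apply: eq_bigr => k _; apply: eq_bigr => l _.
have [->|/struct_const_graded e] := eqVneq (struct_const k l j) 0; first by rewrite !mulr0.
have [wk|wk] := eqVneq (w k) 1%N; last by rewrite (layerP _ _ a1 k wk) !mul0r.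
by congr (_ * _ * _); apply: es; move: e; rewrite wj wk; lia.
Qed.

Lemma hit_ext i x y : (forall j, w j = i -> x 0 j = y 0 j) -> hit i x -> hit i y.
Proof. by move=> xy [s [hs ts es]]; exists s; split => // j ji; rewrite es// xy. Qed.

Lemma lie_bracket_lin u v :
  lie_bracket corr u v = \sum_i \sum_k (u 0 i * v 0 k) *:
    lie_bracket corr (delta_mx 0 i) (delta_mx 0 k).
Proof.
apply/rowP => j; rewrite lie_bracketE summxE; apply: eq_bigr => i _.
rewrite summxE; apply: eq_bigr => k _; rewrite [RHS]mxE; congr (_ * _).
rewrite lie_bracketE -[LHS](sum_delta (fun i => struct_const i k j)).
apply: eq_bigr => i' _; rewrite -(sum_delta (fun k => struct_const i' k j)) mulr_sumr.
by apply: eq_bigr => k' _; rewrite !mxE !eqxx mulrA.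
Qed.

Lemma hit_layer i x : (0 < i)%N -> x \in layer w i -> hit i x.
Proof.
elim: i x => // -[|i] IH x _ xi.
  exists [:: x]; split => /=; rewrite ?mulx0//.
    by move=> z; rewrite inE => /eqP ->.
  by move=> j; rewrite ltnS leqn0 => /eqP wj; have := weight_gt0 j; rewrite wj.
have [iok|iok] := boolP (1 <= i.+1 <= carnot_step G)%N; last first.
  suff -> : x = 0 by exact: hit0.
  apply/rowP => j; rewrite mxE; move/layerP : xi; apply.
  by have /andP[] := @carnot_weightP _ G j; move: iok => /=; lia.
have /seteqP[_ /(_ x xi)] := @carnot_stratified _ G i.+1 iok.
(* The span is tested on the subspace generated by the finitely many brackets of basis vectors,
   which writes x as a finite linear combination of them. *)
pose I := [seq (c, d) | c <- [seq c <- enum 'I_n | w c == 1%N],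
                        d <- [seq d <- enum 'I_n | w d == i.+1]].
pose br (p : 'I_n * 'I_n) := lie_bracket corr (delta_mx 0 p.1) (delta_mx 0 p.2).
have dl (c : 'I_n) m : w c == m -> (delta_mx 0 c : V) \in layer w m.
  by move=> /eqP <-; apply/layerP => d; rewrite mxE eqxx /=; case: (eqVneq d c) => [->|//]; rewrite eqxx.
move=> /(_ <<map br I>>%VS) xU.
have {xU} : x \in <<map br I>>%VS.
  apply: xU => _ [[a b]/= [/layerP a1 /layerP bi] <-].
  rewrite lie_bracket_lin; apply: memv_suml => k _; apply: memv_suml => l _.
  have [wk|/a1 ->] := eqVneq (w k) 1%N; last by rewrite mul0r scale0r mem0v.
  have [wl|/bi ->] := eqVneq (w l) i.+1; last by rewrite mulr0 scale0r mem0v.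
  apply: memvZ; apply: memv_span; apply/mapP; exists (k, l) => //.
  by apply/allpairsP; exists (k, l); split => //=; rewrite mem_filter mem_enum ?wk ?wl eqxx.
rewrite -[map br I]/(val (in_tuple (map br I))) => /coord_span ->.
apply: big_ind => [|a b|k _]; [exact: hit0|exact: hitD|].
apply: hitZ => //.
have /mapP[[a b] /allpairsP[[a' b']/= [+ + [-> ->]]] ->] : (in_tuple (map br I))`_k \in map br I.
  exact: mem_nth.
rewrite !mem_filter => /andP[wa _] /andP[wb _].
have [y hy ye] := hit_bracket (dl _ _ wa) (IH _ isT (dl _ _ wb)).
exact: hit_ext ye hy.
Qed.

Lemma meval_bounded N (p : mpoly.mpoly N R) (M : R) : exists K : R,
  forall z : 'I_N -> R, (forall i, `|z i| <= M) -> `|mpoly.meval z p| <= K.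
Proof.
exists (\sum_(m <- mpoly.msupp p) `|mpoly.mcoeff m p| *
  \prod_i M ^+ mpoly.fun_of_multinom m i) => a aM.
rewrite mpoly.mevalE; apply: le_trans (ler_norm_sum _ _ _) _.
apply: ler_sum => m _; rewrite normrM ler_wpM2l// normr_prod.
apply: ler_prod => i _; rewrite normr_ge0 normrX /=.
by apply: lerXn2r; rewrite ?nnegrE//; exact: le_trans (aM i).
Qed.

Lemma fin_bound (I : finType) (T : Type) (P : I -> T -> R -> Prop) :
  (forall i, exists K, forall t, P i t K) ->
  (forall i t K K', K <= K' -> P i t K -> P i t K') ->
  exists K, forall i t, P i t K.
Proof.
move=> /choice[K HK] mono; exists (\sum_i `|K i|) => i a.
apply: mono (HK i a); rewrite (bigD1 i)//=; apply: le_trans (ler_norm _) _.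
by rewrite lerDl sumr_ge0.
Qed.

Lemma bnd_le M M' x : M <= M' -> bnd M x -> bnd M' x.
Proof. by move=> MM bx j; exact: le_trans (bx j) MM. Qed.

Lemma mul_bounded M : exists K, forall x y, bnd M x -> bnd M y -> bnd K (mul x y).
Proof.
pose P (j : 'I_n) (p : V * V) (K : R) := bnd M p.1 -> bnd M p.2 -> `|mul p.1 p.2 0 j| <= K.
have [|i a K K' KK h b1 b2|K HK] := @fin_bound _ _ P.
- move=> j; have [K HK] := meval_bounded (mul_poly j) M; exists K => -[x y] bx b_y.
  rewrite group_mulE; apply: HK => i; rewrite /pair_val.
  by case: (split_ordP i) => l ->; rewrite ?row_mxEl ?row_mxEr.
- exact: le_trans (h b1 b2) KK.
- by exists K => x y bx b_y j; exact: (HK j (x, y)).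
Qed.

Lemma word_bounded N K : exists M, forall s, (size s <= N)%N ->
  (forall x, x \in s -> bnd K x) -> bnd M (word_eval s).
Proof.
elim: N => [|N [M HM]].
  by exists 0 => s; rewrite leqn0 => /nilP -> _ j; rewrite mxE normr0.
have [K' HK'] := mul_bounded (Num.max M K).
exists (Num.max `|K'| 0) => -[_ _ j|x s]; first by rewrite mxE normr0 le_max lexx orbT.
rewrite /= ltnS => sN sK; apply: bnd_le (HK' _ _ _ _).
- by rewrite le_max ler_norm.
- by apply: bnd_le (sK x _); rewrite ?le_max ?lexx ?orbT// inE eqxx.
- apply: bnd_le (HM _ sN _); first by rewrite le_max lexx.
  by move=> y ys; apply: sK; rewrite inE ys orbT.
Qed.

(* Coordinates are removed one at a time in order of increasing weight: L is the
   set of those that are left. *)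
Lemma word_peel (L : {set 'I_n}) M :
  (forall j l, j \in L -> (w j < w l)%N -> l \in L) ->
  exists N K, forall x, (forall j, j \notin L -> x 0 j = 0) -> bnd M x ->
    exists s, [/\ hword s, (size s <= N)%N, forall u, u \in s -> bnd K u &
                  word_eval s = x].
Proof.
move: {2}#|L| (leqnn #|L|) => c; elim: c L M => [|c IH] L M Lc Lup.
  exists 0%N, 0 => x xL _; exists [::]; split => //.
  apply/rowP => j; rewrite mxE xL//.
  by move: Lc; rewrite leqn0 cards_eq0 => /eqP ->; rewrite inE.
have [L0|[k0 k0L]] := set_0Vmem L.
  by apply: (IH L M _ Lup); rewrite L0 cards0.
pose k := [arg min_(i < k0 in L) w i]%N.
have [kL kmin] : k \in L /\ forall j, j \in L -> (w k <= w j)%N.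
  by rewrite /k; case: arg_minnP.
have [|s0 [hs0 ts0 es0]] := @hit_layer (w k) (delta_mx 0 k) (weight_gt0 k).
  by apply/layerP => b; rewrite mxE eqxx /=; case: (eqVneq b k) => [->|//]; rewrite eqxx.
pose s0K := \sum_(u <- s0) \sum_j `|u 0 j|.
have s0b u j : u \in s0 -> `|u 0 j| <= s0K.
  move=> us0; rewrite /s0K (big_rem u us0)/=.
  rewrite (bigD1 j)//= -addrA lerDl addr_ge0//; first exact: sumr_ge0.
  by apply: sumr_ge0 => v _; exact: sumr_ge0.
have s0K0 : 0 <= s0K by apply: sumr_ge0 => v _; exact: sumr_ge0.
(* The word for e_k is dilated by r = |c'|^(1/w k), which multiplies its letters by r; this r is at
   most the larger of 1 and M. *)
pose K1 := Num.max 1 M * s0K.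
have one (c' : R) : `|c'| <= M -> exists s, [/\ hword s, (size s <= size s0)%N,
    forall u, u \in s -> bnd K1 u, tail (w k) (word_eval s) &
    forall j, w j = w k -> word_eval s 0 j = c' * (j == k)%:R].
  have pos e : 0 < e -> e <= M -> exists s, [/\ hword s, (size s <= size s0)%N,
    forall u, u \in s -> bnd K1 u, tail (w k) (word_eval s) &
    forall j, w j = w k -> word_eval s 0 j = e * (j == k)%:R].
    move=> e0 eM; have [r r0 re] := rootn (weight_gt0 k) e0.
    have rM : r <= Num.max 1 M.
      rewrite leNgt; apply/negP; rewrite gt_max => /andP[r1 Mr].
      have : r <= r ^+ w k by rewrite -[leLHS]expr1 ler_weXn2l ?(ltW r1)// weight_gt0.
      by rewrite re => /le_lt_trans/(_ (le_lt_trans eM Mr)); rewrite ltxx.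
    exists (map (fun x => dil r x) s0); rewrite word_eval_dil ?gt_eqF//; split.
    - exact: hword_dil.
    - by rewrite size_map.
    - move=> _ /mapP[u us ->] j; rewrite (dil_layer1 _ (hs0 _ us)) mxE normrM.
      by rewrite gtr0_norm// ler_pM// ?(ltW r0)//; exact: s0b.
    - by move=> j ji; rewrite dilE ts0// mulr0.
    - by move=> j ji; rewrite dilE ji re es0// mxE eqxx.
  have [c0|c0|->] := ltgtP c' 0.
  - rewrite ler0_norm ?(ltW c0)// => cM; have [|s [hs ss sb ts es]] := pos (- c') _ cM.
      by rewrite oppr_gt0.
    exists (rev (map -%R s)); rewrite word_eval_opp; split.
    + exact: hword_opp.
    + by rewrite size_rev size_map.
    + move=> u; rewrite mem_rev => /mapP[v vs ->] j; rewrite mxE normrN; exact: sb.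
    + by move=> j ji; rewrite mxE ts// oppr0.
    + by move=> j ji; rewrite mxE es// mulNr opprK.
  - rewrite gtr0_norm// => cM; exact: pos.
  - move=> _; exists [::]; split => // j _; by rewrite mxE// mul0r.
have [M1 HM1] := word_bounded (size s0) K1.
have [M2 HM2] := mul_bounded (Num.max M M1).
have [|j l|N [K HK]] := IH (L :\ k) M2.
- by move: Lc; rewrite (cardsD1 k) kL.
- rewrite !inE => /andP[jk jL] jl; rewrite (Lup j l jL jl) andbT.
  by apply: contraTneq jl => ->; rewrite -leqNgt kmin.
exists (size s0 + N)%N, (Num.max K1 K) => x xL xM.
have [s [hs ss sb ts es]] := one (x 0 k) (xM k).
have xlow j : (w j < w k)%N -> x 0 j = 0.
  by move=> jk; apply: xL; apply: contraTN jk => /kmin; rewrite -leqNgt.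
(* Dividing by the word clears coordinate k, keeps the others of the same weight and disturbs only
   heavier ones, which all belong to L. *)
have [T E] : tail (w k).-1.+1 (mul (- word_eval s) x) /\
    forall j, w j = (w k).-1.+1 -> mul (- word_eval s) x 0 j = x 0 j - word_eval s 0 j.
  apply: mul_sub_tail => j jk.
  have {}jk : (w j < w k)%N by have := weight_gt0 k; lia.
  by rewrite ts// xlow.
have wk1 : (w k).-1.+1 = w k by rewrite prednK// weight_gt0.
rewrite wk1 in T E.
have [j||t [ht tN tK te]] := HK (mul (- word_eval s) x).
- rewrite !inE negb_and negbK => /orP[/eqP ->|jL].
    by rewrite E// es// eqxx mulr1 subrr.
  have [jk|jk] := eqVneq (w j) (w k).
    rewrite E// es// xL// (_ : j == k = false) ?mulr0 ?subrr//.
    by apply: contraNF jL => /eqP ->.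
  apply: T; rewrite ltn_neqAle jk/= leqNgt; apply: contra jL; exact: Lup.
- apply: HM2.
    move=> j; rewrite mxE normrN; apply: bnd_le (HM1 s ss sb) j.
    by rewrite le_max lexx orbT.
  by apply: bnd_le xM; rewrite le_max lexx.
exists (s ++ t); split.
- exact: hword_cat.
- by rewrite size_cat leq_add.
- move=> u; rewrite mem_cat => /orP[/sb|/tK]; apply: bnd_le; by rewrite le_max lexx ?orbT.
- by rewrite word_eval_cat te mulVKx.
Qed.

Lemma word_box : exists N K, forall x, bnd 1 x ->
    exists s, [/\ hword s, (size s <= N)%N, forall u, u \in s -> bnd K u &
                  word_eval s = x].
Proof.
have [//|N [K H]] := @word_peel [set: 'I_n] 1.
  by move=> j l _ _; rewrite inE.
by exists N, K => x; apply: H => j; rewrite inE.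
Qed.
End Words.

(** * The Carnot distance and homogeneous boxes *)

Section Curves.
Context {R : realType} (G : carnotGroup R).
Local Notation n := (carnot_dim G).
Local Notation w := (@carnot_weight _ G).
Local Notation corr := (@carnot_corr _ G).
Local Notation V := 'rV[R]_n.
Local Notation mul := (group_mul corr).
Implicit Types (x y z u v a b : V) (j k l : 'I_n).
Local Opaque frame dframe ev lie_bracket.

(** Limits are taken along an arbitrary filter, to serve both ordinary continuity and continuity
    within [0, 1]. *)
Lemma cvg_sum_fct (T : Type) (F : set_system T) {FF : Filter F}
    (W : normedModType R) (I : Type) (r : seq I) (f : I -> T -> W) (l : I -> W) :
  (forall i, f i @ F --> l i) ->
  (fun t => \sum_(i <- r) f i t) @ F --> \sum_(i <- r) l i.
Proof.
move=> H; elim: r => [|i r IH].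
  by under eq_fun do rewrite big_nil; rewrite big_nil; exact: cvg_cst.
under eq_fun do rewrite big_cons; rewrite big_cons; exact: cvgD.
Qed.

Lemma cvg_rV (T : Type) (F : set_system T) {FF : Filter F} m (f : T -> 'rV[R]_m)
    (l : 'rV[R]_m) :
  (forall i, (fun t => f t 0 i) @ F --> l 0 i) -> f @ F --> l.
Proof.
move=> H; rewrite (row_sum_delta l).
have -> : f = fun t => \sum_i f t 0 i *: delta_mx 0 i.
  by apply/funext => t; exact: row_sum_delta.
by apply: cvg_sum_fct => i; apply: cvgZr_tmp; exact: H.
Qed.

Lemma cvg_meval (T : Type) (F : set_system T) {FF : Filter F} N
    (p : mpoly.mpoly N R) (f : 'I_N -> T -> R) (l : 'I_N -> R) :
  (forall i, f i @ F --> l i) ->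
  (fun t => mpoly.meval (fun i => f i t) p) @ F --> mpoly.meval l p.
Proof.
move=> H; under eq_fun do rewrite mpoly.mevalE; rewrite mpoly.mevalE.
apply: cvg_sum_fct => m; apply: cvgM; first exact: cvg_cst.
elim: (index_enum _) => [|i r IH].
  by under eq_fun do rewrite big_nil; rewrite big_nil; exact: cvg_cst.
under eq_fun do rewrite big_cons; rewrite big_cons; apply: cvgM => //.
elim: (mpoly.fun_of_multinom m i) => [|k IHk].
  by under eq_fun do rewrite expr0; rewrite expr0; exact: cvg_cst.
by under eq_fun do rewrite exprS; rewrite exprS; exact: cvgM.
Qed.

Lemma cvg_ev (T : Type) (F : set_system T) {FF : Filter F} p (f g : T -> V) x y :
  (forall i, (fun t => f t 0 i) @ F --> x 0 i) ->
  (forall i, (fun t => g t 0 i) @ F --> y 0 i) ->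
  (fun t => ev p (f t) (g t)) @ F --> ev p x y.
Proof.
move=> Hf Hg.
apply: (@cvg_meval T F FF _ p (fun i t => pair_val (f t) (g t) i) (pair_val x y)) => i.
rewrite /pair_val; case: (split_ordP i) => k ->.
  by under eq_fun do rewrite row_mxEl; rewrite row_mxEl; exact: Hf.
by under eq_fun do rewrite row_mxEr; rewrite row_mxEr; exact: Hg.
Qed.

Lemma cvg_coord (T : Type) (F : set_system T) {FF : Filter F} m (f : T -> 'rV[R]_m)
    (l : 'rV[R]_m) i :
  f @ F --> l -> (fun t => f t 0 i) @ F --> l 0 i.
Proof.
move=> Hf; have := @cvg_comp _ _ _ f (fun M : 'rV[R]_m => M 0 i) _ _ _ Hf.
by move=> /(_ _ (@coord_continuous _ _ _ 0 i l)).
Qed.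

Lemma cvg_frame (T : Type) (F : set_system T) {FF : Filter F} (f : T -> V) x j k :
  (forall i, (fun t => f t 0 i) @ F --> x 0 i) ->
  (fun t => frame (f t) j k) @ F --> frame x j k.
Proof. by move=> H; apply: (@cvg_ev _ _ _ _ f (fun=> 0)) => // i; exact: cvg_cst. Qed.

Lemma cvg_mul (T : Type) (F : set_system T) {FF : Filter F} (f g : T -> V) x y i :
  (forall i, (fun t => f t 0 i) @ F --> x 0 i) ->
  (forall i, (fun t => g t 0 i) @ F --> y 0 i) ->
  (fun t => mul (f t) (g t) 0 i) @ F --> mul x y 0 i.
Proof.
move=> Hf Hg; under eq_fun do rewrite group_mulE; rewrite group_mulE.
exact: cvg_ev.
Qed.

Section HorizontalNorm.
Context (ip : {dot (subvs_of (horizontal_space G)) for idfun}).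
Local Notation H := (horizontal_space G).

Definition gram k l : R := ip (vsproj H (delta_mx 0 k)) (vsproj H (delta_mx 0 l)).

(** The inner product composed with the projection [vsproj] onto the horizontal space: a quadratic
    form on all of [V], given by its Gram matrix. *)
Definition hsq v : R := \sum_k \sum_l v 0 k * v 0 l * gram k l.

Lemma ip_hsq v : ip (vsproj H v) (vsproj H v) = hsq v.
Proof.
have E : vsproj H v = \sum_k v 0 k *: vsproj H (delta_mx 0 k).
  rewrite {1}(row_sum_delta v) linear_sum; apply: eq_bigr => k _; exact: linearZ.
rewrite E linear_sumlz; apply: eq_bigr => k _.
rewrite linear_sumr; apply: eq_bigr => l _.
by rewrite linearZl_LR linearZ/= /gram mulrCA mulrA [v 0 l * _]mulrC.
Qed.

Lemma hsq_ge0 v : 0 <= hsq v.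
Proof.
rewrite -ip_hsq; have [->|v0] := eqVneq (vsproj H v) 0; first by rewrite linear0r.
exact/ltW/neq0_dnorm_gt0.
Qed.

Lemma hsq_bound : exists2 C, 0 < C & forall M v, 0 <= M -> bnd M v ->
  Num.sqrt (hsq v) <= C * M.
Proof.
pose B := \sum_k \sum_l `|gram k l|.
have B0 : 0 <= B by apply: sumr_ge0 => k _; apply: sumr_ge0.
exists (Num.sqrt (B + 1)) => [|M v M0 vM]; first by rewrite sqrtr_gt0; lra.
have -> : Num.sqrt (B + 1) * M = Num.sqrt ((B + 1) * M ^+ 2).
  by rewrite sqrtrM ?sqrtr_sqr ?ger0_norm//; lra.
apply: ler_wsqrtr; apply: (@le_trans _ _ (B * M ^+ 2)); last first.
  by rewrite ler_wpM2r ?exprn_ge0//; lra.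
rewrite /hsq /B mulr_suml; apply: ler_sum => k _; rewrite mulr_suml.
apply: ler_sum => l _; apply: le_trans (ler_norm _) _.
by rewrite !normrM mulrC ler_wpM2l// expr2 ler_pM.
Qed.

Lemma cvg_hsq (T : Type) (F : set_system T) {FF : Filter F} (f : T -> V) x :
  (forall i, (fun t => f t 0 i) @ F --> x 0 i) -> (fun t => hsq (f t)) @ F --> hsq x.
Proof.
move=> Hf; apply: cvg_sum_fct => k; apply: cvg_sum_fct => l.
by apply: cvgM; [apply: cvgM; exact: Hf|exact: cvg_cst].
Qed.

Lemma hsqZ (r : R) v : hsq (r *: v) = r ^+ 2 * hsq v.
Proof.
rewrite /hsq mulr_sumr; apply: eq_bigr => k _; rewrite mulr_sumr.
by apply: eq_bigr => l _; rewrite !mxE; ring.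
Qed.

Lemma hsq_gt0 v : v \in H -> v != 0 -> 0 < hsq v.
Proof.
move=> vH v0; rewrite -ip_hsq neq0_dnorm_gt0//; apply: contra v0 => /eqP e.
by rewrite -(vsprojK vH) e linear0.
Qed.

Lemma rV_norm_bnd v : bnd `|v| v.
Proof.
move=> j; have /mapP[i _ ->] : `|v 0 j| \in [seq `|v i.1 i.2| | i : 'I_1 * 'I_n].
  by apply/mapP; exists (0, j) => //=; rewrite mem_enum.
by rewrite [leRHS]/Num.Def.normr /= mx_normrE; apply/bigmax_geP; right => /=; exists i.
Qed.

(** Equivalence of norms by compactness. Adding the squares of the non-horizontal coordinates makes
    the form positive definite on [V], with a positive minimum on the unit sphere; on the horizontal
    space these squares vanish. *)
Lemma coord_hsq : exists2 C, 0 < C & forall v j, v \in H -> `|v 0 j| <= C * Num.sqrt (hsq v).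
Proof.
pose q v := hsq v + \sum_j (w j != 1%N)%:R * v 0 j ^+ 2.
have cq0 (T : Type) (F : set_system T) (FF : Filter F) (f : T -> V) x :
    (forall i, (fun t => f t 0 i) @ F --> x 0 i) -> (fun t => q (f t)) @ F --> q x.
  move=> Hf; apply: cvgD; first exact: cvg_hsq.
  apply: cvg_sum_fct => i; apply: cvgM; first exact: cvg_cst.
  by under eq_fun do rewrite expr2; rewrite expr2; apply: cvgM; exact: Hf.
have cq : continuous q.
  by move=> v; apply: (cq0 V (nbhs v) (nbhs_filter v) id v) => i; exact: coord_continuous.
pose S := [set v : V | `|v| = 1].
have [[v0 Sv0]|S0] := pselect (S !=set0); last first.
  exists 1 => // v j _; suff -> : v = 0 by rewrite mxE normr0 mul1r sqrtr_ge0.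
  apply/eqP; apply/negP => /negP v0; apply: S0; exists (`|v|^-1 *: v) => /=.
  by rewrite /S/= mx_normZ normfV normr_id mulVf// normr_eq0.
have cS : compact S.
  apply: bounded_closed_compact.
    by exists 1; split; [exact: num_real|move=> M M1 v /= ->; exact: ltW].
  rewrite (_ : S = (fun v : V => `|v|) @^-1` [set 1]) //.
  apply: closed_comp; last exact: closed_eq.
  by move=> v _; exact: norm_continuous.
have [|c cS1 cmin] := EVT_min_rV _ cS (continuous_subspaceT cq); first by exists v0.
have c1 : `|c| = 1 by move: cS1; rewrite inE.
have cn0 : c != 0 by rewrite -normr_eq0 c1 oner_eq0.
have s0 v : 0 <= \sum_j (w j != 1%N)%:R * v 0 j ^+ 2.
  by apply: sumr_ge0 => j _; rewrite mulr_ge0 ?sqr_ge0.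
have qc : 0 < q c.
  have [cH|cH] := boolP (c \in H).
    by rewrite /q ltr_wpDr ?hsq_gt0.
  have [j wj cj] : exists2 j, w j != 1%N & c 0 j != 0.
    apply/not_exists2P => hh; move/negP : cH; apply; apply/layerP => j wj.
    by have [//|/negP] := hh j; rewrite negbK => /eqP.
  rewrite /q ltr_wpDl ?hsq_ge0// (bigD1 j)//= ltr_wpDr//.
    by apply: sumr_ge0 => i _; rewrite mulr_ge0 ?sqr_ge0.
  by rewrite wj mul1r lt_def sqrf_eq0 cj sqr_ge0.
exists (Num.sqrt (q c))^-1; first by rewrite invr_gt0 sqrtr_gt0.
move=> v j vH; apply: le_trans (rV_norm_bnd v j) _.
have [->|v1] := eqVneq v 0.
  by rewrite normr0 mulr_ge0// ?invr_ge0 ?sqrtr_ge0.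
have nv : 0 < `|v| by rewrite normr_gt0.
rewrite mulrC ler_pdivlMr ?sqrtr_gt0//.
rewrite -[`|v|](ger0_norm (normr_ge0 v)) -sqrtr_sqr -sqrtrM ?sqr_ge0//.
apply: ler_wsqrtr.
have Sv : `|v|^-1 *: v \in S.
  by rewrite inE /S/= mx_normZ normfV normr_id mulVf// gt_eqF.
have := cmin _ Sv; rewrite {2}/q hsqZ big1 ?addr0.
  by rewrite exprVn mulrC ler_pdivlMr ?exprn_gt0// mulrC.
move=> i _; rewrite mxE; have [_|wi] := eqVneq (w i) 1%N; first by rewrite mul0r.
by have /layerP -> // := vH; rewrite mulr0 expr0n mulr0.
Qed.

End HorizontalNorm.
End Curves.

(** * Horizontal curves along words *)

Section NiceCurves.
Context {R : realType} (G : carnotGroup R).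
Local Notation n := (carnot_dim G).
Local Notation corr := (@carnot_corr _ G).
Local Notation V := 'rV[R]_n.
Local Notation mul := (group_mul corr).
Local Notation d1 l p := (mpoly.mderiv (lshift n l) p).
Implicit Types (x y z u v a b : V) (j k l : 'I_n).
Local Opaque frame dframe ev lie_bracket.

Context (ip : {dot (subvs_of (horizontal_space G)) for idfun}).
Lemma is_derive_sqpos t :
  is_derive t (1 : R) (fun s : R => Num.max 0 s ^+ 2) (2 * Num.max 0 t).
Proof.
have hid s : is_derive s (1 : R) (fun r : R => r) 1 by exact: is_derive_id.
have [t0|t0|->] := ltgtP t 0.
- rewrite mulr0.
  apply: (@near_eq_is_derive R R R (fun=> 0)).
  near=> s; rewrite max_l ?expr0n//; apply: ltW; near: s; exact: lt_nbhsl.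
-
  have hs : is_derive t (1 : R) (fun s : R => s * s) (2 * t).
    by apply: is_derive_ext (is_derive_mul (hid t) (hid t)) => //; ring.
  apply: (@near_eq_is_derive R R R (fun s => s * s)).
  near=> s; rewrite max_r ?expr2//; apply: ltW; near: s; exact: lt_nbhsr.
- apply/is_derive1_caratheodory; exists (fun s => Num.max 0 s); split.
  + move=> s; rewrite maxxx expr0n/= !subr0.
    by have [s0|s0] := leP 0 s; rewrite ?mul0r ?expr0n ?expr2.
  + apply: continuous_max; [exact: cst_continuous|exact: cvg_id].
  + by rewrite maxxx mulr0.
Unshelve. all: by end_near.
Qed.

(** A C^1 passage from 0 to 1 whose derivative [hat] is the tent of height 2 on [0, 1]. The velocity
    vanishes at both ends, so that consecutive curves join with continuous velocity. *)
Definition ramp (t : R) : R :=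
  2 * (Num.max 0 t ^+ 2 - 2 * Num.max 0 (t - 2^-1) ^+ 2 + Num.max 0 (t - 1) ^+ 2).
Definition hat (t : R) : R :=
  4 * (Num.max 0 t - 2 * Num.max 0 (t - 2^-1) + Num.max 0 (t - 1)).

Lemma is_derive_ramp t : is_derive t (1 : R) ramp (hat t).
Proof.
have sh c : is_derive t (1 : R) (fun s : R => Num.max 0 (s - c) ^+ 2) (2 * Num.max 0 (t - c)).
  have hs : is_derive t (1 : R) (fun s : R => s - c) 1.
    have hid : is_derive t (1 : R) (fun r : R => r) 1 by exact: is_derive_id.
    by apply: is_derive_ext (is_derive_add hid (is_derive_const (- c) t)) => //; rewrite addr0.
  have := @is_derive1_comp R (fun r => Num.max 0 r ^+ 2) (fun s => s - c) t _ _
    (is_derive_sqpos (t - c)) hs.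
  by apply: is_derive_ext => //; rewrite mulr1.
have h2 := is_derive_mul (is_derive_const (- 2) t) (sh 2^-1).
have h := is_derive_add (is_derive_add (is_derive_sqpos t) h2) (sh 1).
apply: is_derive_ext (is_derive_mul (is_derive_const 2 t) h) => [s|].
  by rewrite /ramp mulNr.
by rewrite /hat; ring.
Qed.

Lemma ramp0 t : t <= 0 -> ramp t = 0.
Proof. by move=> t0; rewrite /ramp !max_l; [ring|lra..]. Qed.

Lemma ramp1 t : 1 <= t -> ramp t = 1.
Proof. by move=> t0; rewrite /ramp !max_r; [field|lra..]. Qed.

Lemma hat_out t : t <= 0 \/ 1 <= t -> hat t = 0.
Proof.
case=> t0; rewrite /hat; first by rewrite !max_l; [ring|lra..].
by rewrite !max_r; [field|lra..].
Qed.

Lemma hat_bound t : `|hat t| <= 2.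
Proof.
rewrite /hat ler_norml; case: (leP 0 t) => h1; case: (leP 0 (t - 2^-1)) => h2;
  case: (leP 0 (t - 1)) => h3; apply/andP; split; lra.
Qed.

(** A horizontal curve from 0 to x over [0, 1], extended by constants to the whole line so that
    concatenation needs no one-sided derivatives. The bound L on the speed is also a bound on the
    length. *)
Record nice (x : V) (L : R) (g v : R -> V) : Prop := Nice {
  nice_velocity : forall t j, is_derive t (1 : R) (fun s : R => g s 0 j)
    (\sum_k v t 0 k * frame (g t) j k);
  nice_horizontal : forall t, v t \in horizontal_space G;
  nice_continuous : forall (t : R) j, (fun s => v s 0 j) @ t --> v t 0 j;
  nice_start : forall t, t <= 0 -> g t = 0;
  nice_end : forall t, 1 <= t -> g t = x;
  nice_out : forall t, t <= 0 \/ 1 <= t -> v t = 0;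
  nice_speed : forall t, Num.sqrt (hsq ip (v t)) <= L
}.

Lemma cvg_hat t : hat s @[s --> t] --> hat t.
Proof.
have pc c : (fun s : R => Num.max 0 (s - c)) @ t --> Num.max 0 (t - c).
  have := @continuous_max R R (fun=> 0) (fun s => s - c) t.
  apply; first exact: cst_continuous.
  by apply: cvgB; [exact: cvg_id|exact: cvg_cst].
apply: cvgM; first exact: cvg_cst; apply: cvgD => //.
have p0 : (fun s : R => Num.max 0 s) @ t --> Num.max 0 t.
  have := @continuous_max R R (fun=> 0) (fun s => s) t.
  by apply; [exact: cst_continuous|exact: cvg_id].
apply: cvgB => //; apply: cvgM => //; exact: cvg_cst.
Qed.

Lemma hsq0 : hsq ip 0 = 0.
Proof. by rewrite /hsq big1// => k _; rewrite big1// => l _; rewrite mxE !mul0r. Qed.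

Lemma sqrt_hsqZ r x : Num.sqrt (hsq ip (r *: x)) = `|r| * Num.sqrt (hsq ip x).
Proof. by rewrite hsqZ sqrtrM ?sqr_ge0// sqrtr_sqr. Qed.

Lemma nice_nil : nice 0 0 (fun=> 0) (fun=> 0).
Proof.
split => // [t j|t|t j|t].
- rewrite big1 => [|k _]; last by rewrite mxE mul0r.
  by apply: is_derive_ext (is_derive_const 0 t) => // s; rewrite mxE.
- exact: mem0v.
- exact: cvg_cst.
- by rewrite hsq0 sqrtr0.
Qed.

Lemma nice_letter x : x \in horizontal_space G ->
  nice x (2 * Num.sqrt (hsq ip x)) (fun t => ramp t *: x) (fun t => hat t *: x).
Proof.
move=> xH; split.
- move=> t j; have -> : \sum_k (hat t *: x) 0 k * frame (ramp t *: x) j k = hat t * x 0 j.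
    have [r0|r0] := eqVneq (ramp t) 0.
      rewrite r0 scale0r -[LHS](_ : \sum_k (j == k)%:R * (hat t *: x) 0 k = _); last first.
        by apply: eq_bigr => k _; rewrite frame0 mulrC.
      by under eq_bigr do rewrite eq_sym; rewrite sum_delta mxE.
    apply: (mulfI r0); rewrite mulr_sumr; transitivity (hat t * (ramp t *: x) 0 j).
      rewrite -[X in _ = _ * X]frame_exp mulr_sumr.
      by apply: eq_bigr => k _; rewrite !mxE; ring.
    by rewrite mxE mulrCA.
  apply: is_derive_ext (is_derive_mul (is_derive_ramp t) (is_derive_const (x 0 j) t)) => [s|].
    by rewrite mxE.
  by rewrite mulr0 addr0.
- by move=> t; rewrite memvZ.
- move=> t j; under eq_fun do rewrite mxE; rewrite mxE.
  by apply: cvgM; [exact: cvg_hat|exact: cvg_cst].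
- by move=> t t0; rewrite ramp0// scale0r.
- by move=> t t1; rewrite ramp1// scale1r.
- by move=> t ht; rewrite hat_out// scale0r.
- by move=> t; rewrite sqrt_hsqZ ler_wpM2r ?sqrtr_ge0// hat_bound.
Qed.

Lemma d1_at0 x j l : ev (d1 l (mul_poly j)) x 0 = (j == l)%:R.
Proof.
have h := is_derive_ev (mul_poly j) (is_derive_line x (delta_mx 0 l) 0) (is_derive_row_const 0 0).
have h2 : is_derive (0 : R) (1 : R) (fun s : R => ev (mul_poly j) (x + s *: delta_mx 0 l) 0)
    ((delta_mx 0 l : V) 0 j).
  by apply: is_derive_ext (is_derive_line x (delta_mx 0 l) 0 j) => // s; rewrite -group_mulE mulx0.
have := is_derive_inj h h2; rewrite sum_delta_mx [X in _ + X]big1 => [|i _]; last first.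
  by rewrite mxE mul0r.
by rewrite addr0 scale0r addr0 mxE eqxx.
Qed.

Lemma is_derive_reparam (f : R -> R) (c e t d : R) : is_derive (c * t + e) (1 : R) f d ->
  is_derive t (1 : R) (fun s => f (c * s + e)) (c * d).
Proof.
move=> fd; have hs : is_derive t (1 : R) (fun s : R => c * s + e) c.
  have hid : is_derive t (1 : R) (fun r : R => r) 1 by exact: is_derive_id.
  apply: is_derive_ext (is_derive_add (is_derive_mul (is_derive_const c t) hid)
    (is_derive_const e t)) => //; by rewrite mul0r add0r mulr1 addr0.
have := @is_derive1_comp R f (fun s => c * s + e) t _ _ fd hs.
by apply: is_derive_ext => //; rewrite mulrC.
Qed.

(* At each time one of the two factors is at rest. *)
Lemma nice_cat x y (L L' : R) (g v g' v' : R -> V) : nice x L g v -> nice y L' g' v' ->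
  nice (mul x y) (2 * Num.max L L') (fun t => mul (g (2 * t + 0)) (g' (2 * t + (-1))))
    (fun t => 2 *: v (2 * t + 0) + 2 *: v' (2 * t + (-1))).
Proof.
move=> [V1 H1 C1 S1 E1 O1 L1] [V2 H2 C2 S2 E2 O2 L2].
have cases t : (g' (2 * t + -1) = 0 /\ v' (2 * t + -1) = 0) \/
    (g (2 * t + 0) = x /\ v (2 * t + 0) = 0).
  have [h|h] := leP t 2^-1.
    by left; split; [apply: S2; lra|apply: O2; left; lra].
  by right; split; [apply: E1; lra|apply: O1; right; lra].
split.
- move=> t j.
  pose da : V := \row_i (2 * \sum_k v (2 * t + 0) 0 k * frame (g (2 * t + 0)) i k).
  pose db : V := \row_i (2 * \sum_k v' (2 * t + -1) 0 k * frame (g' (2 * t + -1)) i k).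
  have ha i : is_derive t (1 : R) (fun s : R => g (2 * s + 0) 0 i) (da 0 i).
    by rewrite mxE; exact: (is_derive_reparam (V1 _ _)).
  have hb i : is_derive t (1 : R) (fun s : R => g' (2 * s + -1) 0 i) (db 0 i).
    by rewrite mxE; exact: (is_derive_reparam (V2 _ _)).
  apply: is_derive_ext (is_derive_ev (mul_poly j) ha hb) => [s|].
    by rewrite group_mulE.
  have [[e1 e2]|[e1 e2]] := cases t.
    rewrite [X in _ + X]big1 => [|l _]; last first.
      by rewrite mxE e2 big1 ?mulr0 ?mul0r// => k _; rewrite mxE mul0r.
    rewrite e1 e2 mulx0 scaler0 [2 *: _ + 0]addr0 [X in X = _]addr0.
    under eq_bigr do rewrite d1_at0 eq_sym mulrC; rewrite sum_delta mxE mulr_sumr.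
    by apply: eq_bigr => k _; rewrite mulrA; congr (_ * _); rewrite mxE.
  rewrite [X in X + _]big1 => [|l _]; last first.
    by rewrite mxE e2 big1 ?mulr0 ?mul0r// => k _; rewrite mxE mul0r.
  rewrite e2 scaler0 [0 + 2 *: _]add0r [X in X = _]add0r.
  under [RHS]eq_bigr do rewrite -frame_mul mulr_sumr.
  rewrite exchange_big/=; apply: eq_bigr => l _.
  rewrite mxE mulr_sumr mulr_suml; apply: eq_bigr => k _; rewrite mxE; ring.
- by move=> t; rewrite memvD ?memvZ.
- move=> t j; under eq_fun do rewrite 3!mxE.
  have -> : (2 *: v (2 * t + 0) + 2 *: v' (2 * t + -1)) 0 j =
     2 * v (2 * t + 0) 0 j + 2 * v' (2 * t + -1) 0 j by rewrite 3!mxE.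
  have cl e : (fun s : R => 2 * s + e) @ t --> 2 * t + e.
    apply: cvgD; last exact: cvg_cst.
    by apply: cvgM; [exact: cvg_cst|exact: cvg_id].
  apply: cvgD; (apply: cvgM; first exact: cvg_cst).
    by have := @cvg_comp _ _ _ _ (fun s => v s 0 j) _ _ _ (cl 0) (C1 _ j).
  by have := @cvg_comp _ _ _ _ (fun s => v' s 0 j) _ _ _ (cl (-1)) (C2 _ j).
- by move=> t t0; rewrite S1 ?S2 ?mul0//; lra.
- by move=> t t0; rewrite E1 ?E2//; lra.
- move=> t ht; rewrite O1 ?O2 ?scaler0 ?addr0//; case: ht => ht; [left|right|left|right]; lra.
- move=> t; have [[e1 e2]|[e1 e2]] := cases t; rewrite e2 scaler0 ?[2 *: _ + 0]addr0 ?[0 + 2 *: _]add0r.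
    rewrite sqrt_hsqZ ger0_norm// ler_wpM2l//; apply: le_trans (L1 _) _.
    by rewrite le_max lexx.
  rewrite sqrt_hsqZ ger0_norm// ler_wpM2l//; apply: le_trans (L2 _) _.
  by rewrite le_max lexx orbT.
Qed.

(** A letter has speed at most 2h because of the tent, and concatenation doubles speeds by running
    each curve in half the time; a factor 4 per letter covers both. *)
Lemma nice_word s N h : hword s -> (size s <= N)%N -> 0 <= h ->
  (forall u, u \in s -> Num.sqrt (hsq ip u) <= h) ->
  exists g v : R -> V, nice (word_eval s) (4 ^+ N * h) g v.
Proof.
have mono x (L L' : R) (g v : R -> V) : L <= L' -> nice x L g v -> nice x L' g v.
  by move=> LL [*]; split => // t; exact: le_trans LL.
move=> + + h0; elim: s N => [|x s IH] N hs sN sh.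
  exists (fun=> 0), (fun=> 0); apply: mono nice_nil.
  by rewrite mulr_ge0// exprn_ge0.
case: N sN => // N sN.
have [|u us|g [v nv]] := IH N _ sN _.
- by move=> u us; apply: hs; rewrite inE us orbT.
- by apply: sh; rewrite inE us orbT.
have nx := nice_letter (hs x (mem_head _ _)).
exists (fun t => mul (ramp (2 * t + 0) *: x) (g (2 * t + (-1)))),
  (fun t => 2 *: (hat (2 * t + 0) *: x) + 2 *: v (2 * t + (-1))).
apply: mono (nice_cat nx nv).
have h1 : 1 <= 4 ^+ N :> R by rewrite exprn_ege1// ler1n.
have hx := sh x (mem_head _ _).
rewrite exprS -mulrA.
have hh : h <= 4 ^+ N * h by rewrite ler_peMl.
rewrite -[leRHS](_ : 2 * (2 * (4 ^+ N * h)) = _); last by ring.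
by rewrite ler_wpM2l// ge_max; apply/andP; split; lra.
Qed.
End NiceCurves.

(** * Upper bound and left invariance of the distance *)

Section DistanceUpperBound.
Context {R : realType} (G : carnotGroup R).
Local Notation n := (carnot_dim G).
Local Notation w := (@carnot_weight _ G).
Local Notation corr := (@carnot_corr _ G).
Local Notation V := 'rV[R]_n.
Local Notation mul := (group_mul corr).
Local Notation dil r := (carnot_dilation (G := G) r).
Implicit Types (x y z u v a b : V) (j k l : 'I_n).
Local Opaque frame dframe ev lie_bracket.

Context (ip : {dot (subvs_of (horizontal_space G)) for idfun}).
Local Notation H := (horizontal_space G).
Local Notation d := (carnot_dist ip).
Local Notation I01 := (`[0, 1]%classic : set R).

Lemma within_cvg (T : topologicalType) (A : set R) (f : R -> T) :
  (forall t, f s @[s --> t] --> f t) -> {within A, continuous f}.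
Proof. by move=> h; apply: continuous_subspaceT => t; exact: h. Qed.

Lemma nice_dist x L (g v : R -> V) : nice ip x L g v -> (d 0 x <= L%:E)%E.
Proof.
move=> [V1 H1 C1 S1 E1 O1 L1].
pose u t := vsproj H (v t); have uE t : vsval (u t) = v t by exact: vsprojK.
have gE (t : R) : is_derive t (1 : R) g (carnot_left_field (vsval (u t)) (g t)).
  apply: is_derive_rV => j; rewrite /carnot_left_field left_fieldE uE; exact: V1.
have cg (t : R) : g s @[s --> t] --> g t.
  by apply: differentiable_continuous; apply/derivable1_diffP; case: (gE t).
apply: le_trans (ereal_inf_lbound _) _.
  exists g, u; split; last reflexivity; split => //.
  - exact: S1.
  - exact: E1.
  - exact: within_cvg.
  - apply: within_cvg => t; apply: cvg_rV => i; rewrite uE.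
    by under eq_fun do rewrite uE; exact: C1.
rewrite /horizontal_length.
have E t : Num.sqrt (ip (u t) (u t)) = Num.sqrt (hsq ip (v t)) by rewrite ip_hsq.
under eq_integral do rewrite E.
have mS : measurable_fun [set: R] (fun t => Num.sqrt (hsq ip (v t))).
  apply: continuous_measurable_fun => t; apply: (@cvg_comp _ _ _ (fun t => hsq ip (v t))).
    by apply: cvg_hsq => i; exact: C1.
  exact: sqrt_continuous.
apply: le_trans (ge0_le_integral (f2 := fun=> L%:E) _ _ _ _ _ _) _ => //.
- apply: measurableT_comp => //; exact: measurable_funTS.
- by move=> t _; rewrite lee_fin.
by rewrite (integral_cst _ _ L%:E)//= lebesgue_measure_itv/= lte_fin ltr01 sube0 mule1.
Qed.

(** Dilate x into the unit box, write it there as a word of bounded size and dilate back: horizontal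
    letters are just multiplied by t, and so is the bound on the length. *)
Lemma dist_upper : exists2 C, 0 < C & forall t x, 0 < t ->
  (forall j, `|x 0 j| <= t ^+ w j) -> (d 0 x <= (C * t)%:E)%E.
Proof.
have [N [K HK]] := word_box G; have [C C0 HC] := hsq_bound ip.
exists (4 ^+ N * (C * (`|K| + 1))) => [|t x t0 xt].
  by rewrite !mulr_gt0 ?exprn_gt0// ltr_wpDl.
have tn : t != 0 by rewrite gt_eqF.
have [|s [hs sN sK se]] := HK (dil t^-1 x).
  move=> j; rewrite dilE normrM exprVn normfV (ger0_norm (exprn_ge0 _ (ltW t0))).
  by rewrite ler_pdivrMl ?exprn_gt0// mulr1.
have [|||u /mapP[u' us ->]|g [v nv]] :=
    @nice_word _ _ ip (map (fun x => dil t x) s) N (t * (C * (`|K| + 1))).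
- exact: hword_dil.
- by rewrite size_map.
- by rewrite !mulr_ge0 ?addr_ge0 ?(ltW t0) ?(ltW C0).
- rewrite dil_layer1 ?hs// sqrt_hsqZ gtr0_norm// ler_pM2l//; apply: HC.
    by rewrite addr_ge0.
  by apply: bnd_le (sK _ us); rewrite (le_trans (ler_norm _))// lerDl.
move: nv; rewrite word_eval_dil// se => nv.
have xE : dil t (dil t^-1 x) = x.
  apply/rowP => j; rewrite !dilE mulrA -exprMn mulfV// expr1n mul1r//.
by move: (nice_dist nv); rewrite xE mulrCA mulrC.
Qed.

Lemma dist_left a x y : d (mul a x) (mul a y) = d x y.
Proof.
have le b x' y' : (d (mul b x') (mul b y') <= d x' y')%E.
  apply: ereal_inf_le_tmp => len [g [u [[Hs He Hc Hu Hd] ->]]].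
  exists (fun t => mul b (g t)), u; split; last by [].
  split.
  - by rewrite Hs.
  - by rewrite He.
  - move=> t; apply: cvg_rV => i; apply: cvg_mul => j; first exact: cvg_cst.
    by apply: cvg_coord; exact: Hc.
  - exact: Hu.
  - move=> t t01; apply: is_derive_rV => j; rewrite /carnot_left_field left_fieldE.
    have hg i := is_derive_coord i (Hd t t01).
    apply: is_derive_ext (is_derive_mulr b j hg) => //.
    under [RHS]eq_bigr do rewrite -frame_mul mulr_sumr.
    rewrite exchange_big/=; apply: eq_bigr => l _.
    by rewrite left_fieldE mulr_suml; apply: eq_bigr => k _; rewrite mulrA.
apply/eqP; rewrite eq_le le/= -{1}(mulKx a x) -{1}(mulKx a y); exact: le.
Qed.
End DistanceUpperBound.

(** * Lower bound for the distance *)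

Section DistanceLowerBound.
Context {R : realType} (G : carnotGroup R).
Local Notation n := (carnot_dim G).
Local Notation w := (@carnot_weight _ G).
Local Notation corr := (@carnot_corr _ G).
Local Notation V := 'rV[R]_n.
Local Notation d2 l p := (mpoly.mderiv (rshift n l) p).
Local Notation dil r := (carnot_dilation (G := G) r).
Implicit Types (x y z u v a b : V) (j k l : 'I_n).
Local Opaque frame dframe ev lie_bracket.

Context (ip : {dot (subvs_of (horizontal_space G)) for idfun}).
Local Notation H := (horizontal_space G).
Local Notation d := (carnot_dist ip).

Lemma frame_bounded M : exists2 K, 0 < K & forall x j k, bnd M x -> `|frame x j k| <= K.
Proof.
pose P (i : 'I_n * 'I_n) (x : V) (K : R) := bnd M x -> `|frame x i.1 i.2| <= K.
have [|i t K K' KK h b|K HK] := @fin_bound _ _ _ P.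
- move=> [j k]; have [K HK] := meval_bounded (d2 k (mul_poly j)) (`|M|).
  exists K => x bx; apply: HK => i; rewrite /pair_val.
  case: (split_ordP i) => l ->; rewrite ?row_mxEl ?row_mxEr ?mxE ?normr0//.
  exact: le_trans (bx l) (ler_norm _).
- exact: le_trans (h b) KK.
- exists (`|K| + 1) => [|x j k bx]; first by rewrite ltr_wpDl.
  apply: le_trans (HK (j, k) x bx) _; apply: le_trans (ler_norm _) _.
  by rewrite lerDl.
Qed.

Lemma dilK r x : r != 0 -> dil r (dil r^-1 x) = x.
Proof.
move=> r0; apply/rowP => j; rewrite !dilE mulrA -exprMn mulfV//.
by rewrite expr1n mul1r.
Qed.

Lemma bnd_dil C L x : 0 < L -> (forall j, `|x 0 j| <= C * L ^+ w j) ->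
  bnd C (dil L^-1 x).
Proof.
move=> L0 h j; rewrite dilE normrM exprVn normfV (ger0_norm (exprn_ge0 _ (ltW L0))).
by rewrite ler_pdivrMl ?exprn_gt0// mulrC.
Qed.

(** By homogeneity, the bound on a fixed box applied after [dil L^-1] scales with the exponent w j -
    w k, and here w k = 1. *)
Lemma frame_scaled C : 0 <= C -> exists2 K, 0 < K & forall L x j k, 0 < L -> w k = 1%N ->
  (forall i, (w i < w j)%N -> `|x 0 i| <= C * L ^+ w i) ->
  `|frame x j k| <= K * L ^+ (w j).-1.
Proof.
move=> C0; have [K K0 HK] := frame_bounded C; exists K => // L x j k L0 wk hx.
have Ln : L != 0 by rewrite gt_eqF.
(* Only the coordinates lighter than w j are bounded, and only they enter row j of [frame]; the
   others are replaced by 0. *)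
pose y : V := \row_i (if (w i < w j)%N then x 0 i else 0).
have bz : bnd C (dil L^-1 y).
  apply: bnd_dil => // i; rewrite mxE; case: ifP => [/hx//|_].
  by rewrite normr0 mulr_ge0 ?exprn_ge0// ltW.
have -> : frame x j k = frame y j k by apply: frame_dep => i ij; rewrite mxE ij.
have e : frame y j k * L = L ^+ w j * frame (dil L^-1 y) j k.
  by rewrite -frame_dil// wk expr1 dilK.
have -> : frame y j k = L ^+ (w j).-1 * frame (dil L^-1 y) j k.
  apply: (mulIf Ln); rewrite e -{1}(prednK (weight_gt0 j)) exprS; ring.
rewrite normrM ger0_norm ?exprn_ge0 ?(ltW L0)// mulrC.
by rewrite ler_wpM2r ?exprn_ge0 ?(ltW L0)// HK.
Qed.

Lemma cvg_sqrt_hsq (T : Type) (F : set_system T) {FF : Filter F} (f : T -> V) x :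
  (forall i, (fun t => f t 0 i) @ F --> x 0 i) ->
  (fun t => Num.sqrt (hsq ip (f t))) @ F --> Num.sqrt (hsq ip x).
Proof.
move=> Hf; have h : (fun t => hsq ip (f t)) @ F --> hsq ip x by exact: cvg_hsq.
by have := @cvg_comp _ _ _ _ (@Num.sqrt R) _ _ _ h (@sqrt_continuous R (hsq ip x)).
Qed.

(** Induction on the weight: once the lighter coordinates are O(L^(w i)), the velocity of a
    coordinate of weight m + 1 is O(L^m) times the speed, and integrating the speed yields one more
    factor L. *)
Lemma curve_bound m : exists2 C, 0 < C & forall L x y g (u : R -> subvs_of H), 0 < L ->
  x = 0 -> horizontal_curve x y g u -> (horizontal_length ip u < L%:E)%E ->
  forall j t, (w j <= m)%N -> 0 <= t <= 1 -> `|g t 0 j| <= C * L ^+ w j.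
Proof.
elim: m => [|m [C C0 HC]].
  exists 1 => // L x y g u L0 x0 _ _ j t; have := weight_gt0 j; lia.
have [K K0 HK] := frame_scaled (ltW C0).
have [C1 C10 HC1] := coord_hsq ip.
pose C2 := n%:R * (C1 * K).
exists (C + C2) => [|L x y g u L0 x0 gu lL j t jm /andP[t0 t1]].
  by rewrite ltr_wpDr// mulr_ge0// mulr_ge0// ltW.
have L0w i : 0 <= L ^+ i by rewrite exprn_ge0// ltW.
have C20 : 0 <= C2 by rewrite mulr_ge0// mulr_ge0// ltW.
move: jm; rewrite leq_eqVlt => /predU1P[wj|jm]; last first.
  apply: le_trans (HC L x y g u L0 x0 gu lL j t jm _) _; first by rewrite t0.
  by rewrite ler_wpM2r// lerDl.
have [->|tn0] := eqVneq t 0.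
  by case: gu => -> _ _ _ _; rewrite x0 mxE normr0 mulr_ge0// addr_ge0// ltW.
have {tn0} tpos : 0 < t by rewrite lt_def tn0.
case: (gu) => Hs He Hc Hu Hd.
pose v t := vsval (u t); have vH s : v s \in H by exact: subvsP.
pose S s := Num.sqrt (hsq ip (v s)).
have S0 s : 0 <= S s by exact: sqrtr_ge0.
pose F s := \sum_k v s 0 k * frame (g s) j k.
have sub : `[0, t]%classic `<=` (`[0, 1]%classic : set R).
  by move=> s /=; rewrite !in_itv/= => /andP[-> /le_trans]; apply.
have cv i : {within `[0, 1], continuous (fun s => v s 0 i)}.
  by move=> s; apply: cvg_coord; exact: Hu.
have cg i : {within `[0, 1], continuous (fun s => g s 0 i)}.
  by move=> s; apply: cvg_coord; exact: Hc.
have cF : {within `[0, 1], continuous F}.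
  move=> s; apply: cvg_sum_fct => k; apply: cvgM; first exact: cv.
  by apply: cvg_frame => i; exact: cg.
have cS : {within `[0, 1], continuous S}.
  by move=> s; apply: cvg_sqrt_hsq => i; exact: cv.
have mF : measurable_fun (`[0%R, t]%classic : set R) F.
  apply: (measurable_funS _ sub); first exact: measurable_itv.
  by apply: subspace_continuous_measurable_fun => //; exact: measurable_itv.
have mS : measurable_fun (`[0%R, 1%R]%classic : set R) S.
  by apply: subspace_continuous_measurable_fun => //; exact: measurable_itv.
have FS s : 0 <= s <= 1 -> `|F s| <= C2 * L ^+ m * S s.
  move=> s01; apply: le_trans (ler_norm_sum _ _ _) _.
  rewrite /C2 -!mulrA mulr_natl -[X in _ *+ X](card_ord n) -sumr_const.
  apply: ler_sum => k _; rewrite normrM.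
  have [wk|wk] := eqVneq (w k) 1%N; last first.
    have /layerP -> // := vH s; rewrite normr0 mul0r.
    by rewrite !mulr_ge0// ltW.
  rewrite mulrCA [leRHS](_ : _ = (C1 * S s) * (K * L ^+ m)); last by ring.
  apply: ler_pM => //; first exact: HC1.
  have := HK L (g s) j k L0 wk; rewrite wj/=; apply => i; rewrite ltnS => im.
  exact: (HC L x y g u L0 x0 gu lL).
have dF s : s \in `]0, t[ -> is_derive s (1 : R) (fun s => g s 0 j) (F s).
  rewrite in_itv/= => /andP[s0 st].
  have s01 : 0 < s < 1 by rewrite s0 (lt_le_trans st).
  have := is_derive_coord j (Hd s s01); rewrite /carnot_left_field.
  by apply: is_derive_ext => //; rewrite left_fieldE.
have lr : derivable_oo_LRcontinuous (fun s => g s 0 j) 0 t.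
  have /(continuous_within_itvP _ tpos)[_ h1 h2] :
      {within `[0, t], continuous (fun s => g s 0 j)}.
    by apply: continuous_subspaceW (cg j).
  by split => // s /dF[].
have := @continuous_FTC2 R F (fun s => g s 0 j) 0 t tpos _ lr _.
have -> : (g 0) 0 j = 0 by rewrite Hs x0 mxE.
rewrite sube0 => FTC.
have {}FTC : (\int[lebesgue_measure]_(s in `[0%R, t]) (F s)%:E = (g t 0 j)%:E)%E.
  apply: FTC; first exact: continuous_subspaceW cF.
  by move=> s /dF hs; rewrite derive1E; apply: derive_val.
rewrite -lee_fin -abse_EFin -FTC.
apply: le_trans (le_abse_integral _ _ _) _ => //; first exact: measurableT_comp.
apply: (@le_trans _ _ (\int[lebesgue_measure]_(s in `[0%R, t]) ((C2 * L ^+ m)%:E * (S s)%:E)))%E.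
  apply: ge0_le_integral => //.
  - by do 2 apply: measurableT_comp => //.
  - apply: measurable_funeM; apply: measurableT_comp => //.
    by apply: (measurable_funS _ sub) => //; exact: measurable_itv.
  - move=> s; rewrite /= in_itv/= => /andP[s0 st].
    by rewrite lee_fin FS// s0 (le_trans st).
rewrite ge0_integralZl_EFin//; last 3 first.
- by move=> s _; rewrite lee_fin.
- apply: measurableT_comp => //; apply: (measurable_funS _ sub) => //; exact: measurable_itv.
- by rewrite mulr_ge0.
have SL : (\int[lebesgue_measure]_(s in `[0%R, t]) (S s)%:E <= L%:E)%E.
  apply: le_trans (ltW lL); rewrite /horizontal_length.
  have E s : Num.sqrt (ip (u s) (u s)) = S s by rewrite /S -ip_hsq /v vsvalK.
  under [leRHS]eq_integral do rewrite E.
  apply: ge0_subset_integral => //; first exact: measurableT_comp.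
  by move=> s _; rewrite lee_fin.
apply: (@le_trans _ _ ((C2 * L ^+ m)%:E * L%:E)%E).
  by rewrite lee_wpmul2l// lee_fin mulr_ge0.
rewrite -EFinM lee_fin wj -mulrA -exprSr ler_wpM2r//.
by rewrite lerDr ltW.
Qed.

Lemma dist_lower : exists2 C, 0 < C & forall L x, 0 < L -> (d 0 x < L%:E)%E ->
  forall j, `|x 0 j| <= C * L ^+ w j.
Proof.
have [C C0 HC] := curve_bound (carnot_step G); exists C => // L x L0.
move=> /ereal_inf_lt[_ [g [u [gu ->]]] lL] j.
case: (gu) => _ <- _ _ _; apply: (HC L 0 x g u) => //.
  by have /andP[] := @carnot_weightP _ G j.
by rewrite ler01 lexx.
Qed.
End DistanceLowerBound.

(** * Lebesgue measure, translations and dilations *)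

Section LebesgueTupleMaps.
Context {R : realType}.
Local Notation RT := (measurableTypeR R).
Local Open Scope ereal_scope.

(** The right-hand side is a measure in A that agrees with Lebesgue measure on half-open intervals,
    which determine it. *)
Lemma lebesgue_measure_affine (a c : R) (A : set RT) : (0 < a)%R -> measurable A ->
  lebesgue_measure A = a%:E * lebesgue_measure ((fun x : RT => a * x + c)%R @^-1` A).
Proof.
move=> a0 mA.
have mf : measurable_fun [set: RT] (fun x : RT => a * x + c : RT)%R.
  by apply: measurable_funD => //; exact: measurable_funM.
pose f := fun x : RT => (a * x + c : RT)%R.
pose m : {measure set RT -> \bar R} :=
  mscale (NngNum (ltW a0)) (pushforward (@lebesgue_measure R) f).
have -> : lebesgue_measure A = m mf A.
  apply: lebesgue_measure_unique mA => X [[u v] _ <-] /=.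
  rewrite /m /mscale /=.
  have E : f @^-1` `]u, v]%classic = `]((u - c) / a)%R, ((v - c) / a)%R]%classic.
    apply/seteqP; split => x; rewrite /f /= !in_itv/= ltr_pdivrMr// ler_pdivlMr// => /andP[h1 h2];
      apply/andP; split; lra.
  rewrite /pushforward E !lebesgue_measure_itv/= !lte_fin ltr_pM2r ?invr_gt0// ltrD2r.
  case: ifP => // _; last by rewrite mule0.
  rewrite -!EFinD -EFinM; congr _%:E; field; lra.
by [].
Qed.

Lemma lebesgue_tupleS n (A : set (n.+1.-tuple RT)) :
  lebesgue_tuple R n.+1 A =
  \int[@lebesgue_measure R]_x (lebesgue_tuple R n [set t | A (cons_pair (x, t))]).
Proof.
rewrite /= /lebesgue_cons /pushforward /= /product_measure1/=.
by apply: eq_integral => x _; rewrite /xsection/=; congr (lebesgue_tuple R n _); apply/seteqP; split => t /=; rewrite inE.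
Qed.

Lemma lebesgue_tupleS_swap n (A : set (n.+1.-tuple RT)) : measurable A ->
  lebesgue_tuple R n.+1 A =
  \int[lebesgue_tuple R n]_t (@lebesgue_measure R [set x | A (cons_pair (x, t))]).
Proof.
move=> mA.
have mA' : measurable (@cons_pair R n @^-1` A).
  by rewrite -[X in measurable X]setTI; exact: measurable_cons_pair.
rewrite /= /lebesgue_cons /pushforward /=.
rewrite (@product_measure_unique _ _ _ _ R (@lebesgue_measure R) (lebesgue_tuple R n)
  (product_measure2 (@lebesgue_measure R) (lebesgue_tuple R n)))//.
  rewrite /product_measure2/=; apply: eq_integral => x _; congr lebesgue_measure.
  by rewrite /ysection/=; apply/seteqP; split => t /=; rewrite inE.
by move=> X Y mX mY; exact: product_measure2E.
Qed.

(** An affine change of one coordinate, whose translation part will depend on the others. Triangular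
    maps are composed of these, so that Fubini and the one-dimensional case replace a Jacobian
    formula. *)
Definition shear n (j : 'I_n) (a : R) (f : n.-tuple RT -> RT) (t : n.-tuple RT) :
    n.-tuple RT :=
  [tuple (if i == j then (a * tnth t i + f t)%R else tnth t i) | i < n].

Definition indep n (j : 'I_n) (f : n.-tuple RT -> RT) :=
  forall t t' : n.-tuple RT, (forall i, i != j -> tnth t i = tnth t' i) -> f t = f t'.

Lemma measurable_shear n (j : 'I_n) a (f : n.-tuple RT -> RT) :
  measurable_fun setT f -> measurable_fun setT (shear j a f).
Proof.
move=> mf; apply/measurable_fun_tnthP => i.
have [->|ij] := eqVneq i j.
  rewrite (_ : _ \o _ = fun t => (a * tnth t j + f t)%R); last first.
    by apply/funext => t /=; rewrite tnth_mktuple eqxx.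
  apply: measurable_funD => //; apply: measurable_funM => //; exact: measurable_tnth.
rewrite (_ : _ \o _ = fun t => tnth t i); first exact: measurable_tnth.
by apply/funext => t /=; rewrite tnth_mktuple (negbTE ij).
Qed.

Lemma tnth_cons0 n (x : RT) (t : n.-tuple RT) : tnth (cons_pair (x, t)) ord0 = x.
Proof. by []. Qed.

Lemma tnth_consS n (x : RT) (t : n.-tuple RT) i :
  tnth (cons_pair (x, t)) (lift ord0 i) = tnth t i.
Proof. exact: tnthS. Qed.

(** If j is not the first coordinate, slice along the first and use the induction hypothesis; if it
    is, integrate it innermost ([lebesgue_tupleS_swap]), where the map is affine on the line. *)
Lemma lebesgue_shear n (j : 'I_n) (a : R) (f : n.-tuple RT -> RT) (A : set (n.-tuple RT)) :
  (0 < a)%R -> measurable_fun setT f -> indep j f -> measurable A ->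
  lebesgue_tuple R n A = a%:E * lebesgue_tuple R n (shear j a f @^-1` A).
Proof.
move=> a0; elim: n j f A => [[]//|n IH] j f A mf jf mA.
have mS := measurable_shear j a mf.
have mSA : measurable (shear j a f @^-1` A).
  by rewrite -[X in measurable X]setTI; exact: mS.
have mcons x : measurable_fun setT (fun t : n.-tuple RT => cons_pair (x, t)).
  by apply: measurable_cons; [exact: measurable_cst|exact: measurable_id].
have mcons2 (t : n.-tuple RT) : measurable_fun [set: RT] (fun x : RT => cons_pair (x, t) : n.+1.-tuple RT).
  by apply: measurable_cons; [exact: measurable_id|exact: measurable_cst].
have [j' ej|j0] := unliftP ord0 j.
  subst j.
  rewrite !lebesgue_tupleS.
  have mi : measurable_fun setT (fun x : RT =>
     lebesgue_tuple R n [set t | (shear (lift ord0 j') a f @^-1` A) (cons_pair (x, t))]).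
    have mA' : measurable (@cons_pair R n @^-1` (shear (lift ord0 j') a f @^-1` A)).
      by rewrite -[X in measurable X]setTI; exact: measurable_cons_pair.
    have := measurable_fun_xsection (lebesgue_tuple R n) mA'.
    congr (measurable_fun _ _); apply/funext => x /=; congr (lebesgue_tuple R n _).
    by rewrite /xsection/=; apply/seteqP; split => t /=; rewrite inE.
  rewrite -ge0_integralZl_EFin//; last exact: ltW.
  apply: eq_integral => x _.
  pose g (t : n.-tuple RT) := f (cons_pair (x, t)).
  rewrite (IH j' g); first last.
  - by rewrite -[X in measurable X]setTI; exact: mcons.
  - move=> t t' tt'; apply: jf => i; case: (unliftP ord0 i) => [i' ->|-> _//].
    by rewrite !tnth_consS => ij; apply: tt'; apply: contraNneq ij => ->.
  - exact: measurableT_comp.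
  congr (_ * lebesgue_tuple R n _); apply/seteqP; split => t /=;
    rewrite (_ : cons_pair (x, shear j' a g t) = shear (lift ord0 j') a f (cons_pair (x, t)))//;
    apply: eq_from_tnth => i; rewrite tnth_mktuple;
    (case: (unliftP ord0 i) => [i' ->|->]; last by rewrite eq_liftF);
    rewrite !tnth_consS tnth_mktuple (inj_eq lift_inj)//.
rewrite {}j0 in jf mS mSA *.
rewrite !lebesgue_tupleS_swap//.
have mi : measurable_fun setT (fun t : n.-tuple RT =>
     @lebesgue_measure R [set x | (shear ord0 a f @^-1` A) (cons_pair (x, t))]).
  have mA' : measurable (@cons_pair R n @^-1` (shear ord0 a f @^-1` A)).
    by rewrite -[X in measurable X]setTI; exact: measurable_cons_pair.
  have := measurable_fun_ysection (@lebesgue_measure R) mA'.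
  congr (measurable_fun _ _); apply/funext => x /=; congr lebesgue_measure.
  by rewrite /ysection/=; apply/seteqP; split => t /=; rewrite inE.
rewrite -ge0_integralZl_EFin//; last exact: ltW.
apply: eq_integral => t _.
rewrite (@lebesgue_measure_affine a (f (cons_pair (0%R, t))))//; last first.
  by rewrite -[X in measurable X]setTI; exact: mcons2.
congr (_ * lebesgue_measure _); apply/seteqP; split => x /=;
  rewrite (_ : cons_pair ((a * x + f (cons_pair (0, t)))%R, t) = shear ord0 a f (cons_pair (x, t)))//;
  apply: eq_from_tnth => i; rewrite tnth_mktuple;
  (case: (unliftP ord0 i) => [i' ->|->]; first by rewrite !tnth_consS);
  rewrite eqxx !tnth_cons0; congr (_ + _)%R; apply: jf => i' ;
  case: (unliftP ord0 i') => [k ->|->]; rewrite ?eqxx// !tnth_consS//.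
Qed.

End LebesgueTupleMaps.

(** * Volume under translations and dilations *)

Section Volume.
Context {R : realType} (G : carnotGroup R).
Local Notation n := (carnot_dim G).
Local Notation w := (@carnot_weight _ G).
Local Notation corr := (@carnot_corr _ G).
Local Notation V := 'rV[R]_n.
Local Notation mul := (group_mul corr).
Local Notation dil r := (carnot_dilation (G := G) r).
Implicit Types (x y z u v a b : V) (j k l : 'I_n).
Local Opaque frame dframe ev lie_bracket.

Local Notation RT := (measurableTypeR R).
Local Notation pt := (@point_of_tuple R G).

Definition vol (A : set V) : \bar R := lebesgue_tuple R n (pt @^-1` A).
Definition mset (A : set V) : Prop := measurable (pt @^-1` A : set (n.-tuple RT)).
Definition mfun (f : V -> R) : Prop :=
  measurable_fun setT (f \o pt : n.-tuple RT -> RT).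

Definition tup x : n.-tuple RT := [tuple x 0 i | i < n].

Lemma tupK x : pt (tup x) = x.
Proof. by apply/rowP => j; rewrite mxE tnth_mktuple. Qed.

Lemma mset_preimage (f : V -> V) A : (forall j, mfun (fun x => f x 0 j)) ->
  mset A -> mset (f @^-1` A).
Proof.
move=> mf mA; rewrite /mset.
have mt : measurable_fun setT (tup \o f \o pt : n.-tuple RT -> n.-tuple RT).
  apply/measurable_fun_tnthP => i; have := mf i; congr measurable_fun.
  by apply/funext => t /=; rewrite tnth_mktuple.
have := mt measurableT _ mA; rewrite setTI.
by congr (measurable _); apply/seteqP; split => t /=; rewrite tupK.
Qed.

Lemma mfun_coord j : mfun (fun x => x 0 j).
Proof.
have := @measurable_tnth _ RT n j; congr measurable_fun.
by apply/funext => t /=; rewrite mxE.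
Qed.

Lemma mfun_cst c : mfun (fun=> c). Proof. exact: measurable_cst. Qed.
Lemma mfunD f g : mfun f -> mfun g -> mfun (fun x => f x + g x).
Proof. by move=> mf mg; exact: measurable_funD. Qed.
Lemma mfunM f g : mfun f -> mfun g -> mfun (fun x => f x * g x).
Proof. by move=> mf mg; exact: measurable_funM. Qed.

Lemma mfun_ext f g : (forall x, f x = g x) -> mfun f -> mfun g.
Proof. by move=> /funext ->. Qed.

Lemma mfun_row (F : V -> 'I_n -> R) j :
  mfun (fun x => F x j) -> mfun (fun x => (\row_i F x i : V) 0 j).
Proof. by apply: mfun_ext => x; rewrite mxE. Qed.

Lemma mfun_sum (I : Type) (r : seq I) (F : I -> V -> R) :
  (forall i, mfun (F i)) -> mfun (fun x => \sum_(i <- r) F i x).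
Proof.
move=> mF; elim: r => [|i r IH].
  by apply: mfun_ext (mfun_cst 0) => x; rewrite big_nil.
by apply: mfun_ext (mfunD (mF i) IH) => x; rewrite big_cons.
Qed.

Lemma mfunX f (m : nat) : mfun f -> mfun (fun x => f x ^+ m).
Proof.
move=> mf; elim: m => [|m IH]; first by apply: mfun_ext (mfun_cst 1).
by apply: mfun_ext (mfunM mf IH) => x; rewrite exprS.
Qed.

Lemma mfun_meval N (p : mpoly.mpoly N R) (f : 'I_N -> V -> R) :
  (forall i, mfun (f i)) -> mfun (fun x => mpoly.meval (fun i => f i x) p).
Proof.
move=> mf; apply: mfun_ext (fun x => esym (mpoly.mevalE _ _)) _.
apply: mfun_sum => m; apply: mfunM; first exact: mfun_cst.
elim: (index_enum _) => [|i r IHr].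
  by apply: mfun_ext (mfun_cst 1) => x; rewrite big_nil.
apply: mfun_ext (mfunM (mfunX (mpoly.fun_of_multinom m i) (mf i)) IHr) => x.
by rewrite big_cons.
Qed.

Lemma mfun_ev p (f g : V -> V) : (forall j, mfun (fun x => f x 0 j)) ->
  (forall j, mfun (fun x => g x 0 j)) -> mfun (fun x => ev p (f x) (g x)).
Proof.
move=> mf mg; apply: (@mfun_meval _ p (fun i x => pair_val (f x) (g x) i)) => i.
rewrite /pair_val; case: (split_ordP i) => k ->.
  by apply: mfun_ext (mf k) => x; rewrite row_mxEl.
by apply: mfun_ext (mg k) => x; rewrite row_mxEr.
Qed.

Lemma mfun_mul (f g : V -> V) j : (forall j, mfun (fun x => f x 0 j)) ->
  (forall j, mfun (fun x => g x 0 j)) -> mfun (fun x => mul (f x) (g x) 0 j).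
Proof.
move=> mf mg; apply: mfun_ext (mfun_ev (mul_poly j) mf mg) => x.
by rewrite group_mulE.
Qed.

Lemma vol_shear j (a : R) (f : V -> R) A : 0 < a -> mfun f ->
  (forall x y, (forall i, i != j -> x 0 i = y 0 i) -> f x = f y) -> mset A ->
  vol A = (a%:E * vol [set x : V | A (\row_i (if i == j then a * x 0 i + f x else x 0 i))%R])%E.
Proof.
move=> a0 mf jf mA; rewrite /vol (@lebesgue_shear R n j a (f \o pt))//.
  congr (_ * lebesgue_tuple R n _)%E; apply/seteqP; split => t /=;
  rewrite (_ : pt (shear j a (f \o pt) t) =
    \row_i (if i == j then a * pt t 0 i + f (pt t) else pt t 0 i))//;
  by apply/rowP => i; rewrite !mxE tnth_mktuple.
by move=> t t' tt; apply: jf => i ij; rewrite !mxE tt.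
Qed.

(** [T S] translates only the coordinates in an upward closed set S. If k is lightest in S, then
    [T S] is [T (S :\ k)] followed by a shear of coordinate k, whose shift involves only lighter
    coordinates, still untouched. *)
Lemma vol_mul a A : mset A -> vol [set x | A (mul a x)] = vol A.
Proof.
pose T (S : {set 'I_n}) x : V := \row_i (if i \in S then mul a x 0 i else x 0 i).
have mT S j : mfun (fun x => T S x 0 j).
  apply: (@mfun_row (fun x i => if i \in S then mul a x 0 i else x 0 i) j).
  case: (j \in S); last exact: mfun_coord.
  by apply: mfun_mul => i; [exact: mfun_cst|exact: mfun_coord].
suff H c (S : {set 'I_n}) : (#|S| <= c)%N ->
    (forall j l, j \in S -> (w j < w l)%N -> l \in S) ->
    forall A, mset A -> vol (T S @^-1` A) = vol A.
  move=> mA; pose full : {set 'I_n} := (~: finset.set0)%SET.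
  rewrite -(H _ full (leqnn _) _ A mA)//; last by move=> j l _ _; rewrite !inE.
  congr vol; apply/seteqP; split => x /=; rewrite (_ : T full x = mul a x)//;
  by apply/rowP => i; rewrite mxE !inE.
elim: c S => [|c IH] S Sc Sup B mB.
  congr vol; apply/seteqP; split => x /=; rewrite (_ : T S x = x)//;
  apply/rowP => i; rewrite mxE;
  by move: Sc; rewrite leqn0 cards_eq0 => /eqP ->; rewrite inE.
have [S0|[k0 k0S]] := set_0Vmem S.
  by apply: IH; rewrite ?S0 ?cards0// -S0.
pose k := [arg min_(i < k0 in S) w i]%N.
have [kS kmin] : k \in S /\ forall j, j \in S -> (w k <= w j)%N.
  by rewrite /k; case: arg_minnP.
pose f x := a 0 k + ev (corr k) a x.
pose s x : V := \row_i (if i == k then 1 * x 0 i + f x else x 0 i).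
have mf : mfun f.
  apply: mfunD; first exact: mfun_cst.
  by apply: mfun_ev => i; [exact: mfun_cst|exact: mfun_coord].
have ms i : mfun (fun x => s x 0 i).
  apply: (@mfun_row (fun x i => if i == k then 1 * x 0 i + f x else x 0 i) i).
  case: (i == k); last exact: mfun_coord.
  by apply: mfunD => //; apply: mfunM; [exact: mfun_cst|exact: mfun_coord].
have -> : vol B = vol (s @^-1` B).
  rewrite (@vol_shear k 1 f B)// ?mul1e// => x y xy; congr (_ + _).
  by apply: corr_dep => // i ik; apply: xy; apply: contraTneq ik => ->; rewrite ltnn.
rewrite -(IH (S :\ k) _ _ (s @^-1` B)); first last.
- exact: mset_preimage.
- move=> j l; rewrite !inE => /andP[jk jS] jl; rewrite (Sup j l jS jl) andbT.
  by apply: contraTneq jl => ->; rewrite -leqNgt kmin.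
- by move: Sc; rewrite (cardsD1 k) kS.
have sT x : s (T (S :\ k) x) = T S x.
  apply/rowP => i; rewrite [LHS]mxE [RHS]mxE [T (S :\ k) x 0 i]mxE !inE.
  have [->|ik]//= := eqVneq i k; rewrite kS mul_coord mul1r /f addrCA addrA.
  congr (_ + _); apply: corr_dep => // l lk; rewrite mxE !inE.
  rewrite (_ : l \in S = false) ?andbF//; apply/negbTE; apply: contraTN lk => /kmin.
  by rewrite -leqNgt.
by congr vol; apply/seteqP; split => x /=; rewrite sT.
Qed.

Definition hdim : nat := (\sum_j w j)%N.

Lemma vol_dil (r : R) A : 0 < r -> mset A ->
  vol A = ((r ^+ hdim)%:E * vol [set x | A (dil r x)])%E.
Proof.
move=> r0.
pose T (S : seq 'I_n) x : V := \row_i (if i \in S then r ^+ w i * x 0 i else x 0 i).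
have mT S j : mfun (fun x => T S x 0 j).
  apply: (@mfun_row (fun x i => if i \in S then r ^+ w i * x 0 i else x 0 i) j).
  case: (j \in S); last exact: mfun_coord.
  by apply: mfunM; [exact: mfun_cst|exact: mfun_coord].
suff H (S : seq 'I_n) : uniq S -> forall A, mset A ->
    vol A = ((r ^+ (\sum_(i <- S) w i)%N)%:E * vol (T S @^-1` A))%E.
  move=> mA; rewrite (H (index_enum 'I_n))//; last exact: index_enum_uniq.
  congr (_ * vol _)%E; apply/seteqP; split => x /=;
  rewrite (_ : T (index_enum 'I_n) x = dil r x)//;
  by apply/rowP => i; rewrite mxE mem_index_enum dilE.
elim: S => [_ B mB|k S IH /= /andP[kS uS] B mB].
  rewrite big_nil expr0 mul1e; congr vol.
  by apply/seteqP; split => x /=; rewrite (_ : T [::] x = x)//; apply/rowP => i; rewrite mxE.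
rewrite big_cons exprD EFinM.
rewrite (@vol_shear k (r ^+ w k) (fun=> 0) B) ?exprn_gt0//; last exact: mfun_cst.
pose s x : V := \row_i (if i == k then r ^+ w k * x 0 i + 0 else x 0 i).
have ms i : mfun (fun x => s x 0 i).
  apply: (@mfun_row (fun x i => if i == k then r ^+ w k * x 0 i + 0 else x 0 i) i).
  case: (i == k); last exact: mfun_coord.
  by apply: mfunD => //; [apply: mfunM; [exact: mfun_cst|exact: mfun_coord]|exact: mfun_cst].
rewrite (IH uS (s @^-1` B)); last exact: mset_preimage.
rewrite -muleA; congr (_ * (_ * vol _))%E.
apply/seteqP; split => x /=; rewrite (_ : s (T S x) = T (k :: S) x)//;
  apply/rowP => i; rewrite !mxE inE; have [->|ik]//= := eqVneq i k;
  by rewrite (negbTE kS) addr0.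
Qed.

Lemma lebesgue_tuple_prod m (B : 'I_m -> set RT) : (forall i, measurable (B i)) ->
  lebesgue_tuple R m [set t | forall i, B i (tnth t i)] =
  (\prod_(i < m) @lebesgue_measure R (B i))%E.
Proof.
elim: m B => [|m IH] B mB.
  rewrite big_ord0 /= diracE mem_set//=; by case.
have mset_prod k (C : 'I_k -> set RT) : (forall i, measurable (C i)) ->
    measurable [set t : k.-tuple RT | forall i, C i (tnth t i)].
  move=> mC; have -> : [set t : k.-tuple RT | forall i, C i (tnth t i)] =
      \bigcap_(i in [set: 'I_k]) ((fun t : k.-tuple RT => tnth t i) @^-1` C i).
    by apply/seteqP; split => t h i //=; exact: h.
  apply: fin_bigcap_measurable => // i _; rewrite -[X in measurable X]setTI.
  exact: measurable_tnth.
rewrite big_ord_recl -(IH (fun i => B (lift ord0 i)))// lebesgue_tupleS.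
have -> : @lebesgue_measure R (B ord0) = (\int[@lebesgue_measure R]_x (\1_(B ord0) x)%:E)%E.
  by rewrite integral_indic// setIT.
rewrite -ge0_integralZr//; last exact/measurable_EFinP.
apply: eq_integral => x _ /=; rewrite indicE.
have [xB|xB] := boolP (x \in B ord0); rewrite ?mul1e ?mul0e.
  congr (lebesgue_tuple R m _); apply/seteqP; split => t /= h i.
    by rewrite -(tnth_consS x); exact: h.
  by case: (unliftP ord0 i) => [i' ->|->]; rewrite ?tnth_consS//; move: xB; rewrite inE.
rewrite [X in lebesgue_tuple R m X](_ : _ = set0) ?measure0//.
by apply/seteqP; split => t //= /(_ ord0); move: xB; rewrite notin_setE.
Qed.

Lemma vol_prod (B : 'I_n -> set RT) : (forall i, measurable (B i)) ->
  mset [set x | forall i, B i (x 0 i)] /\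
  vol [set x | forall i, B i (x 0 i)] = (\prod_(i < n) @lebesgue_measure R (B i))%E.
Proof.
move=> mB; have E : pt @^-1` [set x | forall i, B i (x 0 i)] =
    [set t : n.-tuple RT | forall i, B i (tnth t i)].
  by apply/seteqP; split => t /= h i; have := h i; rewrite mxE.
rewrite /vol /mset E lebesgue_tuple_prod//; split => //.
have -> : [set t : n.-tuple RT | forall i, B i (tnth t i)] =
      \bigcap_(i in [set: 'I_n]) ((fun t : n.-tuple RT => tnth t i) @^-1` B i).
  by apply/seteqP; split => t h i //=; exact: h.
apply: fin_bigcap_measurable => // i _; rewrite -[X in measurable X]setTI.
exact: measurable_tnth.
Qed.
End Volume.

(** * Integer points, the fundamental domain and counting in boxes *)

Section IntegerPoints.
Context {R : realType} (G : carnotGroup R).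
Local Notation n := (carnot_dim G).
Local Notation w := (@carnot_weight _ G).
Local Notation corr := (@carnot_corr _ G).
Local Notation V := 'rV[R]_n.
Local Notation mul := (group_mul corr).
Implicit Types (x y z u v a b : V) (j k l : 'I_n).
Local Opaque frame dframe ev lie_bracket.

(** Integer vectors form a countable type with decidable equality, so that lattice points can be
    listed in sequences and enumerated by [pickle]. *)
Definition iv (z : 'rV[int]_n) : V := map_mx intr z.

Lemma ivE (z : 'rV[int]_n) j : iv z 0 j = (z 0 j)%:~R. Proof. by rewrite mxE. Qed.

Lemma integer_pointP x : integer_point x -> exists p : 'rV[int]_n, x = iv p.
Proof.
move=> xi; exists (\row_j Num.floor (x 0 j)); apply/rowP => j; rewrite !mxE.
by rewrite floorK.
Qed.

Lemma iv_integer (z : 'rV[int]_n) : integer_point (iv z).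
Proof. by move=> j; rewrite ivE intr_int. Qed.

Lemma iv_inj : injective iv.
Proof.
move=> p q /rowP e; apply/rowP => j; have := e j; rewrite !ivE.
by move/intr_inj.
Qed.

Lemma meval_int N (p : mpoly.mpoly N R) (f : 'I_N -> R) :
  p \is a mpoly.mpolyOver _ Num.int -> (forall i, f i \is a Num.int) ->
  mpoly.meval f p \is a Num.int.
Proof.
move=> /mpoly.mpolyOverP pi fi; rewrite mpoly.mevalE; apply: rpred_sum => m _.
by apply: rpredM => //; apply: rpred_prod => i _; apply: rpredX.
Qed.

Lemma integer_mul x y : rational_carnot G ->
  integer_point x -> integer_point y -> integer_point (mul x y).
Proof.
move=> Grat xi yi j; rewrite mul_coord; apply: rpredD; first exact: rpredD.
apply: meval_int => // i; rewrite /pair_val.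
by case: (split_ordP i) => l ->; rewrite ?row_mxEl ?row_mxEr.
Qed.

Lemma integer_opp x : integer_point x -> integer_point (- x).
Proof. by move=> xi j; rewrite mxE rpredN. Qed.

Lemma mul_taill i x y j : tail i x -> (w j <= i)%N -> mul x y 0 j = x 0 j + y 0 j.
Proof.
move=> tx ji; rewrite mul_coord -[X in _ + X](_ : 0 = _) ?addr0//.
rewrite -(corr0l j y); apply: corr_dep => // l lj; rewrite mxE tx//.
exact: leq_trans lj ji.
Qed.

Definition unit_cube : set V := [set x | forall j, 0 <= x 0 j < 1].

(** Integer parts are removed weight by weight: [z'] lives in layer m + 1, so dividing by it
    subtracts floors there and leaves lighter coordinates alone. Rationality keeps the accumulated
    point integral. *)
Lemma fundamental_domain x : rational_carnot G ->
  exists2 z, integer_point z & unit_cube (mul (- z) x).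
Proof.
move=> Grat; suff [z zi zc] : exists2 z, integer_point z &
    forall j, (w j <= carnot_step G)%N -> 0 <= mul (- z) x 0 j < 1.
  by exists z => // j; apply: zc; have /andP[] := @carnot_weightP _ G j.
elim: (carnot_step G) => [|m [z zi zc]].
  exists 0 => [j|j]; first by rewrite mxE rpred0.
  by have := weight_gt0 j; lia.
pose y := mul (- z) x.
pose z' : V := \row_j (if w j == m.+1 then (Num.floor (y 0 j))%:~R else 0).
have tz' : tail m.+1 (- z').
  by move=> j jm; rewrite !mxE ltn_eqF// oppr0.
exists (mul z z').
  apply: integer_mul => // j; rewrite mxE; case: ifP => _; last exact: rpred0.
  exact: intr_int.
move=> j jm; rewrite -mul_inv -mulA -/y (mul_taill _ tz')// [(- z') 0 j]mxE [z' 0 j]mxE.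
move: jm; rewrite leq_eqVlt => /predU1P[->|jm].
  rewrite eqxx addrC subr_ge0 floor_le ltrBlDl -[X in _ + X](_ : 1%:~R = 1)//.
  by rewrite -intrD floorD1_gt.
by rewrite ltn_eqF// oppr0 add0r; apply: zc.
Qed.

(** Multiplication is bounded on a fixed box, and dilations carry this to every t with the same
    constant. It plays the role of the triangle inequality for boxes. *)
Lemma mul_hbounded C : exists2 K, 0 < K & forall t a b, 0 < t ->
  (forall j, `|a 0 j| <= C * t ^+ w j) -> (forall j, `|b 0 j| <= C * t ^+ w j) ->
  forall j, `|mul a b 0 j| <= K * t ^+ w j.
Proof.
have [K HK] := mul_bounded G C; exists (`|K| + 1); first by rewrite ltr_wpDl.
move=> t a b t0 ha hb j; have tn : t != 0 by rewrite gt_eqF.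
rewrite -(dilK a tn) -(dilK b tn) mul_dil// dilE normrM mulrC.
rewrite (ger0_norm (exprn_ge0 (w j) (ltW t0))) ler_wpM2r ?exprn_ge0 ?(ltW t0)//.
apply: le_trans (HK _ _ (bnd_dil t0 ha) (bnd_dil t0 hb) j) _.
by rewrite (le_trans (ler_norm _))// lerDl.
Qed.

Definition cbox (C t : R) : set V := [set x | forall j, `|x 0 j| <= C * t ^+ w j].

Lemma card_cond_ord (m p : nat) : (p <= m)%N -> #|[pred i : 'I_m | (i < p)%N]| = p.
Proof.
move=> pm; rewrite -sum1_card -[RHS](card_ord p) -sum1_card.
exact: (big_ord_narrow pm).
Qed.

Lemma int_box (lo : 'I_n -> int) (m : 'I_n -> nat) : exists s : seq 'rV[int]_n,
  [/\ uniq s, size s = (\prod_j m j)%N &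
  forall p : 'rV[int]_n, p \in s <-> forall j, (lo j <= p 0%R j < lo j + (m j)%:Z)%R].
Proof.
pose B := (\sum_j m j)%N.
have mB j : (m j <= B)%N by rewrite /B (bigD1 j)//= leq_addr.
pose F (j : 'I_n) := [pred i : 'I_B | (i < m j)%N].
pose e (f : {ffun 'I_n -> 'I_B}) : 'rV[int]_n := \row_j ((f j : nat)%:Z + lo j).
have e_inj : injective e.
  move=> f g /rowP h; apply/ffunP => j; apply/val_inj => /=.
  by have := h j; rewrite !mxE; lia.
exists (map e (enum (family F))); split.
- by rewrite map_inj_uniq// enum_uniq.
- rewrite size_map -cardE card_family foldrE big_image/=.
  by apply: eq_bigr => j _; rewrite card_cond_ord.
move=> p; split=> [/mapP[f]|zb].
  rewrite mem_enum => /familyP fF -> j; have := fF j; rewrite !inE mxE.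
  by move: (nat_of_ord (f j)) (m j) (lo j) => i m' l; lia.
have zB j : (absz (p 0%R j - lo j)%R < B)%N.
  by apply: leq_trans (mB j); have := zb j; lia.
apply/mapP; exists [ffun j => Ordinal (zB j)].
  rewrite mem_enum; apply/familyP => j; rewrite !inE ffunE /=; have := zb j; lia.
by apply/rowP => j; rewrite mxE ffunE /=; have := zb j; lia.
Qed.

Lemma hdim_prod (r : R) : \prod_j r ^+ w j = r ^+ hdim G.
Proof. by rewrite /hdim expr_sum. Qed.

Lemma intbox_real (C t : R) : 0 <= C -> 1 <= t -> exists s : seq 'rV[int]_n,
  [/\ uniq s, (size s)%:R <= (2 * C + 1) ^+ n * t ^+ hdim G &
  forall p : 'rV[int]_n, p \in s <-> cbox C t (iv p)].
Proof.
move=> C0 t1; have t0 : 0 <= t by apply: le_trans t1.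
have ct j : 0 <= C * t ^+ w j by rewrite mulr_ge0 ?exprn_ge0.
pose b j := `|Num.floor (C * t ^+ w j)|%N.
have [s [us ss sP]] := int_box (fun j => - (b j)%:Z) (fun j => (b j).*2.+1).
exists s; split => //.
  rewrite ss natr_prod -hdim_prod -[X in _ ^+ X]card_ord -prodr_const -big_split/=.
  apply: ler_prod => j _; rewrite ler0n/=.
  have f0 : 0 <= Num.floor (C * t ^+ w j) by rewrite floor_ge0.
  have fl : (`|Num.floor (C * t ^+ w j)|%N)%:R <= C * t ^+ w j :> R.
    by rewrite -[leLHS]mulrz_nat natz gez0_abs// floor_le.
  (* As t >= 1, the summand 1 in the number 2 floor(C t^w) + 1 of integers is absorbed into t^w. *)
  have tw : 1 <= t ^+ w j by rewrite exprn_ege1.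
  rewrite -addn1 -muln2 natrD natrM; lra.
move=> p; rewrite sP; split=> h j.
  rewrite ivE -intr_norm; have := h j => hj.
  have f0 : 0 <= Num.floor (C * t ^+ w j) by rewrite floor_ge0.
  apply: le_trans (floor_le _); rewrite ler_int -(gez0_abs f0).
  by move: hj; rewrite /b; move: `|Num.floor _|%N (p 0%R j) => m m'; lia.
have := h j; rewrite ivE -intr_norm -floor_ge_int /b.
by move: (Num.floor _) (p 0 j) => m m'; lia.
Qed.

Lemma vol_cbox C t y : 0 <= C -> 0 <= t ->
  mset [set x | cbox C t (mul y x)] /\
  vol [set x | cbox C t (mul y x)] = ((2 * C) ^+ n * t ^+ hdim G)%:E.
Proof.
move=> C0 t0.
pose B j : set R := `[- (C * t ^+ w j), C * t ^+ w j]%classic.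
have E : cbox C t = [set x : V | forall j, B j (x 0 j)].
  by apply/seteqP; split => x h j; have := h j; rewrite /B /= in_itv/= ler_norml.
have [mb vb] := vol_prod (fun j => measurable_itv _ : measurable (B j)).
have {}mb : mset (cbox C t) by rewrite E.
have {}vb : vol (cbox C t) = (\prod_(i < n) @lebesgue_measure R (B i))%E by rewrite E.
split.
  apply: (@mset_preimage _ _ (mul y) (cbox C t)) => // j.
  by apply: mfun_mul => i; [exact: mfun_cst|exact: mfun_coord].
rewrite vol_mul// vb -hdim_prod -[X in _ ^+ X]card_ord -prodr_const -big_split/= -prodEFin.
apply: eq_bigr => j _; rewrite /B lebesgue_measure_itv/= lte_fin.
have : 0 <= C * t ^+ w j by rewrite mulr_ge0 ?exprn_ge0.
rewrite -[2 * C * _]mulrA; move: (C * _) => c; rewrite le_eqVlt => /predU1P[<-|p0].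
  by rewrite oppr0 ltxx mulr0.
rewrite ifT; last by lra.
by rewrite -EFinD; congr _%:E; ring.
Qed.
End IntegerPoints.

(** * Hausdorff dimension *)

Section HausdorffLowerBound.
Context {R : realType} (G : carnotGroup R).
Local Notation n := (carnot_dim G).
Local Notation w := (@carnot_weight _ G).
Local Notation corr := (@carnot_corr _ G).
Local Notation V := 'rV[R]_n.
Local Notation mul := (group_mul corr).
Implicit Types (x y z u v a b : V) (j k l : 'I_n).
Local Opaque frame dframe ev lie_bracket.

Context (ip : {dot (subvs_of (horizontal_space G)) for idfun}).
Local Notation d := (carnot_dist ip).

Lemma mul_cancel a x y : mul (- mul a x) (mul a y) = mul (- x) y.
Proof. by rewrite -mul_inv -mulA mulKx. Qed.

Lemma dist_left0 x y : d x y = d 0 (mul (- x) y).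
Proof. by rewrite -(dist_left ip (- x)) mulVx. Qed.

Lemma dist_cbox : exists2 C, 0 < C & forall D x y, 0 <= D -> (d x y <= D%:E)%E ->
  cbox C D (mul (- x) y).
Proof.
have [C C0 HC] := dist_lower ip.
(* [dist_lower] asks for a strict inequality; it is applied with 2D, and 2^(w j) is at most 2 to the
   power of the step. *)
pose C' := C * 2 ^+ carnot_step G.
have C'0 : 0 < C' by rewrite mulr_gt0// exprn_gt0.
exists C' => // D x y; rewrite dist_left0 le_eqVlt => /predU1P[<-|D0] dD j.
  rewrite expr0n (gtn_eqF (weight_gt0 j)) mulr0 -(mulr0 C).
  (* For D = 0 the strict bound holds with every L > 0; this L makes C L^(w j) at most e. *)
  apply/ler_addgt0Pr => e e0; pose L := Num.min 1 (e / C).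
  have L0 : 0 < L by rewrite lt_min ltr01 divr_gt0.
  have dL : (d 0 (mul (- x) y) < L%:E)%E by rewrite (le_lt_trans dD) ?lte_fin.
  apply: le_trans (HC _ _ L0 dL j) _; rewrite mulr0 add0r.
  have : L ^+ w j <= L.
    by rewrite -[leRHS]expr1 ler_wiXn2l ?(ltW L0) ?weight_gt0// ge_min lexx.
  move=> Lw; rewrite -ler_pdivlMl// mulrC (le_trans Lw)// ge_min lexx orbT//.
have L0 : 0 < 2 * D by rewrite mulr_gt0.
have dL : (d 0 (mul (- x) y) < (2 * D)%:E)%E.
  by rewrite (le_lt_trans dD)// lte_fin; lra.
apply: le_trans (HC _ _ L0 dL j) _; rewrite exprMn mulrA ler_wpM2r ?exprn_ge0 ?(ltW D0)//.
rewrite ler_wpM2l ?(ltW C0)// ler_weXn2l ?ler1n//.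
by have /andP[] := @carnot_weightP _ G j.
Qed.

Lemma vol_unit_cube : mset (@unit_cube R G) /\ vol (@unit_cube R G) = 1%E.
Proof.
pose B (j : 'I_n) : set R := `[0, 1[%classic.
have [mb vb] := vol_prod (fun j => measurable_itv _ : measurable (B j)).
have E : @unit_cube R G = [set x : V | forall j, B j (x 0 j)].
  by apply/seteqP; split => x h j; have := h j; rewrite /B /= in_itv.
rewrite E; split => //; rewrite vb big1// => j _.
by rewrite /B lebesgue_measure_itv/= lte_fin ltr01 sube0.
Qed.

Lemma hdim_gt0 : (0 < hdim G)%N.
Proof.
rewrite /hdim (bigD1 (Ordinal (carnot_dim_gt0 G)))//= addn_gt0.
by rewrite weight_gt0.
Qed.

Lemma vol_cover (A : set V) (W : nat -> set V) : mset A -> (forall i, mset (W i)) ->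
  A `<=` \bigcup_i W i -> (vol A <= \sum_(0 <= i <oo) vol (W i))%E.
Proof.
move=> mA mW AW.
apply: (measure_sigma_subadditive (lebesgue_tuple R n)
  (F := fun i => point_of_tuple (G := G) @^-1` W i)) => //.
by move=> t /AW[i _ h]; exists i.
Qed.

(** A set of diameter D lies in a box of volume c D^Q. If s < Q and D <= 1 then D^Q <= D^s, so a
    cover of the unit cube whose sum of D^s is below 1/c would give the cube volume less than 1. *)
Lemma hausdorff_lower s : 0 < s -> hausdorff_measure d s [set: V] = 0%E -> (hdim G)%:R <= s.
Proof.
move=> s0 H0; rewrite leNgt; apply/negP => sQ.
have [C C0 HC] := dist_cbox.
pose c := (2 * C) ^+ n; have c0 : 0 < c by rewrite exprn_gt0// mulr_gt0.
have pre : (hausdorff_premeasure d s 1 [set: V] <= 0)%E.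
  by rewrite -H0; apply: ereal_sup_ubound; exists 1 => /=.
have : (hausdorff_premeasure d s 1 [set: V] < (c^-1)%:E)%E.
  by apply: le_lt_trans pre _; rewrite lte_fin invr_gt0.
move=> /ereal_inf_lt[_ [U [Ucov Ud] <-]].
pose D i := fine (diameter d (U i)).
have d0 i : (0 <= diameter d (U i))%E by apply: ereal_sup_ubound; left.
have DE i : diameter d (U i) = (D i)%:E.
  rewrite fineK// ge0_fin_numE//; exact: le_lt_trans (Ud i) (ltry _).
have D0 i : 0 <= D i by rewrite -lee_fin -DE.
have D1 i : D i <= 1 by rewrite -lee_fin -DE.
have [W HW] : {W : nat -> set V & forall i, [/\ U i `<=` W i, mset (W i) &
    (vol (W i) <= (c * D i ^+ hdim G)%:E)%E]}.
  apply: (@choice _ _ (fun i W => [/\ U i `<=` W, mset W &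
    (vol W <= (c * D i ^+ hdim G)%:E)%E])) => i.
  have [[x Ux]|Uk] := pselect (U i !=set0); last first.
    exists set0; split.
    - by move=> y Uy; exfalso; apply: Uk; exists y.
    - exact: measurable0.
    - by rewrite /vol preimage_set0 measure0 lee_fin mulr_ge0 ?(ltW c0) ?exprn_ge0.
  have [m1 m2] := vol_cbox (- x) (ltW C0) (D0 i).
  exists [set y | cbox C (D i) (mul (- x) y)]; split => //; last by rewrite m2.
  move=> y Uy /=; apply: HC => //; rewrite -DE.
  by apply: ereal_sup_ubound; right; exists (x, y).
have [mI vI] := vol_unit_cube.
have mW i : mset (W i) by have [] := HW i.
have /(vol_cover mI mW) : unit_cube (G := G) `<=` \bigcup_i W i.
  by move=> x _; have [i _ Ux] := Ucov x I; exists i => //; have [h _ _] := HW i; exact: h.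
rewrite vI => cov Ulim; suff : (1 < 1 :> \bar R)%E by rewrite ltxx.
apply: le_lt_trans cov _.
apply: (@le_lt_trans _ _ (\sum_(0 <= i <oo) (c%:E * (diameter d (U i) `^ s)))%E).
  apply: lee_nneseries => [i _ _|i _].
    exact: measure_ge0.
  have [_ _ /le_trans->//] := HW i.
  rewrite DE poweR_EFin -EFinM lee_fin ler_wpM2l ?(ltW c0)//.
  have [->|Dk] := eqVneq (D i) 0.
    by rewrite powR0 ?gt_eqF// expr0n gtn_eqF// hdim_gt0.
  have Dp : 0 < D i by rewrite lt_def Dk D0.
  rewrite -powR_mulrn//; apply: ger_powR; first by rewrite Dp D1.
  exact: ltW.
rewrite nneseriesZl => [|i _]; last exact: poweR_ge0.
by rewrite -lte_pdivlMl// mule1.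
Qed.
End HausdorffLowerBound.

(** * Generalities on Hausdorff measure *)

Section HausdorffMeasure.
Context {R : realType} {T : Type} (d : T -> T -> \bar R).
Local Open Scope ereal_scope.

Lemma diameter0 : diameter d set0 = 0.
Proof.
apply/eqP; rewrite eq_le ereal_sup_ubound ?andbT; last by left.
by apply: ub_ereal_sup => _ [->//|[z [[]]]].
Qed.

Lemma diameter_ge0 A : 0 <= diameter d A.
Proof. by apply: ereal_sup_ubound; left. Qed.

Lemma hausdorff_premeasure_ge0 s delta A : 0 <= hausdorff_premeasure d s delta A.
Proof.
by apply: le_ereal_inf_tmp => _ [U _ <-]; apply: nneseries_ge0 => *; exact: poweR_ge0.
Qed.

(** The finite cover is padded with empty sets, which cost nothing: their diameter is 0 by
    convention, and s > 0 makes its s-th power vanish. *)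
Lemma hausdorff_premeasure_seq (I : eqType) (i0 : I) (r : seq I) (U : I -> set T) (s delta e : R) A :
  (0 < s)%R -> (0 <= e <= delta)%R -> (forall x, A x -> exists2 i, i \in r & U i x) ->
  (forall i, i \in r -> diameter d (U i) <= e%:E) ->
  hausdorff_premeasure d s delta A <= ((size r)%:R * e `^ s)%:E.
Proof.
move=> s0 /andP[e0 ed] AU Ue.
pose W m := if (m < size r)%N then U (nth i0 r m) else set0.
have We m : diameter d (W m) <= e%:E.
  rewrite /W; case: ltnP => mr; first by apply: Ue; exact: mem_nth.
  by rewrite diameter0 lee_fin.
apply: (@le_trans _ _ (\sum_(0 <= m <oo) (diameter d (W m) `^ s))).
  apply: ereal_inf_lbound; exists W => //; split.
    move=> x /AU[i ir Uix]; exists (index i r) => //.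
    by rewrite /W index_mem ir nth_index.
  by move=> m; rewrite (le_trans (We m))// lee_fin.
rewrite (nneseries_split 0 (size r)) => [|m _]; last exact: poweR_ge0.
rewrite add0n [X in _ + X]eseries0 => [|m sm _]; last first.
  rewrite /W ltnNge sm/= diameter0 poweR_EFin powR0 ?gt_eqF//.
rewrite adde0 big_mkord.
apply: (@le_trans _ _ (\sum_(i < size r) (e `^ s)%:E)).
  apply: lee_sum => i _; rewrite -poweR_EFin.
  by apply: gt0_ler_poweR; rewrite ?(ltW s0) ?in_itv/= ?leey ?andbT ?diameter_ge0 ?lee_fin.
by rewrite sumEFin sumr_const card_ord mulr_natl.
Qed.

(** The i-th set is covered at cost eps / 2^(i+1), and the double sequence of covering sets is
    enumerated by a bijection from nat to pairs. *)
Lemma hausdorff_measure_bigcup0 (s : R) (A : (set T)^nat) : (0 < s)%R ->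
  (forall i delta, (0 < delta)%R -> hausdorff_premeasure d s delta (A i) = 0) ->
  hausdorff_measure d s (\bigcup_i A i) = 0.
Proof.
move=> s0 HA; apply/eqP; rewrite eq_le; apply/andP; split; last first.
  apply: le_trans (hausdorff_premeasure_ge0 s 1 (\bigcup_i A i)) _.
  by apply: ereal_sup_ubound; exists 1%R => /=.
apply: ub_ereal_sup => _ [delta /= d0 <-]; apply/lee_addgt0Pr => eps e0; rewrite add0e.
have ei i : (0 < eps / (2 ^ i.+1)%:R)%R.
  by rewrite divr_gt0// ltr0n expn_gt0.
have [U HU] : {U : nat -> (set T)^nat & forall i, [/\ A i `<=` \bigcup_k U i k,
    forall k, diameter d (U i k) <= delta%:E &
    \sum_(0 <= k <oo) (diameter d (U i k) `^ s) <= (eps / (2 ^ i.+1)%:R)%:E]}.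
  apply: (@choice _ _ (fun i (U : (set T)^nat) => [/\ A i `<=` \bigcup_k U k,
    forall k, diameter d (U k) <= delta%:E &
    \sum_(0 <= k <oo) (diameter d (U k) `^ s) <= (eps / (2 ^ i.+1)%:R)%:E])) => i.
  have : hausdorff_premeasure d s delta (A i) < (eps / (2 ^ i.+1)%:R)%:E.
    by rewrite HA// lte_fin.
  by move=> /ereal_inf_lt[_ [W [WA Wd] <-] /ltW We]; exists W.
have /card_esym/ppcard_eqP[f] := card_nat2.
pose W k := U (f k).1 (f k).2.
apply: (@le_trans _ _ (\sum_(0 <= k <oo) (diameter d (W k) `^ s))).
  apply: ereal_inf_lbound; exists W => //; split.
    move=> x [i _ /(let: And3 h _ _ := HU i in h)[m _ Ux]].
    have [k _ fk] := 'surj_f (I : [set: nat * nat] (i, m)).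
    by exists k => //; rewrite /W fk.
  by move=> k; have [_ h _] := HU (f k).1; exact: h.
have p0 i m : 0 <= diameter d (U i m) `^ s by exact: poweR_ge0.
rewrite nneseries_esumT => [|k]; last exact: p0.
rewrite -(@reindex_esum _ _ _ setT setT f (fun z => diameter d (U z.1 z.2) `^ s)); last exact: 'bij_f.
have := @esum_esum R _ _ setT (fun=> setT) (fun i m => diameter d (U i m) `^ s).
rewrite (_ : setT `*`` (fun=> setT) = setT) => [<- //|]; last by apply/seteqP.
rewrite (eq_esum (b := fun i => \sum_(0 <= m <oo) (diameter d (U i m) `^ s))) => [|i _]; last first.
  by rewrite nneseries_esumT.
rewrite -nneseries_esumT => [|i]; last by apply: nneseries_ge0 => *; exact: p0.
apply: le_trans (epsilon_trick0 xpredT (ltW e0)).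
apply: lee_nneseries => i _; first by move=> _; apply: nneseries_ge0 => *; exact: p0.
by have [] := HU i.
Qed.

End HausdorffMeasure.

(** * Upper bound for the Hausdorff dimension *)

Section HausdorffUpperBound.
Context {R : realType} (G : carnotGroup R).
Local Notation n := (carnot_dim G).
Local Notation w := (@carnot_weight _ G).
Local Notation corr := (@carnot_corr _ G).
Local Notation V := 'rV[R]_n.
Local Notation mul := (group_mul corr).
Local Notation dil r := (carnot_dilation (G := G) r).
Implicit Types (x y z u v a b : V) (j k l : 'I_n).
Local Opaque frame dframe ev lie_bracket.

Context (ip : {dot (subvs_of (horizontal_space G)) for idfun}).
Local Notation d := (carnot_dist ip).

Lemma unit_cube_cbox t x : 1 <= t -> unit_cube x -> cbox 1 t x.
Proof.
move=> t1 ux j; have /andP[x0 x1] := ux j.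
by rewrite mul1r ger0_norm// (le_trans (ltW x1))// exprn_ege1.
Qed.

Lemma cboxN C t x : cbox C t x -> cbox C t (- x).
Proof. by move=> h j; rewrite mxE normrN. Qed.

Lemma dilN r x : dil r (- x) = - dil r x.
Proof. by apply/rowP => j; rewrite dilE [(- x) 0 j]mxE [RHS]mxE dilE mulrN. Qed.

(** Dilating by M and translating maps the tile into the unit cube, where quotients of two points
    lie in a box of size K. *)
Lemma diameter_tile (K C : R) : 0 < K -> 0 < C ->
  (forall a b, cbox 1 1 a -> cbox 1 1 b -> cbox K 1 (mul a b)) ->
  (forall t x, 0 < t -> (forall j, `|x 0 j| <= t ^+ w j) -> (d 0 x <= (C * t)%:E)%E) ->
  forall M z p, 1 <= M ->
  (diameter d [set x | unit_cube (mul (- p) (dil M (mul (- z) x)))] <=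
    (C * (K + 1) / M)%:E)%E.
Proof.
move=> K0 C0 HK HC M z p M1; have M0 : 0 < M by apply: lt_le_trans M1.
apply: ub_ereal_sup => _ [->|[[x y] [/= ux uy] <-]].
  by rewrite lee_fin divr_ge0 ?mulr_ge0 ?addr_ge0 ?(ltW C0) ?(ltW K0) ?(ltW M0).
rewrite dist_left0 -mulrA; apply: HC => [|j]; first by rewrite divr_gt0// ltr_wpDl// ltW.
have Mn : M != 0 by rewrite gt_eqF.
have E : dil M (mul (- x) y) =
    mul (- mul (- p) (dil M (mul (- z) x))) (mul (- p) (dil M (mul (- z) y))).
  by rewrite mul_cancel -dilN mul_dil// mul_cancel.
have : `|dil M (mul (- x) y) 0 j| <= K * 1 ^+ w j.
  rewrite E; apply: HK; first exact/cboxN/unit_cube_cbox.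
  exact/unit_cube_cbox.
rewrite dilE normrM expr1n mulr1 (ger0_norm (exprn_ge0 _ (ltW M0))) => h.
rewrite expr_div_n ler_pdivlMr ?exprn_gt0// mulrC (le_trans h)//.
(* Since K + 1 >= 1, one has K <= (K + 1)^(w j). *)
rewrite (@le_trans _ _ (K + 1))// ?lerDl// -[leLHS]expr1 ler_weXn2l ?weight_gt0//.
by rewrite lerDr ltW.
Qed.

(** Countably many integer translates of the unit cube cover the group. Each is cut into O(M^Q)
    tiles of diameter at most D / M, at a total cost O(M^(Q - s)), which tends to 0. *)
Lemma hausdorff_upper (s : R) : rational_carnot G -> (hdim G)%:R < s ->
  hausdorff_measure d s [set: V] = 0%E.
Proof.
move=> Grat Qs; have s0 : 0 < s by apply: le_lt_trans Qs.
have [K K0 HK] := mul_hbounded G 1.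
have [C C0 HC] := dist_upper ip.
pose zi (i : nat) : V := iv (odflt 0 (unpickle i) : 'rV[int]_n).
have -> : [set: V] = \bigcup_i [set x | unit_cube (mul (- zi i) x)].
  apply/esym/seteqP; split=> // x _; have [z zint zx] := fundamental_domain x Grat.
  have [z' zE] := integer_pointP zint; exists (pickle z') => //.
  by rewrite /zi /= pickleK /= -zE.
apply: hausdorff_measure_bigcup0 => // i delta delta0.
apply/eqP; rewrite eq_le hausdorff_premeasure_ge0 andbT.
apply/lee_addgt0Pr => eps e0; rewrite add0e.
pose D := C * (K + 1); have D0 : 0 < D by rewrite mulr_gt0// addr_gt0.
pose E := (2 * K + 1) ^+ n * D `^ s.
have E0 : 0 < E by rewrite mulr_gt0 ?powR_gt0// exprn_gt0// addr_gt0// mulr_gt0.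
have sQ : 0 < s - (hdim G)%:R by rewrite subr_gt0.
(* The second summand ensures D / M <= delta, the third E M^(Q - s) <= eps. *)
pose M := 1 + D / delta + (E / eps) `^ (s - (hdim G)%:R)^-1.
have M1 : 1 <= M by rewrite /M -addrA lerDl addr_ge0 ?powR_ge0 ?divr_ge0 ?(ltW D0) ?(ltW delta0).
have M0 : 0 < M by apply: lt_le_trans M1.
have MD : D / M <= delta.
  by rewrite ler_pdivrMr// -ler_pdivrMl// mulrC /M addrAC lerDr addr_ge0 ?powR_ge0.
have ME : E / eps <= M `^ (s - (hdim G)%:R).
  have sQn : s - (hdim G)%:R != 0 by rewrite gt_eqF.
  have -> : E / eps = ((E / eps) `^ (s - (hdim G)%:R)^-1) `^ (s - (hdim G)%:R).
    by rewrite -powRrM mulVf// powRr1// divr_ge0 ?(ltW E0) ?(ltW e0).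
  apply: ge0_ler_powR.
  - exact: ltW.
  - by rewrite nnegrE powR_ge0.
  - by rewrite nnegrE ltW.
  - by rewrite /M lerDr addr_ge0// divr_ge0 ?(ltW D0) ?(ltW delta0).
have [r [_ szr rP]] := intbox_real G (ltW K0) M1.
pose U (p : 'rV[int]_n) := [set x | unit_cube (mul (- iv p) (dil M (mul (- zi i) x)))].
apply: (@le_trans _ _ ((size r)%:R * (D / M) `^ s)%:E).
  apply: (@hausdorff_premeasure_seq _ _ d _ 0 r U) => //.
  - by rewrite MD divr_ge0// ltW.
  - move=> x /= ux; have [p pint px] := fundamental_domain (dil M (mul (- zi i) x)) Grat.
    have [p' pE] := integer_pointP pint; exists p'; last by rewrite /U /= -pE.
    apply/rP; rewrite -pE.
    have -> : p = mul (dil M (mul (- zi i) x)) (- mul (- p) (dil M (mul (- zi i) x))).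
      by rewrite -mul_inv opprK mulA mulxV mul0.
    apply: HK => //; last exact/cboxN/unit_cube_cbox.
    move=> j; rewrite dilE normrM (ger0_norm (exprn_ge0 _ (ltW M0))) mulrC.
    by rewrite ler_wpM2r ?exprn_ge0 ?(ltW M0)//; have := unit_cube_cbox (lexx 1) ux j; rewrite expr1n mulr1.
  - move=> p _; apply: diameter_tile => // a b ha hb; exact: HK.
rewrite lee_fin powRM ?invr_ge0 ?(ltW D0) ?(ltW M0)//.
apply: (@le_trans _ _ (((2 * K + 1) ^+ n * M ^+ hdim G) * (D `^ s * M^-1 `^ s))).
  by rewrite ler_wpM2r// mulr_ge0// powR_ge0.
rewrite mulrACA -/E -powR_inv1 ?(ltW M0)// -powRrM mulN1r -powR_mulrn ?(ltW M0)//.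
rewrite powRN -[X in E * X]invf_div -powRB ?(gt_eqF M0) ?implybT//.
by rewrite ler_pdivrMr ?powR_gt0// mulrC -ler_pdivrMr.
Qed.

Lemma carnot_hausdorff_dimE : rational_carnot G -> carnot_hausdorff_dim ip = (hdim G)%:R.
Proof.
move=> Grat; rewrite /carnot_hausdorff_dim; suff -> :
  hausdorff_dimension d [set: V] = (hdim G)%:R%:E by [].
apply/eqP; rewrite eq_le; apply/andP; split.
  apply/lee_addgt0Pr => e e0; apply: ereal_inf_lbound; exists ((hdim G)%:R + e) => //.
  split; first by rewrite ltr_wpDl.
  by apply: hausdorff_upper; rewrite // ltrDl.
apply: le_ereal_inf_tmp => _ [s [s0 Hs] <-].
by rewrite lee_fin; exact: hausdorff_lower Hs.
Qed.

Lemma critical_exponentE : rational_carnot G ->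
  critical_exponent ip = ((hdim G)%:R + 1) / (hdim G)%:R.
Proof. by move=> Grat; rewrite /critical_exponent carnot_hausdorff_dimE. Qed.
End HausdorffUpperBound.

(** * The convergence half *)

(** Cauchy condensation: the block from 2^k to 2^(k+1) sums to at most r^k with r = 2^(1 - a) <
    1. *)
Lemma pseries_bounded {R : realType} (a : R) : 1 < a ->
  exists S : R, forall m, \sum_(0 <= i < m) i.+1%:R `^ (- a) <= S.
Proof.
move=> a1; pose r : R := 2 `^ (1 - a).
have r0 : 0 < r by rewrite powR_gt0.
have r1 : r < 1.
  rewrite /r -[1 - a]opprB powRN invf_lt1 ?powR_gt0//.
  have : 1 `^ (a - 1) < 2 `^ (a - 1) :> R.
    by apply: gt0_ltr_powR; rewrite ?nnegrE ?subr_gt0 ?ltr1n.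
  by rewrite powR1.
have block k : \sum_(1 <= q < 2 ^ k) q%:R `^ (- a) <= \sum_(0 <= j < k) r ^+ j.
  elim: k => [|k IH]; first by rewrite expn0 !big_geq.
  rewrite (@big_cat_nat _ _ _ (2 ^ k))/= ?expn_gt0 ?leq_exp2l// big_nat_recr//=.
  apply: lerD => //.
  apply: (@le_trans _ _ (\sum_(2 ^ k <= q < 2 ^ k.+1) (2 ^ k)%:R `^ (- a))).
    rewrite big_nat_cond [leRHS]big_nat_cond; apply: ler_sum => q /andP[/andP[kq _] _].
    have k0 : (0 < 2 ^ k)%N by rewrite expn_gt0.
    rewrite !powRN lef_pV2 ?posrE ?powR_gt0 ?ltr0n ?(leq_trans k0)//.
    by apply: ge0_ler_powR; rewrite ?nnegrE ?ler0n ?ler_nat//; lra.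
  rewrite sumr_const_nat expnS mul2n -addnn addnK -[_ *+ _]mulr_natl natrX.
  have e2 : 2 ^+ k = 2 `^ k%:R :> R by rewrite powR_mulrn.
  rewrite e2 -powRrM -powRD ?pnatr_eq0 ?implybT//.
  rewrite -(@powR_mulrn _ r) ?(ltW r0)// -powRrM.
  by have -> : k%:R + k%:R * - a = (1 - a) * k%:R by ring.
exists (1 - r)^-1 => m.
have -> : \sum_(0 <= i < m) i.+1%:R `^ (- a) = \sum_(1 <= q < m.+1) q%:R `^ (- a) :> R.
  by rewrite big_add1.
apply: (@le_trans _ _ (\sum_(1 <= q < 2 ^ m.+1) q%:R `^ (- a))).
  have mm : (m.+1 <= 2 ^ m.+1)%N by apply: ltnW; exact: ltn_expl.
  rewrite [leRHS](@big_cat_nat _ _ _ m.+1)//= lerDl.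
  by apply: sumr_ge0 => *; exact: powR_ge0.
apply: le_trans (block _) _.
rewrite -[leRHS]mul1r ler_pdivlMr ?subr_gt0// big_mkord mulrC.
have := subrX1 r m.+1; rewrite -opprB -[r - 1]opprB mulNr => /oppr_inj <-.
by rewrite lerBlDr lerDl exprn_ge0// ltW.
Qed.

Section ConvergenceHalf.
Context {R : realType} (G : carnotGroup R).
Local Notation n := (carnot_dim G).
Local Notation w := (@carnot_weight _ G).
Local Notation corr := (@carnot_corr _ G).
Local Notation V := 'rV[R]_n.
Local Notation mul := (group_mul corr).
Local Notation dil r := (carnot_dilation (G := G) r).
Implicit Types (x y z u v a b : V) (j k l : 'I_n).
Local Opaque frame dframe ev lie_bracket.

Context (ip : {dot (subvs_of (horizontal_space G)) for idfun}).
Local Notation d := (carnot_dist ip).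

(** As alpha >= 0 the radius is at most 1, so p/q stays in a bounded box and only O(q^Q) points p
    matter; the second bound replaces the metric ball by a box. *)
Lemma approximant_bounded (b : R) : exists K C : R, [/\ 0 < K, 0 < C &
  forall alpha (q : nat) x p, 0 <= alpha -> (0 < q)%N -> cbox b 1 x ->
    (d x (dil q%:R^-1 p) < (q%:R `^ (- alpha))%:E)%E ->
    cbox K q%:R p /\ cbox C (q%:R `^ (- alpha)) (mul (- dil q%:R^-1 p) x)].
Proof.
have [C C0 HC] := dist_cbox ip.
have [K K0 HK] := mul_hbounded G (Num.max b C).
exists K, C; split=> // alpha q x p alpha0 q0 bx dxp.
have qR : 0 < q%:R :> R by rewrite ltr0n.
have D0 : 0 <= q%:R `^ (- alpha) :> R by exact: powR_ge0.
have h := HC _ _ _ D0 (ltW dxp).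
have D1 : q%:R `^ (- alpha) <= 1 :> R.
  rewrite powRN invf_le1 ?powR_gt0//.
  have : q%:R `^ 0 <= q%:R `^ alpha :> R by apply: ler_powR; rewrite ?ler1n.
  by rewrite powRr0.
split=> [j|]; last first.
  by rewrite -[mul _ _]opprK -mul_inv opprK; exact: cboxN.
have : `|dil q%:R^-1 p 0 j| <= K * 1 ^+ w j.
  rewrite -(mulVKx x (dil q%:R^-1 p)); apply: HK => // l.
    by rewrite (le_trans (bx l))// ler_wpM2r ?exprn_ge0// le_max lexx.
  rewrite (le_trans (h l))// ler_pM ?exprn_ge0 ?(ltW C0)//.
    by rewrite le_max lexx orbT.
  by rewrite expr1n exprn_ile1.
rewrite dilE normrM expr1n mulr1 exprVn ger0_norm ?invr_ge0 ?exprn_ge0 ?(ltW qR)//.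
by rewrite mulrC ler_pdivrMr// exprn_gt0.
Qed.

Lemma vol_bigcup_seq_le (I : choiceType) (r : seq I) (A : I -> set V) (c : R) :
  (forall i, mset (A i) /\ (vol (A i) <= c%:E)%E) ->
  mset (\bigcup_(i in [set` r]) A i) /\
  (vol (\bigcup_(i in [set` r]) A i) <= ((size r)%:R * c)%:E)%E.
Proof.
move=> HA; rewrite /mset /vol preimage_bigcup bigcup_seq.
elim: r => [|i r [IH1 IH2]]; first by rewrite big_nil mul0r measure0.
have [mA vA] := HA i; rewrite big_cons; split; first exact: measurableU.
by rewrite (le_trans (measureU2 _ _ _))//= -nat1r mulrDl mul1r EFinD leeD.
Qed.

Lemma vol_bigcup_seq (I : choiceType) (r : seq I) (A : I -> set V) (c : R) :
  (forall i, mset (A i) /\ vol (A i) = c%:E) ->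
  mset (\bigcup_(i in [set` r]) A i) /\
  (vol (\bigcup_(i in [set` r]) A i) <= ((size r)%:R * c)%:E)%E.
Proof. by move=> HA; apply: vol_bigcup_seq_le => i; have [? ->] := HA i. Qed.

Lemma vol_bigcup_disjoint (I : choiceType) (r : seq I) (A : I -> set V) (c : R) :
  (forall i, mset (A i) /\ vol (A i) = c%:E) -> uniq r ->
  (forall i i' x, A i x -> A i' x -> i = i') ->
  vol (\bigcup_(i in [set` r]) A i) = ((size r)%:R * c)%:E.
Proof.
move=> HA ur disj; rewrite /vol preimage_bigcup bigcup_seq.
elim: r ur => [|i r IH]; first by rewrite big_nil measure0 mul0r.
rewrite big_cons /= => /andP[ir ur]; have [mi vi] := HA i.
rewrite measureU//.
- by rewrite [X in (X + _)%E](vi) [X in (_ + X)%E](IH ur) -EFinD -[(size r).+1]add1n natrD mulrDl mul1r.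
- by apply: bigsetU_measurable => i' _; have [] := HA i'.
apply/seteqP; split=> // t [/= h1]; rewrite -bigcup_seq => -[i' /= i'r h2].
by move: ir; rewrite (disj _ _ _ h1 h2) i'r.
Qed.

Lemma convergence_half alpha : rational_carnot G -> critical_exponent ip < alpha ->
  (lebesgue_tuple R n).-negligible
     [set t | infinite_set (approximations ip alpha (point_of_tuple t))].
Proof.
move=> Grat; rewrite critical_exponentE// => halpha.
have Q0 : 0 < (hdim G)%:R :> R by rewrite ltr0n hdim_gt0.
have alpha0 : 0 <= alpha.
  by rewrite ltW// (le_lt_trans _ halpha)// divr_ge0 ?addr_ge0 ?(ltW Q0).
(* For each q there are O(q^Q) boxes of volume O(q^(-alpha Q)), in total O(q^(-a)); the hypothesis
   on alpha says exactly that a > 1. *)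
pose a := alpha * (hdim G)%:R - (hdim G)%:R.
have a1 : 1 < a.
  by move: halpha; rewrite ltr_pdivrMr// /a; lra.
suff H (b : nat) : (lebesgue_tuple R n).-negligible
     [set t | cbox b%:R 1 (point_of_tuple t) /\
       infinite_set (approximations ip alpha (point_of_tuple t))].
  apply: negligibleS (negligible_bigcup H) => t it.
  pose x := point_of_tuple t.
  exists (Num.truncn (\sum_j `|x 0 j|)).+1 => //; split => // j; rewrite expr1n mulr1.
  apply: le_trans (ltW (truncnS_gt _)).
  by rewrite (bigD1 j)//= lerDl sumr_ge0.
have [K [C [K0 C0 HKC]]] := approximant_bounded b%:R.
have q1 (i : nat) : 1 <= i.+1%:R :> R by rewrite ler1n.
have [s sP] : {s : nat -> seq 'rV[int]_n & forall i,
    (size (s i))%:R <= (2 * K + 1) ^+ n * i.+1%:R ^+ hdim G /\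
    forall p : 'rV[int]_n, p \in s i <-> cbox K i.+1%:R (iv p)}.
  apply: (@choice _ _ (fun i (s : seq 'rV[int]_n) =>
    (size s)%:R <= (2 * K + 1) ^+ n * i.+1%:R ^+ hdim G /\
    forall p : 'rV[int]_n, p \in s <-> cbox K i.+1%:R (iv p))) => i.
  by have [s [_ s1 s2]] := intbox_real G (ltW K0) (q1 i); exists s.
pose D (i : nat) : R := i.+1%:R `^ (- alpha).
pose F (i : nat) : set V := \bigcup_(p in [set` s i])
  [set x | cbox C (D i) (mul (- dil i.+1%:R^-1 (iv p)) x)].
have D0 i : 0 <= D i by exact: powR_ge0.
have [mF vF] : (forall i, mset (F i)) /\
    forall i, (vol (F i) <= ((size (s i))%:R * ((2 * C) ^+ n * D i ^+ hdim G))%:E)%E.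
  by split=> i; have [] := vol_bigcup_seq (s i)
    (fun p => vol_cbox (- dil i.+1%:R^-1 (iv p)) (ltW C0) (D0 i)).
pose c := (2 * K + 1) ^+ n * (2 * C) ^+ n.
have c0 : 0 <= c by rewrite mulr_ge0// exprn_ge0// ?addr_ge0// mulr_ge0// ltW.
have vF' i : (vol (F i) <= (c * i.+1%:R `^ (- a))%:E)%E.
  apply: le_trans (vF i) _; rewrite lee_fin; have [+ _] := sP i => sz.
  apply: (@le_trans _ _ (((2 * K + 1) ^+ n * i.+1%:R ^+ hdim G) *
      ((2 * C) ^+ n * D i ^+ hdim G))).
    by rewrite ler_wpM2r// mulr_ge0// exprn_ge0// mulr_ge0// ltW.
  rewrite mulrACA -/c ler_wpM2l// -!powR_mulrn// /D -powRrM -powRD ?pnatr_eq0 ?implybT//.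
  by have -> : (hdim G)%:R + - alpha * (hdim G)%:R = - a by rewrite /a; ring.
have lim0 : lebesgue_tuple R n (lim_sup_set (fun i => point_of_tuple (G := G) @^-1` F i)) = 0%E.
  apply: lim_sup_set_cvg0 => //.
  have [S HS] := pseries_bounded a1.
  apply: (@le_lt_trans _ _ (c * S)%:E); last exact: ltry.
  apply: lime_le; first by apply: is_cvg_nneseries => *; exact: measure_ge0.
  apply: nearW => m.
  apply: (@le_trans _ _ (\sum_(0 <= i < m) (c * i.+1%:R `^ (- a))%:E)%E).
    by apply: lee_sum => i _; exact: vF'.
  by rewrite sumEFin lee_fin -mulr_sumr ler_wpM2l.
have mL : measurable (lim_sup_set (fun i => point_of_tuple (G := G) @^-1` F i)).
  by apply: bigcap_measurable => // m _; apply: bigcup_measurable => i _; exact: mF.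
apply: (@negligibleS _ _ _ _ _ _ _ (proj2 (negligibleP _ mL) lim0)) => t [bt it] N _.
apply: contrapT => nF; apply: it.
(* The denominator q has the index q - 1. If t lies in no F i with i >= N, then all solutions have q
   <= N and belong to this finite list. *)
pose L := [seq (iv p, q) | q <- iota 1 N, p <- s q.-1].
apply: (@sub_finite_set _ _ [set` L]); last exact: finite_seq.
move=> [x q] [/= xi q0 dx]; have [xK xC] := HKC _ _ _ _ alpha0 q0 bt dx.
have [p pE] := integer_pointP xi; rewrite pE in xK xC *.
case: q q0 dx xK xC => // q _ _ xK xC.
have ps : p \in s q by have [_ h] := sP q; apply/h.
apply/allpairsPdep; exists q.+1, p; split => //=.
rewrite mem_iota add1n ltnS /=; case: ltnP => // Nq.
by exfalso; apply: nF; exists q => //; exists p.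
Qed.
End ConvergenceHalf.

(** * The divergence half *)

Lemma sum_dvdn p X : (0 < p)%N -> (\sum_(1 <= m < X.+1) (p %| m) = X %/ p)%N.
Proof.
move=> p0; elim: X => [|X IH]; first by rewrite big_geq// div0n.
by rewrite big_nat_recr//= IH divnS// addnC.
Qed.

Definition smooth (k m : nat) : bool := all (fun p => p < k)%N (primes m).

(** A number below 2^J all of whose prime factors are below k is determined by k exponents, each
    less than J. *)
Lemma sum_smooth_le (k J : nat) : (0 < J)%N ->
  (\sum_(1 <= m < 2 ^ J) smooth k m <= J ^ k)%N.
Proof.
move=> J0; pose s := [seq m <- index_iota 1 (2 ^ J) | smooth k m].
have -> : (\sum_(1 <= m < 2 ^ J) smooth k m = size s)%N.
  by rewrite size_filter -sum1_count [RHS]big_mkcond/=; apply: eq_bigr => m _; case: smooth.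
pose f m : {ffun 'I_k -> 'I_J} := [ffun p : 'I_k => insubd (Ordinal J0) (logn p m)].
have sP m : m \in s -> [/\ (0 < m)%N, (m < 2 ^ J)%N & smooth k m].
  by rewrite mem_filter mem_index_iota => /andP[-> /andP[-> ->]].
have fE m (p : 'I_k) : m \in s -> f m p = logn p m :> nat.
  move=> /sP[m0 mJ _]; rewrite ffunE val_insubd ifT//.
  have [pp|/negbTE np] := boolP (prime p); last by rewrite lognE np.
  rewrite -(ltn_exp2l _ _ (isT : 1 < 2)%N) (leq_ltn_trans _ mJ)//.
  apply: leq_trans (dvdn_leq m0 (pfactor_dvdnn p m)).
  by have [->//|l0] := posnP (logn p m); rewrite leq_exp2r ?prime_gt1.
have f_inj : {in s &, injective f}.
  move=> m m' ms ms' /ffunP fmm; have [m0 _ sm] := sP m ms; have [m0' _ sm'] := sP m' ms'.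
  apply: eqn_from_log => // p; have [pk|kp] := ltnP p k.
    by rewrite -(fE m (Ordinal pk))// fmm fE.
  have big l : smooth k l -> logn p l = 0%N.
    move=> /allP sl; apply/eqP; rewrite -leqn0 leqNgt logn_gt0; apply/negP => /sl.
    by rewrite ltnNge kp.
  by rewrite !big.
have fu : uniq (map f s) by rewrite map_inj_in_uniq// filter_uniq// iota_uniq.
rewrite -(size_map f) -(card_uniqP fu) (leq_trans (max_card _))//.
by rewrite card_ffun !card_ord.
Qed.

Lemma exp_beats_poly k : exists2 J, (0 < J)%N & (4 * J ^ k <= 2 ^ J)%N.
Proof.
have le2 j : (2 * j <= 2 ^ j)%N.
  by case: j => // j; rewrite expnS leq_mul2l/= ltn_expl.
(* With J a power of 2 the claim compares exponents: 2 + 2k(k + 2) <= 4^(k + 2). *)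
exists (2 ^ (2 * (k + 2)))%N; first by rewrite expn_gt0.
rewrite -(expnM 2 _ k) -(expnD 2 2) leq_exp2l//.
rewrite (expnM 2 2) (_ : 2 ^ 2 = 2 * 2)%N// expnMn.
by have := le2 (k + 2)%N; nia.
Qed.

(** Erdos's argument: if the tail were always below 1/2, at most half of the numbers up to X = 2^J -
    1 would have a prime factor >= k, while the others are smooth and number at most a quarter of
    2^J. *)
Lemma prime_tail_half (R : realFieldType) (k : nat) : exists N,
  2^-1 <= \sum_(k <= p < N | prime p) p%:R^-1 :> R.
Proof.
apply: contrapT => noN.
have H N : \sum_(k <= p < N | prime p) p%:R^-1 < 2^-1 :> R.
  by rewrite ltNge; apply/negP => h; apply: noN; exists N.
have [J J0 hJ] := exp_beats_poly k.
pose X := (2 ^ J).-1; have X1 : X.+1 = (2 ^ J)%N by rewrite prednK// expn_gt0.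
have : (X <= J ^ k + \sum_(k <= p < X.+1 | prime p) X %/ p)%N.
  have -> : (\sum_(k <= p < X.+1 | prime p) X %/ p =
      \sum_(1 <= m < X.+1) \sum_(k <= p < X.+1 | prime p) (p %| m))%N.
    by rewrite exchange_big/=; apply: eq_bigr => p /prime_gt0 p0; rewrite sum_dvdn.
  rewrite (leq_trans _ (leq_add (sum_smooth_le k J0) (leqnn _)))// -X1 -big_split/=.
  rewrite -[leqLHS](_ : \sum_(1 <= m < X.+1) 1 = X)%N; last by rewrite sum_nat_const_nat muln1 subn1.
  rewrite big_nat_cond [leqRHS]big_nat_cond; apply: leq_sum => m; rewrite andbT => /andP[m0 mX].
  case: (boolP (smooth k m)) => //= /allPn[p]; rewrite mem_primes -leqNgt => /and3P[pp _ pm] kp.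
  have pX : p \in index_iota k X.+1.
    by rewrite mem_index_iota kp (leq_ltn_trans (dvdn_leq m0 pm)).
  by rewrite add0n big_mkcond (bigD1_seq p)/= ?iota_uniq// pp pm.
rewrite -(ler_nat R) natrD natr_sum => h.
have h2 : \sum_(k <= p < X.+1 | prime p) (X %/ p)%:R <= X%:R * 2^-1 :> R.
  apply: le_trans (ler_wpM2l (ler0n _ _) (ltW (H X.+1))).
  rewrite mulr_sumr; apply: ler_sum => p /prime_gt0 p0.
  by rewrite ler_pdivlMr ?ltr0n// -natrM ler_nat leq_trunc_div.
have h3 : 4 * (J ^ k)%:R <= X%:R + 1 :> R by rewrite -natrM natr1 X1 ler_nat.
have h4 : 4 <= X%:R + 1 :> R.
  by rewrite natr1 X1 ler_nat (leq_trans _ hJ)// leq_pmulr// expn_gt0 J0.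
move: h h2 h3 h4; move: (\sum_(_ <= _ < _ | _) _) (X%:R) ((J ^ k)%:R) => a b c; lra.
Qed.

Lemma prime_harmonic_unbounded (R : archiRealFieldType) (k : nat) (S : R) : exists N,
  S <= \sum_(k <= p < N | prime p) p%:R^-1.
Proof.
suff H (m : nat) : exists N, m%:R / 2 <= \sum_(k <= p < N | prime p) p%:R^-1 :> R.
  have [N HN] := H (Num.truncn (S * 2)).+1; exists N; apply: le_trans HN.
  by rewrite ler_pdivlMr// ltW// truncnS_gt.
elim: m => [|m [N HN]]; first by exists 0%N; rewrite mul0r big_geq.
have [N' HN'] := prime_tail_half R (maxn k N).
exists (maxn (maxn k N) N'); rewrite -natr1 mulrDl mul1r.
rewrite (@big_cat_nat _ _ _ (maxn k N))/= ?leq_maxl ?(leq_trans (leq_maxl k N))//.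
apply: lerD.
  apply: le_trans HN _; case: (leqP N k) => [Nk|kN].
    by rewrite !big_geq.
  exact: lexx.
case: (leqP N' (maxn k N)) => [N1|//].
by move: HN'; rewrite !big_geq.
Qed.

(** The overlaps stand on the right to avoid subtracting extended reals. The induction step is
    inclusion-exclusion for the new set and the union so far, with Boole's inequality for their
    intersection. *)
Lemma bonferroni d (T : measurableType d) (R : realType) (mu : {measure set T -> \bar R})
  (F : (set T)^nat) (m : nat) : (forall i, measurable (F i)) ->
  (\sum_(i < m) mu (F i) <= mu (\big[setU/set0]_(i < m) F i) +
     \sum_(i < m) \sum_(j < i) mu (F i `&` F j))%E.
Proof.
move=> mF; elim: m => [|m IH]; first by rewrite !big_ord0 measure0 adde0.
rewrite !big_ord_recr /=; set U := \big[setU/set0]_(i < m) F i.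
have mU : measurable U by apply: bigsetU_measurable.
have E : (mu U + mu (F m) = mu (U `|` F m) + mu (F m `&` U))%E.
  have -> : U `|` F m = U `|` (F m `\` U) by apply/seteqP; split=> x; rewrite /= ; have [] := pselect (U x); tauto.
  rewrite measureU//; last 2 first.
  - exact: measurableD.
  - by rewrite setDIK.
  by rewrite -addeA addeC [in LHS](measureDI mu (mF m) mU) addeC.
have O : (mu (F m `&` U) <= \sum_(j < m) mu (F m `&` F j))%E.
  rewrite /U big_distrr/=; apply: (@Boole_inequality _ _ _ mu (fun j => F m `&` F j) m).
  by move=> j _; exact: measurableI.
apply: (le_trans (leeD2r _ IH)); rewrite addeAC E -addeA leeD2l// addeC leeD2l//.
Qed.

(** * Lipschitz bounds and intersecting boxes *)

Section LocalEstimates.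
Context {R : realType} (G : carnotGroup R).
Local Notation n := (carnot_dim G).
Local Notation w := (@carnot_weight _ G).
Local Notation corr := (@carnot_corr _ G).
Local Notation V := 'rV[R]_n.
Local Notation mul := (group_mul corr).
Local Notation dil r := (carnot_dilation (G := G) r).
Implicit Types (x y z u v a b : V) (j k l : 'I_n).
Local Opaque frame dframe ev lie_bracket.

(** Functions that are bounded by K and K-Lipschitz on the box, for one common K, are closed under
    sums and products, so polynomials follow by induction. *)
Lemma meval_lipschitz N (p : mpoly.mpoly N R) (C : R) : exists2 K : R, 0 <= K &
  forall (f g : 'I_N -> R) (t : R), 0 <= t -> (forall i, `|f i| <= C) ->
    (forall i, `|g i| <= C) -> (forall i, `|f i - g i| <= t) ->
    `|mpoly.meval f p - mpoly.meval g p| <= K * t.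
Proof.
pose good (F : ('I_N -> R) -> R) := exists2 K : R, 0 <= K &
  forall (f g : 'I_N -> R) (t : R), 0 <= t -> (forall i, `|f i| <= C) ->
    (forall i, `|g i| <= C) -> (forall i, `|f i - g i| <= t) ->
    `|F f| <= K /\ `|F f - F g| <= K * t.
have good_cst c : good (fun=> c).
  exists `|c| => // f g t t0 _ _ _; rewrite subrr normr0 lexx; split => //.
  exact: mulr_ge0.
have goodD F1 F2 : good F1 -> good F2 -> good (fun f => F1 f + F2 f).
  move=> [K1 K10 H1] [K2 K20 H2]; exists (K1 + K2) => [|f g t t0 fC gC fg]; first exact: addr_ge0.
  have [a1 b1] := H1 f g t t0 fC gC fg; have [a2 b2] := H2 f g t t0 fC gC fg.
  rewrite (le_trans (ler_normD _ _)) ?lerD// mulrDl; split => //.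
  rewrite [X in `|X|](_ : _ = (F1 f - F1 g) + (F2 f - F2 g)); last by ring.
  by rewrite (le_trans (ler_normD _ _)) ?lerD.
have goodM F1 F2 : good F1 -> good F2 -> good (fun f => F1 f * F2 f).
  move=> [K1 K10 H1] [K2 K20 H2]; exists (K1 * K2 * 2) => [|f g t t0 fC gC fg].
    by rewrite !mulr_ge0.
  have [a1 b1] := H1 f g t t0 fC gC fg; have [a2 b2] := H2 f g t t0 fC gC fg.
  have gf i : `|g i - f i| <= t by rewrite distrC.
  have [a3 _] := H2 g f t t0 gC fC gf.
  have KK : 0 <= K1 * K2 by exact: mulr_ge0.
  rewrite normrM; split.
    by rewrite (le_trans (ler_pM _ _ a1 a2))// mulr_natr mulr2n lerDl.
  rewrite [X in `|X|](_ : _ = F1 f * (F2 f - F2 g) + (F1 f - F1 g) * F2 g); last by ring.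
  rewrite (le_trans (ler_normD _ _))// !normrM [leRHS](_ : _ = K1 * (K2 * t) + (K1 * t) * K2); last by ring.
  by rewrite lerD// ler_pM.
have goodX F (m : nat) : good F -> good (fun f => F f ^+ m).
  move=> gF; elim: m => [|m IH].
    by rewrite (_ : (fun=> _) = fun=> 1)//; apply/funext => f; rewrite expr0.
  rewrite (_ : (fun=> _) = fun f => F f * F f ^+ m); first exact: goodM.
  by apply/funext => f; rewrite exprS.
have [K K0 HK] : good (fun f => mpoly.meval f p).
  rewrite (_ : (fun=> _) = fun f => \sum_(m <- mpoly.msupp p)
      (mpoly.mcoeff m p * \prod_i f i ^+ mpoly.fun_of_multinom m i)); last first.
    by apply/funext => f; exact: mpoly.mevalE.
  elim: (mpoly.msupp p : seq _) => [|m r IH].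
    by rewrite (_ : (fun=> _) = fun=> 0)//; apply/funext => f; rewrite big_nil.
  rewrite (_ : (fun=> _) = fun f =>
    mpoly.mcoeff m p * (\prod_i f i ^+ mpoly.fun_of_multinom m i) +
    \sum_(m <- r) (mpoly.mcoeff m p * \prod_i f i ^+ mpoly.fun_of_multinom m i)); last first.
    by apply/funext => f; rewrite big_cons.
  apply: (goodD _ _) => //; apply: (goodM _ _) => //.
  elim: (index_enum _) => [|i s IHs].
    by rewrite (_ : (fun=> _) = fun=> 1)//; apply/funext => f; rewrite big_nil.
  rewrite (_ : (fun=> _) = fun f => f i ^+ mpoly.fun_of_multinom m i *
    \prod_(i <- s) f i ^+ mpoly.fun_of_multinom m i); last first.
    by apply/funext => f; rewrite big_cons.
  apply: (goodM _ _) => //; apply: (goodX _ _).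
  exists (`|C| + 1) => [|f g t t0 fC _ fg]; first by rewrite addr_ge0.
  split; first by rewrite (le_trans (fC i))// (le_trans (ler_norm _))// lerDl.
  by rewrite (le_trans (fg i))// ler_peMl// lerDr.
by exists K => // f g t t0 fC gC fg; have [] := HK f g t t0 fC gC fg.
Qed.

Lemma mul_lipschitz (b : R) : exists2 K : R, 0 <= K &
  forall t x a, 0 <= t <= 1 -> bnd b x -> bnd t a ->
    forall j, `|mul x a 0 j - x 0 j| <= K * t.
Proof.
pose C := `|b| + 1.
have HC j := meval_lipschitz (mul_poly j) C.
have [K HK] : {K : 'I_n -> R & forall j, 0 <= K j /\ forall (f g : 'I_(n + n) -> R) (t : R),
   0 <= t -> (forall i, `|f i| <= C) ->
    (forall i, `|g i| <= C) -> (forall i, `|f i - g i| <= t) ->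
    `|mpoly.meval f (mul_poly j) - mpoly.meval g (mul_poly j)| <= K j * t}.
  apply: (@choice _ _ (fun j (K : R) => 0 <= K /\ forall (f g : 'I_(n + n) -> R) (t : R),
   0 <= t -> (forall i, `|f i| <= C) ->
    (forall i, `|g i| <= C) -> (forall i, `|f i - g i| <= t) ->
    `|mpoly.meval f (mul_poly j) - mpoly.meval g (mul_poly j)| <= K * t)) => j.
  by have [K] := HC j; exists K.
have K0 j : 0 <= K j by have [] := HK j.
exists (\sum_j K j) => [|t x a /andP[t0 t1] bx ba j]; first by rewrite sumr_ge0.
have {2}-> : x = mul x 0 by rewrite mulx0.
rewrite !group_mulE; have [_ H] := HK j.
apply: le_trans (H _ _ t t0 _ _ _) _; last first.
- by rewrite ler_wpM2r// (bigD1 j)//= lerDl sumr_ge0.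
- move=> i; rewrite /pair_val; case: (split_ordP i) => l ->; rewrite ?row_mxEl ?row_mxEr.
    by rewrite subrr normr0.
  by rewrite mxE subr0; exact: ba.
- move=> i; rewrite /pair_val; case: (split_ordP i) => l ->; rewrite ?row_mxEl ?row_mxEr.
    by rewrite (le_trans (bx l))// (le_trans (ler_norm _))// lerDl.
  by rewrite mxE normr0 addr_ge0.
- move=> i; rewrite /pair_val; case: (split_ordP i) => l ->; rewrite ?row_mxEl ?row_mxEr.
    by rewrite (le_trans (bx l))// (le_trans (ler_norm _))// lerDl.
  by rewrite (le_trans (ba l))// (le_trans t1)// lerDr.
Qed.

Lemma dil_dil r s x : dil r (dil s x) = dil (r * s) x.
Proof. by apply/rowP => j; rewrite !dilE mulrA exprMn. Qed.

(** Weight by weight, an integer that is the difference of two numbers in [0, 1) is 0. *)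
Lemma fundamental_domain_uniq z x : integer_point z ->
  unit_cube x -> unit_cube (mul z x) -> z = 0.
Proof.
move=> zi ux uzx; suff H m j : (w j <= m)%N -> z 0 j = 0.
  apply/rowP => j; rewrite [RHS]mxE; apply: (H (carnot_step G)).
  by have /andP[] := @carnot_weightP _ G j.
elim: m j => [|m IH] j; first by have := weight_gt0 j; lia.
move=> jm; have tz : tail m.+1 z by move=> l lm; apply: IH.
have := uzx j; rewrite (mul_taill _ tz)//; have := ux j.
have /intrP[a ->] := zi j.
move=> /andP[x0 x1] /andP[zx0 zx1].
have a1 : a%:~R < 1%:~R :> R by rewrite [X in _ < X](_ : _ = 1)//; lra.
have a2 : (-1)%:~R < a%:~R :> R by rewrite [X in X < _](_ : _ = -1)//; lra.
by move: a1 a2; rewrite !ltr_int => a1 a2; have -> : a = 0 by lia.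
Qed.

(** Multiplying the quotient of x by p/q with the inverse of its quotient by p'/q' cancels x and
    leaves the quotient of the two centres; dilation by q q' clears the denominators. *)
Lemma overlap_diff : exists2 K : R, 1 <= K & forall (q q' : nat) (t t' : R) p p' x,
  (0 < q)%N -> (0 < q')%N -> 0 < t' -> t <= t' -> 0 <= t ->
  cbox 1 t (mul (- dil q%:R^-1 p) x) -> cbox 1 t' (mul (- dil q'%:R^-1 p') x) ->
  cbox K (q%:R * q'%:R * t') (mul (- dil q'%:R p) (dil q%:R p')).
Proof.
have [K K0 HK] := mul_hbounded G 1.
exists (K + 1) => [|q q' t t' p p' x q0 q'0 t'0 tt' t0 h h']; first by rewrite lerDr ltW.
have qR : q%:R != 0 :> R by rewrite pnatr_eq0 -lt0n.
have q'R : q'%:R != 0 :> R by rewrite pnatr_eq0 -lt0n.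
have qq : q%:R * q'%:R != 0 :> R by rewrite mulf_neq0.
have -> : mul (- dil q'%:R p) (dil q%:R p') =
    dil (q%:R * q'%:R) (mul (mul (- dil q%:R^-1 p) x) (- mul (- dil q'%:R^-1 p') x)).
  rewrite -mul_inv opprK -mulA mulVKx -mul_dil// dilN !dil_dil.
  by rewrite mulrAC mulfV// mul1r mulfK.
move=> j; rewrite dilE normrM ger0_norm ?exprn_ge0 ?mulr_ge0//.
rewrite [leRHS](_ : _ = (q%:R * q'%:R) ^+ w j * ((K + 1) * t' ^+ w j)); last first.
  by rewrite [in LHS]exprMn mulrCA.
rewrite ler_wpM2l ?exprn_ge0 ?mulr_ge0//.
apply: (@le_trans _ _ (K * t' ^+ w j)); last by rewrite ler_wpM2r ?exprn_ge0 ?(ltW t'0)// lerDl.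
apply: HK => // l; last exact: cboxN h' l.
by rewrite (le_trans (h l))// !mul1r lerXn2r ?nnegrE// ltW.
Qed.
End LocalEstimates.

(** * Quasi-independence for prime denominators *)

Section Overlaps.
Context {R : realType} (G : carnotGroup R).
Local Notation n := (carnot_dim G).
Local Notation w := (@carnot_weight _ G).
Local Notation corr := (@carnot_corr _ G).
Local Notation V := 'rV[R]_n.
Local Notation mul := (group_mul corr).
Local Notation dil r := (carnot_dilation (G := G) r).
Implicit Types (x y z u v a b : V) (j k l : 'I_n).
Local Opaque frame dframe ev lie_bracket.

Local Notation Q := (hdim G).

(** The critical radius: about q^Q boxes of this size have total volume of order c^Q / q. *)
Definition rad (c : R) (q : nat) : R := c * q%:R `^ (- (1 + Q%:R^-1)).

Lemma rad_gt0 c q : 0 < c -> (0 < q)%N -> 0 < rad c q.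
Proof. by move=> c0 q0; rewrite mulr_gt0// powR_gt0 ?ltr0n. Qed.

Lemma rad_exp c q : rad c q ^+ Q = c ^+ Q * q%:R ^- Q.+1.
Proof.
rewrite exprMn -(@powR_mulrn _ (q%:R `^ _)) ?powR_ge0// -powRrM -powR_invn//.
have Q0 : Q%:R != 0 :> R by rewrite pnatr_eq0 -lt0n hdim_gt0.
by rewrite mulNr mulrDl mul1r mulVf// -natr1.
Qed.

Lemma rad_le c q q' : 0 < c -> (0 < q')%N -> (q' <= q)%N -> rad c q <= rad c q'.
Proof.
move=> c0 q'0 qq; have q0 : (0 < q)%N by apply: leq_trans qq.
rewrite ler_wpM2l ?(ltW c0)// !powRN lef_pV2 ?posrE ?powR_gt0 ?ltr0n//.
by apply: ge0_ler_powR; rewrite ?nnegrE ?ler_nat// addr_ge0.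
Qed.

(** Boxes are used instead of metric balls, so that volumes are exact; the comparison constant is
    settled in [divergence_half]. *)
Definition rball c q (p : 'rV[int]_n) : set V :=
  [set x | cbox 1 (rad c q) (mul (- dil q%:R^-1 (iv p)) x)].

Lemma vol_rball c q p : 0 < c -> (0 < q)%N -> mset (rball c q p) /\
  vol (rball c q p) = (2 ^+ n * (c ^+ Q * q%:R ^- Q.+1))%:E.
Proof.
move=> c0 q0; have [m v] := vol_cbox (- dil q%:R^-1 (iv p)) (ler01 : 0 <= 1 :> R) (ltW (rad_gt0 c0 q0)).
by split => //; rewrite v mulr1 rad_exp.
Qed.

(** The range from a quarter to a half of q^(w j) serves three ends: coordinates congruent modulo
    q^(w j) are equal, a coordinate of weight 1 is not divisible by q, and the dilated point stays
    well inside the unit cube. The 8 comes from floor(m/4) >= m/8 for m >= 4. *)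
Lemma box_points (q : nat) : exists s : seq 'rV[int]_n, [/\ uniq s,
  (4 <= q)%N -> q%:R ^+ Q / 8 ^+ n <= (size s)%:R :> R &
  forall p : 'rV[int]_n, p \in s -> forall j,
    ((q ^ w j)%N%:Z < 4 * p 0 j) && (2 * p 0 j <= (q ^ w j)%N%:Z)].
Proof.
have [s [us sz sP]] := int_box (fun j => (q ^ w j %/ 4).+1%:Z) (fun j => q ^ w j %/ 4)%N.
exists s; split => // [q4|p /sP ps j]; last first.
  by have := ps j; move: (q ^ w j)%N (p 0 j) => m a; lia.
rewrite sz natr_prod -hdim_prod -[X in 8 ^+ X]card_ord -prodr_const -prodf_div.
apply: ler_prod => j _; rewrite divr_ge0 ?exprn_ge0//= ler_pdivrMr// -natrX -natrM ler_nat.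
have : (4 <= q ^ w j)%N.
  by rewrite (leq_trans q4)// -[leqLHS]expn1 leq_pexp2l ?weight_gt0//; lia.
by move: (q ^ w j)%N => m; lia.
Qed.

Definition pts q : seq 'rV[int]_n := projT1 (cid (box_points q)).

Lemma pts_uniq q : uniq (pts q).
Proof. by rewrite /pts; case: cid => s /= []. Qed.

Lemma size_pts q : (4 <= q)%N -> q%:R ^+ Q / 8 ^+ n <= (size (pts q))%:R :> R.
Proof. by rewrite /pts; case: cid => s /= []. Qed.

Lemma ptsP q (p : 'rV[int]_n) : p \in pts q -> forall j,
  ((q ^ w j)%N%:Z < 4 * p 0 j) && (2 * p 0 j <= (q ^ w j)%N%:Z).
Proof. by rewrite /pts; case: cid => s /= [_ _]; exact. Qed.

Context (Grat : rational_carnot G).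

(** For q = q' the quotient in [overlap_diff] is the dilation by q of an integer point, whose
    coordinates must then be below 1 in absolute value. *)
Lemma rball_disjoint (K c : R) q p p' x : 1 <= K -> 0 < c -> (0 < q)%N ->
  (forall (q q' : nat) (t t' : R) p p' x,
  (0 < q)%N -> (0 < q')%N -> 0 < t' -> t <= t' -> 0 <= t ->
  cbox 1 t (mul (- dil q%:R^-1 p) x) -> cbox 1 t' (mul (- dil q'%:R^-1 p') x) ->
  cbox K (q%:R * q'%:R * t') (mul (- dil q'%:R p) (dil q%:R p'))) ->
  K * (q%:R * rad c q) < 1 -> rball c q p x -> rball c q p' x -> p = p'.
Proof.
move=> K1 c0 q0 HK Kq h h'; have r0 := rad_gt0 c0 q0.
have qR : 0 < q%:R :> R by rewrite ltr0n.
have qr0 : 0 < q%:R * rad c q by rewrite mulr_gt0.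
have := HK _ _ _ _ _ _ _ q0 q0 r0 (lexx _) (ltW r0) h h'.
rewrite -dilN mul_dil ?gt_eqF// => H.
have zi : integer_point (mul (- iv p) (iv p')).
  by apply: integer_mul => //; [apply: integer_opp|]; exact: iv_integer.
have z0 : mul (- iv p) (iv p') = 0.
  apply/rowP => j; rewrite [RHS]mxE; have := H j.
  rewrite dilE normrM ger0_norm ?exprn_ge0 ?(ltW qR)// -[_ * _ * rad c q]mulrA exprMn mulrCA.
  rewrite ler_pM2l ?exprn_gt0//; have /intrP[a ->] := zi j => ha.
  have : `|a%:~R| < 1 :> R.
    apply: le_lt_trans ha _; apply: (le_lt_trans _ Kq); rewrite ler_wpM2l ?(le_trans ler01 K1)//.
    rewrite -[leRHS]expr1 ler_wiXn2l ?weight_gt0 ?(ltW qr0)//.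
    by rewrite ltW// (le_lt_trans _ Kq)// ler_peMl// ltW.
  by rewrite -intr_norm -[X in _ < X](_ : 1%:~R = 1)// ltr_int => a1; have -> : a = 0 by lia.
by apply: (@iv_inj _ G); rewrite -[RHS](mulVKx (iv p)) z0 mulx0.
Qed.

(** If the least weight were above 1, layer 1 would be 0, and so would the layer of least weight,
    which is spanned by brackets with layer 1. *)
Lemma weight1_exists : exists j, w j = 1%N.
Proof.
have [j _ jmin] := @arg_minnP _ (Ordinal (carnot_dim_gt0 G)) xpredT w isT.
exists j; apply/eqP; rewrite eqn_leq weight_gt0 andbT leqNgt; apply/negP => j1.
have jw : w j = (w j).-1.+1 by rewrite prednK// weight_gt0.
have wj : (1 <= (w j).-1 <= carnot_step G)%N.
  by have /andP[_] := @carnot_weightP _ G j; lia.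
have : (delta_mx 0 j : V) \in layer w (w j).-1.+1.
  by apply/layerP => l; apply: contraNeq; rewrite mxE eqxx/= pnatr_eq0 eqb0 negbK => /eqP ->; rewrite -jw.
have /seteqP[_ H] := carnot_stratified wj.
move=> /H /(_ 0%VS) H0; have : (delta_mx 0 j : V) \in 0%VS.
  apply: H0 => _ [[u v] [/= u1 _] <-]; suff -> : u = 0 by rewrite lie_bracket0l mem0v.
  apply/rowP => l; rewrite [RHS]mxE; move/layerP : u1; apply.
  by rewrite gtn_eqF// (leq_trans j1)//; exact: jmin.
rewrite memv0 => /eqP/rowP/(_ j); rewrite !mxE !eqxx => /eqP.
by rewrite oner_eq0.
Qed.

(** Modulo m the equation gives p = s, because m' is invertible and both lie in an interval of
    length less than m. *)
Lemma coprime_combination_inj (m m' : nat) (p p' s s' : int) : coprime m m' ->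
  (m%:Z < 4 * p) && (2 * p <= m%:Z) -> (m%:Z < 4 * s) && (2 * s <= m%:Z) ->
  - (m'%:Z * p) + m%:Z * p' = - (m'%:Z * s) + m%:Z * s' -> p = s /\ p' = s'.
Proof.
move=> co hp hs e.
have m0 : (0 < m)%N by lia.
have e' : m%:Z * (p' - s') = m'%:Z * (p - s) by rewrite !mulrBr; lia.
have ps : p = s.
  have : (m %| m' * absz (p - s)%R)%N.
    by have := congr1 absz e'; rewrite !abszM !absz_nat => <-; exact: dvdn_mulr.
  rewrite Gauss_dvdr// => /dvdn_leq; have [//|psn] := eqVneq p s.
  by rewrite absz_gt0 subr_eq0 psn => /(_ isT); lia.
split => //; move: e'; rewrite ps subrr mulr0 => /eqP.
by rewrite mulf_eq0 => /orP[/eqP|]; [lia|rewrite subr_eq0 => /eqP].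
Qed.

(** In weight 1 coordinates just add, so the value -q' p_j + q p'_j could vanish only if q divided
    p_j. *)
Lemma pts_diff_neq0 q q' p p' : prime q -> prime q' -> (q' < q)%N -> p \in pts q ->
  exists2 j, w j = 1%N & mul (- dil q'%:R (iv p)) (dil q%:R (iv p')) 0 j != 0.
Proof.
move=> pq pq' qq hp; have [j wj] := weight1_exists; exists j => //.
have t1 x : tail 1 x by move=> l l1; have := weight_gt0 l; lia.
rewrite (mul_taill _ (t1 _)) ?wj// [(- dil _ _) 0 j]mxE !dilE !ivE wj !expr1.
rewrite -[q'%:R]/(q'%:Z%:~R) -[q%:R]/(q%:Z%:~R) -!intrM addrC subr_eq0 eqr_int.
have := ptsP hp j; rewrite wj expn1 => hq; apply/negP => /eqP e.
have : (q %| q' * absz (p 0%R j))%N.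
  by have := congr1 absz e; rewrite !abszM !absz_nat => <-; exact: dvdn_mulr.
rewrite Gauss_dvdr; last by rewrite prime_coprime// dvdn_prime2// gtn_eqF.
by move=> /dvdn_leq; rewrite absz_gt0; move: (p 0 j) hq => a hq; lia.
Qed.

Lemma pts_diff_inj q q' p1 p1' p2 p2' : prime q -> prime q' -> (q' < q)%N ->
  p1 \in pts q -> p1' \in pts q' -> p2 \in pts q -> p2' \in pts q' ->
  mul (- dil q'%:R (iv p1)) (dil q%:R (iv p1')) =
  mul (- dil q'%:R (iv p2)) (dil q%:R (iv p2')) -> p1 = p2 /\ p1' = p2'.
Proof.
move=> pq pq' qq h1 h1' h2 h2' e.
suff H m j : (w j <= m)%N -> p1 0 j = p2 0 j /\ p1' 0 j = p2' 0 j.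
  have wm j : (w j <= carnot_step G)%N by have /andP[] := @carnot_weightP _ G j.
  by split; apply/rowP => j; have [] := H _ _ (wm j).
elim: m j => [|m IH] j jm; first by have := weight_gt0 j; lia.
have := congr1 (fun x : V => x 0 j) e; rewrite !mul_coord.
(* Both corrections involve only lighter coordinates, equal by induction; once they cancel, -q'^(w
   j) p + q^(w j) p' is left on each side. *)
rewrite (@corr_dep _ G j _ (- dil q'%:R (iv p2)) _ (dil q%:R (iv p2'))); first last.
- by move=> l lj; rewrite !dilE !ivE; have [_ ->] := IH l (leq_trans lj jm).
- move=> l lj; rewrite [LHS]mxE [RHS]mxE !dilE !ivE.
  by have [-> _] := IH l (leq_trans lj jm).
move=> /addIr; rewrite [X in X + _ = _]mxE [X in _ = X + _]mxE !dilE !ivE.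
rewrite -!natrX -!mulNr.
have E (l l' : nat) (s s' : int) : - l'%:R * s%:~R + l%:R * s'%:~R =
    (- (l'%:Z * s) + l%:Z * s')%:~R :> R.
  by rewrite intrD mulrNz !intrM mulNr.
rewrite !E => /intr_inj; apply: coprime_combination_inj; try exact: ptsP.
by rewrite coprimeXl// coprimeXr// prime_coprime// dvdn_prime2// gtn_eqF.
Qed.

Lemma vol_bigcup_le (T : choiceType) (r : seq T) (A : T -> set V) (v : R) (B : set V) :
  mset B -> (forall i, mset (A i) /\ vol (A i) = v%:E) ->
  B `<=` \bigcup_(i in [set` r]) A i -> (vol B <= ((size r)%:R * v)%:E)%E.
Proof.
move=> mB HA BA; have [mU vU] := vol_bigcup_seq r HA.
apply: le_trans vU; rewrite /vol le_measure ?inE//.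
by move=> t; apply: BA.
Qed.

Definition rballs c q : set V := \bigcup_(p in [set` pts q]) rball c q p.

Lemma rballs_overlap : exists2 C : R, 0 < C & forall c q q', 0 < c ->
  prime q -> prime q' -> (q' < q)%N ->
  mset (rballs c q) /\
  (vol (rballs c q `&` rballs c q') <= (C * (c ^+ Q / q%:R) * (c ^+ Q / q'%:R))%:E)%E.
Proof.
have [K K1 HK] := overlap_diff G.
have K0 : 0 < K by apply: lt_le_trans K1.
exists ((2 * K + 1) ^+ n * K ^+ Q * 2 ^+ n).
  by rewrite !mulr_gt0 ?exprn_gt0 ?addr_gt0 ?mulr_gt0.
move=> c q q' c0 pq pq' qq; have q0 := prime_gt0 pq; have q'0 := prime_gt0 pq'.
have mr c' m : 0 < c' -> (0 < m)%N -> mset (rballs c' m).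
  by move=> c'0 m0; have [] := vol_bigcup_seq (pts m) (fun p => vol_rball p c'0 m0).
split; first exact: mr.
pose rho := q%:R * q'%:R * rad c q'.
have r0 := rad_gt0 c0 q'0.
have rho0 : 0 < rho by rewrite mulr_gt0// mulr_gt0// ltr0n.
have diff p p' x : rball c q p x -> rball c q' p' x ->
    cbox K rho (mul (- dil q'%:R (iv p)) (dil q%:R (iv p'))).
  by apply: HK => //; [apply: rad_le => //; exact: ltnW|exact/ltW/rad_gt0].
(* For small rho there is no overlap at all: u has a nonzero integer coordinate of weight 1, which
   the box would force below 1. *)
have [Krho|Krho] := ltP (K * rho) 1.
  rewrite (_ : rballs c q `&` rballs c q' = set0).
    by rewrite /vol preimage_set0 measure0 lee_fin !mulr_ge0 ?invr_ge0 ?exprn_ge0 ?addr_ge0 ?mulr_ge0 ?(ltW K0) ?(ltW c0).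
  apply/seteqP; split=> // x [[p /= hp hx] [p' /= hp' hx']].
  have [j wj] := pts_diff_neq0 p' pq pq' qq hp.
  have := diff _ _ _ hx hx' j; rewrite wj expr1.
  have ui : integer_point (mul (- dil q'%:R (iv p)) (dil q%:R (iv p'))).
    apply: integer_mul => //; [apply: integer_opp|]; move=> l; rewrite dilE rpredM ?rpredX ?iv_integer//; exact: intr_nat.
  have /intrP[a ->] := ui j; rewrite -intr_norm => ha.
  have : `|a|%:~R < 1%:~R :> R by rewrite (le_lt_trans ha).
  by rewrite ltr_int intr_eq0 => a1 /eqP; apply; clear -a1; lia.
(* The radius is enlarged to K rho, which is at least 1 as the count of integer points requires. *)
have [s [_ sz sP]] := intbox_real G (ltW K0) Krho.
pose u (zz : 'rV[int]_n * 'rV[int]_n) := mul (- dil q'%:R (iv zz.1)) (dil q%:R (iv zz.2)).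
pose f (zz : 'rV[int]_n * 'rV[int]_n) : 'rV[int]_n := \row_j Num.floor (u zz 0 j).
have fu zz : iv (f zz) = u zz.
  have ui : integer_point (u zz).
    by apply: integer_mul => //; [apply: integer_opp|]; move=> l; rewrite dilE rpredM ?rpredX ?iv_integer//; exact: intr_nat.
  by apply/rowP => j; rewrite ivE mxE floorK//; exact: ui.
pose meet (zz : 'rV[int]_n * 'rV[int]_n) := `[< exists x, rball c q zz.1 x /\ rball c q' zz.2 x >].
pose r := [seq zz <- [seq (p, p') | p <- pts q, p' <- pts q'] | meet zz].
have rP zz : zz \in r -> [/\ zz.1 \in pts q, zz.2 \in pts q' & meet zz].
  rewrite mem_filter => /andP[mt /allpairsP[pp [h1 h2 ppE]]].
  by move: mt; rewrite ppE; case: pp h1 h2 {ppE} => p p' /= h1 h2 mt; split.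
have f_inj : {in r &, injective f}.
  move=> zz zz' /rP[z1 z2 _] /rP[z1' z2' _] /(congr1 (@iv _ _)); rewrite !fu => uzz.
  have [] := pts_diff_inj pq pq' qq z1 z2 z1' z2' uzz.
  by case: zz zz' {z1 z2 z1' z2' uzz} => [? ?] [? ?] /= -> ->.
have fr : (size r <= size s)%N.
  rewrite -(size_map f); apply: uniq_leq_size.
    rewrite map_inj_in_uniq// filter_uniq// allpairs_uniq ?pts_uniq//.
    by move=> [? ?] [? ?].
  move=> _ /mapP[zz /rP[_ _ /asboolP[x [hx hx']]] ->]; apply/sP; rewrite fu.
  move=> j; apply: le_trans (diff _ _ _ hx hx' j) _; rewrite ler_wpM2l ?(ltW K0)//.
  by rewrite lerXn2r ?nnegrE ?(ltW rho0)// ?ler_peMl ?(ltW rho0)// mulr_ge0 ?(ltW K0) ?(ltW rho0).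
have mI : mset (rballs c q `&` rballs c q').
  by apply: measurableI; exact: mr.
apply: le_trans (vol_bigcup_le (r := r) mI (fun zz => vol_rball zz.1 c0 q0) _) _.
  move=> x [[p /= hp hx] [p' /= hp' hx']]; exists (p, p') => //=.
  rewrite mem_filter; apply/andP; split; first by apply/asboolP; exists x.
  by apply/allpairsP; exists (p, p').
rewrite lee_fin.
have cq : 0 <= c ^+ Q * q%:R ^- Q.+1 by rewrite mulr_ge0 ?invr_ge0 ?exprn_ge0 ?(ltW c0).
apply: (@le_trans _ _ (((2 * K + 1) ^+ n * (K * rho) ^+ Q) * (2 ^+ n * (c ^+ Q * q%:R ^- Q.+1)))).
  apply: ler_wpM2r; first by rewrite mulr_ge0// exprn_ge0.
  by apply: le_trans sz; rewrite ler_nat.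
rewrite [(K * rho) ^+ Q]exprMn /rho [(_ * rad c q') ^+ Q]exprMn rad_exp exprMn !exprS le_eqVlt; apply/predU1P; left.
have q1 : q%:R != 0 :> R by rewrite pnatr_eq0 -lt0n.
have q2 : q'%:R != 0 :> R by rewrite pnatr_eq0 -lt0n.
have := expf_neq0 Q q1; have := expf_neq0 Q q2.
move: (q%:R ^+ Q) (q'%:R ^+ Q) (K ^+ Q) (c ^+ Q) ((2 * K + 1) ^+ n) (2 ^+ n).
move: q1 q2; move: (q%:R : R) (q'%:R : R) => A B A0 B0 C D E F H I D0 C0.
by field; rewrite A0 B0 C0 D0.
Qed.

Lemma vol_rballs c : 0 < c -> exists q0, forall q, prime q -> (q0 <= q)%N ->
  ((4^-1 ^+ n * (c ^+ Q / q%:R))%:E <= vol (rballs c q))%E.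
Proof.
move=> c0; have [K K1 HK] := overlap_diff G.
have K0 : 0 < K by apply: lt_le_trans K1.
have Q0 : 0 < Q%:R :> R by rewrite ltr0n hdim_gt0.
(* Such q make K q rad(q) = K c q^(-1/Q) less than 1, so that the boxes of one q are disjoint; the 4
   is for [size_pts]. *)
pose q0 := maxn 4 (Num.truncn ((K * c) `^ Q%:R)).+1.
exists q0 => q pq; rewrite geq_max => /andP[q4 qK].
have qgt0 := prime_gt0 pq.
have small : K * (q%:R * rad c q) < 1.
  have qR : 0 < q%:R :> R by rewrite ltr0n.
  have -> : K * (q%:R * rad c q) = K * c * q%:R `^ (- Q%:R^-1).
    rewrite /rad opprD powRD; last by rewrite (gt_eqF qR) implybT.
    by rewrite powR_inv1 ?(ltW qR)//; field; rewrite gt_eqF.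
  rewrite powRN ltr_pdivrMr ?powR_gt0// mul1r.
  have -> : K * c = ((K * c) `^ Q%:R) `^ Q%:R^-1.
    by rewrite -powRrM mulfV ?(gt_eqF Q0)// powRr1// mulr_ge0 ?(ltW K0) ?(ltW c0).
  apply: gt0_ltr_powR; rewrite ?invr_gt0// ?nnegrE ?powR_ge0//.
  by rewrite (lt_le_trans (truncnS_gt _))// ler_nat.
have E : vol (rballs c q) = ((size (pts q))%:R * (2 ^+ n * (c ^+ Q * q%:R ^- Q.+1)))%:E.
  apply: vol_bigcup_disjoint (pts_uniq q) _ => [p|p p' x]; first exact: vol_rball.
  exact: (rball_disjoint K1 c0 qgt0 HK small).
rewrite E lee_fin.
apply: (@le_trans _ _ ((q%:R ^+ Q / 8 ^+ n) * (2 ^+ n * (c ^+ Q * q%:R ^- Q.+1)))); last first.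
  rewrite ler_wpM2r ?size_pts// !mulr_ge0 ?invr_ge0 ?exprn_ge0 ?(ltW c0)//.
rewrite le_eqVlt; apply/predU1P; left; have -> : (8 : R) = 2 * 4 by lra.
rewrite exprMn exprVn exprS.
have q1 : q%:R != 0 :> R by rewrite pnatr_eq0 -lt0n.
have := expf_neq0 Q q1; have : 2 ^+ n != 0 :> R by rewrite expf_neq0.
have : 4 ^+ n != 0 :> R by rewrite expf_neq0.
move: (q%:R ^+ Q) (c ^+ Q) (4 ^+ n) (2 ^+ n) q1; move: (q%:R : R) => A B C D F A0 D0 F0 B0.
by field; rewrite A0 B0 D0 F0.
Qed.
End Overlaps.

(** * A lower bound for the limsup set, uniform in c *)

Section Density.
Context {R : realType} (G : carnotGroup R).
Local Notation n := (carnot_dim G).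
Local Notation w := (@carnot_weight _ G).
Local Notation corr := (@carnot_corr _ G).
Local Notation V := 'rV[R]_n.
Local Notation mul := (group_mul corr).
Local Notation dil r := (carnot_dilation (G := G) r).
Implicit Types (x y z u v a b : V) (j k l : 'I_n).
Local Opaque frame dframe ev lie_bracket.

Local Notation Q := (hdim G).

Lemma rad_le_inv c q : 0 < c -> (0 < q)%N -> rad G c q <= c / q%:R.
Proof.
move=> c0 q0; rewrite ler_wpM2l ?(ltW c0)// -(@powR_inv1 _ q%:R)//.
by apply: ler_powR; rewrite ?ler1n// lerN2 lerDl.
Qed.

Lemma rballs_unit_cube c : 0 < c -> exists q0, forall q, (q0 <= q)%N ->
  rballs c q `<=` unit_cube (G := G).
Proof.
move=> c0; have [K K0 HK] := mul_lipschitz G 1.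
(* This gives K rad < 1/4 and rad <= 1: the centres have coordinates in [1/4, 1/2], which move by
   less than 1/4. *)
exists (Num.truncn (c * (4 * K + 4))).+1 => q qc.
have q0 : (0 < q)%N by apply: leq_trans qc.
have qR : 0 < q%:R :> R by rewrite ltr0n.
have rc : rad G c q < (4 * K + 4)^-1.
  apply: le_lt_trans (rad_le_inv c0 q0) _.
  rewrite ltr_pdivrMr// ltr_pdivlMl; last by rewrite ltr_wpDl// mulr_ge0.
  by rewrite mulrC (lt_le_trans (truncnS_gt _))// ler_nat.
move=> x [p /= hp hx]; pose y := dil q%:R^-1 (iv p).
have r0 : 0 < rad G c q by exact: rad_gt0.
have Kr : K * rad G c q < 4^-1 /\ rad G c q <= 1.
  have K4 : 0 < 4 * K + 4 by rewrite ltr_wpDl// mulr_ge0.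
  have : rad G c q * (4 * K + 4) < 1 by rewrite -ltr_pdivlMr// div1r.
  have : 0 <= K * rad G c q by rewrite mulr_ge0// ltW.
  have -> : rad G c q * (4 * K + 4) = 4 * (K * rad G c q) + 4 * rad G c q by ring.
  move: r0.
  by move: (K * rad G c q) (rad G c q) => A B; split; lra.
have yb j : 4^-1 <= y 0 j <= 2^-1.
  have := ptsP hp j.
  have -> : y 0 j = (p 0 j)%:~R / (q ^ w j)%:R by rewrite /y dilE ivE exprVn natrX mulrC.
  rewrite ler_pdivlMr ?ler_pdivrMr ?ltr0n ?expn_gt0 ?q0//.
  move: (q ^ w j)%N (p 0 j) => l s /andP[l1 l2].
  have : l%:Z%:~R <= (4 * s)%:~R :> R by rewrite ler_int ltW.
  have : (2 * s)%:~R <= l%:Z%:~R :> R by rewrite ler_int.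
  rewrite !intrM -[l%:Z%:~R]/(l%:R) -[2%:~R]/(2 : R) -[4%:~R]/(4 : R) => h1 h2.
  by apply/andP; split; lra.
move=> j; rewrite -(mulVKx y x); have [Kr1 r1] := Kr.
have : `|mul y (mul (- y) x) 0 j - y 0 j| <= K * rad G c q.
  apply: HK => [|l|l]; first by rewrite (ltW r0).
    by have := yb l; rewrite ler_norml; lra.
  apply: le_trans (hx l) _; rewrite mul1r -[leRHS]expr1.
  by rewrite ler_wiXn2l ?weight_gt0 ?(ltW r0).
by have := yb j; rewrite ler_distl; move: Kr1; lra.
Qed.

(** The union over all p is indexed by natural numbers through [unpickle], which makes it a
    countable union for measurability. *)
Definition near_pts c q : set V :=
  \bigcup_i (if (unpickle i : option 'rV[int]_n) is Some p then rball c q p else set0).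

Lemma near_ptsP c q x : near_pts c q x <-> exists p, rball c q p x.
Proof.
split=> [[i _]|[p px]]; last first.
  by exists (pickle p) => //; rewrite pickleK.
by case: (unpickle i) => [p px|[]]; exists p.
Qed.

Definition well_approximable c : set V := lim_sup_set (near_pts c).

Lemma mset_near_pts c q : 0 < c -> mset (near_pts c q.+1).
Proof.
move=> c0; rewrite /mset preimage_bigcup; apply: bigcup_measurable => i _.
case: (unpickle i) => [p|]; first exact: (vol_rball p c0 (ltn0Sn q)).1.
by rewrite preimage_set0; exact: measurable0.
Qed.

(** Shifting the index discards the denominator 0. *)
Lemma well_approximableE c : well_approximable c = \bigcap_i \bigcup_(q >= i) near_pts c q.+1.
Proof.
apply/seteqP; split=> x hx i _.
  by have [[|q]// qi hq] := hx i.+1 I; exists q.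
by have [q qi hq] := hx i I; exists q.+1 => //=; exact: leqW.
Qed.

Lemma mset_well_approximable c : 0 < c -> mset (well_approximable c).
Proof.
move=> c0; rewrite well_approximableE /mset preimage_bigcap; apply: bigcap_measurable => // i _.
by rewrite preimage_bigcup; apply: bigcup_measurable => q _; exact: mset_near_pts.
Qed.

Context (Grat : rational_carnot G).

(* Finitely many primes are selected so that the sum of c^Q / q is of order eta:
   the overlaps, bounded by C eta^2, are then dominated by the volumes. *)
Lemma well_approximable_density : exists2 kappa : R, 0 < kappa <= 1 & forall c, 0 < c ->
  (kappa%:E <= vol (well_approximable c `&` @unit_cube R G))%E.
Proof.
have [C C0 HC] := rballs_overlap Grat.
pose a : R := 4^-1 ^+ n; have a0 : 0 < a by rewrite exprn_gt0.
(* For eta/2 <= S <= eta one has a S - C S^2 = S (a - C S) >= (eta/2)(a/2), since C eta = a/2. None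
   of these constants involves c. *)
pose eta := a / (2 * C); have eta0 : 0 < eta by rewrite divr_gt0// mulr_gt0.
pose kappa := Num.min 1 (eta / 2 * (a / 2)).
exists kappa.
  rewrite /kappa lt_min ltr01 ge_min lexx andbT /=.
  by apply: mulr_gt0; apply: divr_gt0.
move=> c c0.
have [q1 hq1] := vol_rballs Grat c0.
have [q2 hq2] := rballs_unit_cube c0.
(* Beyond q3 each term c^Q / q is at most eta/2, so the first partial sum to reach eta/2 does not
   exceed eta. Only such thresholds depend on c. *)
pose q3 := (Num.truncn (c ^+ Q * (eta / 2)^-1)).+1.
pose q0 := maxn 1 (maxn q1 (maxn q2 q3)).
pose F (q : nat) : set V := if prime q && (q0 <= q)%N then rballs c q else set0.
have mF q : mset (F q).
  rewrite /F; case: ifP => [/andP[pq _]|_]; last exact: measurable0.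
  by have [] := vol_bigcup_seq (pts G q) (fun p => vol_rball p c0 (prime_gt0 pq)).
have FI q : F q `<=` @unit_cube R G.
  rewrite /F; case: ifP => [/andP[_ qq]|_]; last exact: sub0set.
  apply: hq2; apply: leq_trans qq.
  by rewrite !leq_max leqnn !orbT.
have [mI vI] := vol_unit_cube G.
pose mu := lebesgue_tuple R n.
pose F' q := @point_of_tuple R G @^-1` F q.
have lower N0 : (kappa%:E <= mu (\bigcup_(q >= N0) F' q))%E.
  pose k0 := maxn N0 q0.
  pose h q : R := if prime q && (k0 <= q)%N then c ^+ Q / q%:R else 0.
  have h_ge0 q : 0 <= h q.
    by rewrite /h; case: ifP => // _; rewrite divr_ge0 ?exprn_ge0 ?(ltW c0).
  pose S m := \sum_(q < m) h q.
  have hP q : prime q && (k0 <= q)%N -> [/\ h q = c ^+ Q / q%:R, F q = rballs c q & h q <= eta / 2].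
    move=> /andP[pq qk]; have qk0 : (q0 <= q)%N by apply: leq_trans qk; rewrite leq_maxr.
    rewrite /h /F pq qk qk0/=; split => //.
    rewrite ler_pdivrMr ?ltr0n ?prime_gt0// mulrC -ler_pdivrMr; last exact: divr_gt0.
    rewrite ltW// (lt_le_trans (truncnS_gt _))// ler_nat -/q3 (leq_trans _ qk0)//.
    by rewrite !leq_max leqnn !orbT.
  have SN : exists N, (eta / 2 <= S N).
    have [N HN] := prime_harmonic_unbounded k0 (eta / 2 / c ^+ Q).
    exists N; move: HN; rewrite ler_pdivrMr ?exprn_gt0// => HN.
    apply: le_trans HN _; rewrite mulr_suml /S.
    have [kN|Nk] := leqP k0 N; last by rewrite big_geq ?(ltnW Nk)// sumr_ge0.
    rewrite -(big_mkord xpredT h) [leRHS](@big_cat_nat _ _ _ k0)//= ler_wpDl ?sumr_ge0//.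
    rewrite big_mkcond/= big_nat_cond [leRHS]big_nat_cond; apply: ler_sum => q'.
    by rewrite andbT /h => /andP[-> _]; rewrite andbT; case: ifP => // _; rewrite mulrC.
  case: (ex_minnP SN) => -[|m]; first by rewrite /S big_ord0 leNgt (divr_gt0 eta0).
  move=> Sm Smin.
  have Smeta : S m.+1 <= eta.
    rewrite /S big_ord_recr/= -/(S m) [leRHS](_ : _ = eta / 2 + eta / 2); last by lra.
    apply: lerD.
      by rewrite leNgt; apply/negP => /ltW /Smin; rewrite ltnn.
    have [/hP[]//|nq] := boolP (prime m && (k0 <= m)%N).
    by rewrite /h (negbTE nq); apply: divr_ge0 => //; exact: ltW.
  pose E q := if prime q && (k0 <= q)%N then F' q else set0.
  have mE q : measurable (E q).
    by rewrite /E; case: ifP => _; [exact: mF|exact: measurable0].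
  have B := bonferroni mu m.+1 mE.
  have sub : (mu (\big[setU/set0]_(i < m.+1) E i) <= mu (\bigcup_(q >= N0) F' q))%E.
    apply: le_measure; rewrite ?inE.
    - by apply: bigsetU_measurable => q _; exact: mE.
    - by apply: bigcup_measurable => q _; exact: mF.
    move=> t; rewrite -bigcup_mkord => -[q _]; rewrite /E; case: ifP => [/andP[_ kq] Eq|_ []].
    by exists q => //=; apply: leq_trans kq; rewrite leq_maxl.
  apply: le_trans sub.
  have low : ((a * S m.+1)%:E <= \sum_(i < m.+1) mu (E i))%E.
    rewrite /S mulr_sumr -sumEFin; apply: lee_sum => q _.
    have [hq|nq] := boolP (prime q && (k0 <= q)%N); last by rewrite /h (negbTE nq) mulr0 measure_ge0.
    rewrite /E hq; have [-> FE _] := hP _ hq; move: hq => /andP[pq kq].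
    rewrite /F' FE; apply: hq1 => //; apply: leq_trans kq.
    by rewrite !leq_max leqnn !orbT.
  have up : (\sum_(i < m.+1) \sum_(i' < i) mu (E i `&` E i') <= (C * S m.+1 ^+ 2)%:E)%E.
    apply: (@le_trans _ _ (\sum_(i < m.+1) \sum_(i' < m.+1) (C * (h i * h i'))%:E)%E).
      apply: lee_sum => q _; rewrite (big_ord_widen _ (fun i' => mu (E q `&` E i')) (ltnW (ltn_ord q))).
      rewrite big_mkcond/=; apply: lee_sum => q' _.
      have hh : 0 <= C * (h q * h q') by rewrite !mulr_ge0 ?(ltW C0).
      case: ifP => // qq.
      have [hq|nq] := boolP (prime q && (k0 <= q)%N); last by rewrite {1}/E (negbTE nq) set0I measure0.
      have [hq'|nq'] := boolP (prime q' && (k0 <= q')%N); last by rewrite {2}/E (negbTE nq') setI0 measure0.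
      have [hE FE _] := hP _ hq; have [hE' FE' _] := hP _ hq'.
      rewrite /E hq hq' /F' FE FE' hE hE' mulrA.
      move: hq hq' => /andP[pq _] /andP[pq' _].
      by have [_] := HC c q q' c0 pq pq' qq.
    rewrite expr2 [in leRHS]/S mulr_suml mulr_sumr -sumEFin; apply: lee_sum => q _.
    by rewrite !mulr_sumr -sumEFin.
  have : ((a * S m.+1)%:E <= mu (\big[setU/set0]_(i < m.+1) E i) + (C * S m.+1 ^+ 2)%:E)%E.
    by apply: le_trans low _; apply: (le_trans B); exact: leeD2l.
  rewrite -leeBlDr// -EFinB; apply: le_trans; rewrite lee_fin /kappa ge_min; apply/orP; right.
  have CS : C * S m.+1 <= a / 2.
    apply: (@le_trans _ _ (C * eta)); first by rewrite ler_wpM2l ?(ltW C0).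
    rewrite /eta le_eqVlt; apply/predU1P; left; have Cn : C != 0 by rewrite gt_eqF.
    by field; rewrite Cn.
  rewrite [leRHS](_ : _ = S m.+1 * (a - C * S m.+1)); last by ring.
  apply: ler_pM => //; [by apply: divr_ge0 => //; exact: ltW|by apply: divr_ge0 => //; exact: ltW|].
  by move: CS; move: (C * _) => A; lra.
have mW := mset_well_approximable c0.
(* Continuity from above carries the bound from the tails to the limsup; the unit cube keeps the
   measures finite. *)
have cvgL : mu (\bigcup_(q >= i) F' q) @[i --> \oo] --> mu (lim_sup_set F').
  apply: lim_sup_set_cvg => //; apply: (@le_lt_trans _ _ 1%E); last exact: ltry.
  rewrite -vI; apply: le_measure; rewrite ?inE//.
    by apply: bigcup_measurable => q _; exact: mF.
  by move=> t [q _ /FI].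
apply: (@le_trans _ _ (mu (lim_sup_set F'))).
  rewrite -(cvg_lim _ cvgL)//; apply: lime_ge; first by apply/cvg_ex; exists (mu (lim_sup_set F')).
  by apply: nearW => i; exact: lower.
apply: le_measure; rewrite ?inE.
- by apply: bigcap_measurable => // i _; apply: bigcup_measurable => q _; exact: mF.
- exact: measurableI.
move=> t ht; split.
  move=> i _; have [q qi] := ht i I; rewrite /F' /F /=; case: ifP => [_ [p _ hp]|_ []].
  by exists q => //; apply/near_ptsP; exists p.
by have [q _ /FI] := ht 0%N I.
Qed.
End Density.

(** * Tiles of mesh 1/M *)

Section Tiles.
Context {R : realType} (G : carnotGroup R).
Local Notation n := (carnot_dim G).
Local Notation w := (@carnot_weight _ G).
Local Notation corr := (@carnot_corr _ G).
Local Notation V := 'rV[R]_n.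
Local Notation mul := (group_mul corr).
Local Notation dil r := (carnot_dilation (G := G) r).
Implicit Types (x y z u v a b : V) (j k l : 'I_n).
Local Opaque frame dframe ev lie_bracket.

Local Notation Q := (hdim G).
Local Notation pt := (@point_of_tuple R G).

(** Coordinate preimages generate the product sigma-algebra, and open right rays generate the Borel
    sets of the line. *)
Lemma mset_ind (P : set V -> Prop) : P set0 -> (forall A, P A -> P (~` A)) ->
  (forall F : (set V)^nat, (forall i, P (F i)) -> P (\bigcup_i F i)) ->
  (forall j (a : R), P [set x : V | a < x 0 j]) -> forall A, mset A -> P A.
Proof.
move=> P0 PC PU Pj A mA.
pose P' (B : set (n.-tuple (measurableTypeR R))) := P (@tup R G @^-1` B).
suff H : measurable `<=` P'.
  have := H _ mA; rewrite /P'; congr P; apply/seteqP; split=> x /=; by rewrite tupK.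
apply: smallest_sub.
  split; first exact: P0.
    by move=> B; rewrite setTD; exact: PC.
  by move=> F; exact: PU.
apply: (big_ind (fun X => X `<=` P')) => [B []|X Y hX hY B [/hX|/hY]//|j _ _ [C mC <-]].
rewrite /P' setTI.
suff : measurable `<=` [set C : set (measurableTypeR R) | P [set x : V | C (x 0 j)]].
  move=> /(_ _ mC) /=; congr P; apply/seteqP; split=> x /=; by rewrite tnth_mktuple.
rewrite [X in X `<=` _]RGenOInfty.measurableE; apply: smallest_sub.
  split; first exact: P0.
    by move=> B; rewrite setTD; exact: PC.
  by move=> F; exact: PU.
move=> _ [a ->] /=; have := Pj j a; congr P; apply/seteqP.
by split=> x /=; rewrite in_itv/= andbT.
Qed.

Definition tile (M : nat) (P : 'rV[int]_n) : set V :=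
  [set x | unit_cube (mul (- iv P) (dil M%:R x))].

Lemma mset_tile_preimage (M : nat) a A : (0 < M)%N -> mset A ->
  mset [set x | A (mul a (dil M%:R x))] /\
  vol A = ((M%:R ^+ Q)%:E * vol [set x | A (mul a (dil M%:R x))])%E.
Proof.
move=> M0 mA; have mdil j : mfun (fun x => dil M%:R x 0 j).
  apply: (mfun_ext _ (mfunM (mfun_cst (M%:R ^+ w j)) (mfun_coord j))) => x.
  by rewrite dilE.
have mmul j : mfun (fun x => mul a x 0 j).
  by apply: mfun_mul => i; [exact: mfun_cst|exact: mfun_coord].
have mA' : mset [set x | A (mul a x)] by exact: (mset_preimage mmul mA).
split; first exact: (mset_preimage mdil mA').
by rewrite -(vol_mul a mA) (vol_dil (r := M%:R) _ mA')// ltr0n.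
Qed.

Lemma vol_tile M P : (0 < M)%N -> mset (tile M P) /\ vol (tile M P) = (M%:R ^- Q)%:E.
Proof.
move=> M0; have [m v] := vol_unit_cube G.
have [m' v'] := mset_tile_preimage (- iv P) M0 m; split => //.
have MQ : 0 < M%:R ^+ Q :> R by rewrite exprn_gt0// ltr0n.
move: v'; rewrite v -[vol [set x | _]]/(vol (tile M P)) => e.
have fin : vol (tile M P) = ((M%:R ^- Q)%:E * (M%:R ^+ Q)%:E * vol (tile M P))%E.
  by rewrite -EFinM mulVf ?mul1e// gt_eqF.
by rewrite fin -muleA -e mule1.
Qed.

Context (Grat : rational_carnot G).

Lemma tile_inj M P P' x : tile M P x -> tile M P' x -> P = P'.
Proof.
move=> h h'; apply: (@iv_inj _ G).
have zi : integer_point (mul (- iv P') (iv P)).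
  by apply: integer_mul => //; [apply: integer_opp|]; exact: iv_integer.
have := fundamental_domain_uniq zi h; rewrite mulA.
rewrite -[mul (mul _ _) (- _)]mulA mulxV mulx0 => /(_ h') z0.
by rewrite -[LHS](mulVKx (iv P')) z0 mulx0.
Qed.

Lemma tile_exists M x : exists P, tile M P x.
Proof.
have [z zi hz] := fundamental_domain (dil M%:R x) Grat.
by have [P zE] := integer_pointP zi; exists P; rewrite /tile /= -zE.
Qed.

Lemma tile_close : exists2 K : R, 0 < K & forall (M : nat) P x y, (0 < M)%N ->
  tile M P x -> tile M P y -> cbox K M%:R^-1 (mul (- x) y).
Proof.
have [K K0 HK] := mul_hbounded G 1; exists K => // M P x y M0 hx hy j.
have MR : 0 < M%:R :> R by rewrite ltr0n.
have Mn : M%:R != 0 :> R by rewrite gt_eqF.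
have E : dil M%:R (mul (- x) y) =
    mul (- mul (- iv P) (dil M%:R x)) (mul (- iv P) (dil M%:R y)).
  by rewrite mul_cancel -dilN mul_dil.
have : `|dil M%:R (mul (- x) y) 0 j| <= K * 1 ^+ w j.
  rewrite E; apply: HK; first exact: ltr01.
    exact/cboxN/unit_cube_cbox.
  exact/unit_cube_cbox.
rewrite dilE normrM expr1n mulr1 (ger0_norm (exprn_ge0 _ (ltW MR))) => h.
by rewrite exprVn ler_pdivlMr ?exprn_gt0// mulrC.
Qed.
End Tiles.

(** * Invariance of the limsup set and approximation by unions of tiles *)

Section Approximation.
Context {R : realType} (G : carnotGroup R).
Local Notation n := (carnot_dim G).
Local Notation corr := (@carnot_corr _ G).
Local Notation V := 'rV[R]_n.
Local Notation mul := (group_mul corr).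
Local Notation dil r := (carnot_dilation (G := G) r).
Implicit Types (x y z u v a b : V) (j k l : 'I_n).
Local Opaque frame dframe ev lie_bracket.

Local Notation Q := (hdim G).

(** Translating p/q by z gives p'/q, where p' is the product of the dilation of z by q with p,
    integral by rationality. *)
Lemma near_pts_mul c q z x : rational_carnot G -> integer_point z ->
  near_pts c q.+1 x -> near_pts c q.+1 (mul z x).
Proof.
move=> Grat zi /near_ptsP[p px]; apply/near_ptsP.
have qR : q.+1%:R != 0 :> R by rewrite pnatr_eq0.
have : integer_point (mul (dil q.+1%:R z) (iv p)).
  apply: integer_mul => //; last exact: iv_integer.
  by move=> j; rewrite dilE rpredM ?rpredX ?zi//; exact: intr_nat.
move=> /integer_pointP[p' p'E]; exists p'; rewrite /rball /= -p'E -mul_dil ?invr_eq0//.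
by rewrite dil_dil mulVf// (_ : dil 1 z = z) ?mul_cancel//; apply/rowP => j; rewrite dilE expr1n mul1r.
Qed.

Lemma well_approximable_mul c z x : rational_carnot G -> integer_point z ->
  well_approximable c x -> well_approximable c (mul z x).
Proof.
move=> Grat zi; rewrite !well_approximableE => hx i _.
by have [q qi hq] := hx i I; exists q => //; exact: near_pts_mul.
Qed.

(** If p/q approximates the dilation of x by M, then p/(Mq) approximates x with the radius divided
    by M. As kappa does not depend on c, the constant may be lowered according to M. *)
Lemma tile_density : rational_carnot G -> exists2 kappa : R, 0 < kappa <= 1 &
  forall c M P, 0 < c -> (0 < M)%N ->
  ((kappa * M%:R ^- Q)%:E <= vol (tile M P `&` well_approximable c : set V))%E.
Proof.
move=> Grat; have [kappa k01 Hk] := well_approximable_density Grat.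
exists kappa => // c M P c0 M0.
have MR : 0 < M%:R :> R by rewrite ltr0n.
have Mn : M%:R != 0 :> R by rewrite gt_eqF.
(* This choice makes rad(c1, q) / M equal to rad(c, M q). *)
pose c1 := c / M%:R `^ Q%:R^-1.
have c10 : 0 < c1 by rewrite divr_gt0// powR_gt0.
pose A := well_approximable c1 `&` @unit_cube R G.
have [mI _] := vol_unit_cube G.
have mA : mset A by apply: measurableI => //; exact: mset_well_approximable.
have [mA' vA] := mset_tile_preimage (- iv P) M0 mA.
have : (vol [set x | A (mul (- iv P) (dil M%:R x))] <= vol (tile M P `&` well_approximable c : set V))%E.
  apply: le_measure; rewrite ?inE//.
    by apply: measurableI; [exact: (vol_tile P M0).1|exact: mset_well_approximable].
  move=> t [/= ht hc]; split => //; move: ht hc; move: (point_of_tuple t) => x ht hc.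
  have /(well_approximable_mul Grat (iv_integer P)) := ht; rewrite mulVKx.
  rewrite !well_approximableE => hx i _; have [q qi /near_ptsP[p hp]] := hx i I.
  exists (M * q.+1).-1; first by move: qi => /=; nia.
  rewrite prednK ?muln_gt0 ?M0//; apply/near_ptsP; exists p => j.
  have E : dil (M * q.+1)%:R^-1 (iv p) = dil M%:R^-1 (dil q.+1%:R^-1 (iv p)).
    by rewrite dil_dil natrM invfM.
  rewrite E -[X in mul _ X](dilK x (invr_neq0 Mn)) -dilN mul_dil ?invr_eq0// invrK.
  rewrite dilE normrM exprVn ger0_norm ?invr_ge0 ?exprn_ge0 ?(ltW MR)//.
  rewrite mulrC ler_pdivrMr ?exprn_gt0// mul1r -exprMn.
  apply: le_trans (hp j) _; rewrite mul1r le_eqVlt; apply/predU1P; left; congr (_ ^+ _).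
  rewrite /rad /c1 natrM powRM ?(ltW MR)//.
  have -> : M%:R `^ (- (1 + Q%:R^-1)) = (M%:R * M%:R `^ Q%:R^-1)^-1 :> R.
    by rewrite powRN powRD ?Mn ?implybT// powRr1// ltW.
  have h : M%:R `^ Q%:R^-1 != 0 :> R by rewrite gt_eqF// powR_gt0.
  by field; rewrite Mn h.
apply: le_trans.
have fin : vol [set x | A (mul (- iv P) (dil M%:R x))] =
    ((M%:R ^- Q)%:E * ((M%:R ^+ Q)%:E * vol [set x | A (mul (- iv P) (dil M%:R x))]))%E.
  by rewrite muleA -EFinM mulVf ?mul1e// expf_neq0.
rewrite fin -vA mulrC EFinM lee_pmul2l//; first exact: Hk.
by rewrite lte_fin invr_gt0 exprn_gt0.
Qed.

(* Up to a set of small measure, membership in A depends only on the tile. *)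
Definition approximable (b : R) (A : set V) := mset A /\
  forall eps, 0 < eps -> exists M0 : nat, forall M, (M0 <= M)%N ->
  exists (s : set 'rV[int]_n) (D : set V), [/\ mset D, (vol D <= eps%:E)%E &
    forall x P, cbox b 1 x -> ~ D x -> tile M P x -> (A x <-> s P)].

(** Within a tile meeting the box a coordinate varies by O(1/M), so only points in the slab from c
    to c + A/M can have an undecided tile; the slab has volume O(1/M) inside the box. *)
Lemma approximable_halfspace (b : R) j (c : R) : 0 < b ->
  approximable b [set x : V | c < x 0 j].
Proof.
move=> b0; have [K K0 HK] := tile_close G.
have [K' K'0 HK'] := mul_lipschitz G b.
pose C := \prod_(l | l != j) (2 * b).
have C0 : 0 <= C by apply: prodr_ge0 => l _; rewrite mulr_ge0// ltW.
pose B e l : set R := if l == j then `]c, (c + e)]%classic else `[- b, b]%classic.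
pose D e : set V := [set x | forall l, B e l (x 0 l)].
have slab (e : R) : 0 < e -> mset (D e) /\ vol (D e) = (e * C)%:E.
  move=> e0.
  have mB l : measurable (B e l) by rewrite /B; case: ifP => _; exact: measurable_itv.
  have [mS vS] := vol_prod mB; split => //; rewrite /D vS (bigD1 j)//= EFinM; congr (_ * _)%E.
    by rewrite /B eqxx lebesgue_measure_itv/= lte_fin ltrDl e0 -EFinB addrC addKr.
  rewrite /C -prodEFin; apply: eq_bigr => l lj.
  rewrite /B (negbTE lj) lebesgue_measure_itv/= lte_fin ifT; last by lra.
  by rewrite -EFinB opprK mulr_natl mulr2n.
split.
  have := mfun_coord j measurableT (measurable_itv `]c, +oo[); rewrite setTI; congr (measurable _).
  by apply/seteqP; split => t /=; rewrite in_itv/= andbT.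
move=> eps e0; pose A := K' * K + 1.
have A0 : 0 < A by rewrite ltr_wpDl// mulr_ge0// ltW.
exists (Num.truncn (K + A * C / eps)).+1 => M MM.
have M0 : (0 < M)%N by apply: leq_trans MM.
have MR : 0 < M%:R :> R by rewrite ltr0n.
have KM : K + A * C / eps <= M%:R by rewrite ltW// (lt_le_trans (truncnS_gt _))// ler_nat.
have AC : 0 <= A * C / eps by rewrite divr_ge0 ?mulr_ge0// ?(ltW A0) ?(ltW e0).
have [mD vD] := slab (A / M%:R) (divr_gt0 A0 MR).
exists [set P | forall y, tile M P y -> c < y 0 j], (D (A / M%:R)); split => //.
  rewrite vD lee_fin mulrAC ler_pdivrMr// -ler_pdivrMl// mulrC (le_trans _ KM)//.
  by rewrite lerDr ltW.
move=> x P bx Dx tx; split=> [/= cx y ty|]; last by apply.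
have : `|mul x (mul (- x) y) 0 j - x 0 j| <= K' * (K / M%:R).
  apply: HK'.
  - by rewrite divr_ge0 ?(ltW K0) ?(ltW MR)//= ler_pdivrMr// mul1r (le_trans _ KM)// lerDl.
  - by move=> l; have := bx l; rewrite expr1n mulr1.
  move=> l; apply: le_trans (HK _ _ _ _ M0 tx ty l) _; rewrite ler_wpM2l ?(ltW K0)//.
  rewrite -[leRHS]expr1 ler_wiXn2l ?weight_gt0 ?invr_ge0 ?(ltW MR)//.
  by rewrite invf_le1// ler1n.
rewrite mulVKx ler_distl => /andP[xy _].
have xc : c + A / M%:R < x 0 j.
  rewrite ltNge; apply/negP => xc; apply: Dx => l; rewrite /B.
  case: (eqVneq l j) => [->|_]; first by rewrite /= in_itv/= cx xc.
  by rewrite /= in_itv/= -ler_norml; have := bx l; rewrite expr1n mulr1.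
apply: lt_le_trans xy; rewrite ltrBrDr; apply: le_lt_trans xc.
by rewrite lerD2l mulrA ler_pM2r ?invr_gt0// lerDl.
Qed.

Lemma approximableC (b : R) A : approximable b A -> approximable b (~` A).
Proof.
move=> [mA HA]; split; first by rewrite /mset preimage_setC; exact: measurableC.
move=> eps e0; have [M0 H] := HA _ e0; exists M0 => M MM.
have [s [D [mD vD HD]]] := H M MM; exists (~` s), D; split => // x P bx Dx tx.
by have [h1 h2] := HD x P bx Dx tx; split=> h hh; apply: h; auto.
Qed.

Lemma approximable0 (b : R) : approximable b set0.
Proof.
split; first by rewrite /mset preimage_set0; exact: measurable0.
move=> eps e0; exists 0%N => M _; exists set0, set0; split => //.
  by rewrite /mset preimage_set0; exact: measurable0.
by rewrite /vol preimage_set0 measure0 lee_fin ltW.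
Qed.

Lemma volU (D D' : set V) (e e' : R) : mset D -> mset D' -> (vol D <= e%:E)%E -> (vol D' <= e'%:E)%E ->
  mset (D `|` D') /\ (vol (D `|` D') <= (e + e')%:E)%E.
Proof.
move=> mD mD' vD vD'; split; first exact: measurableU.
by rewrite (le_trans (measureU2 _ _ _))//= EFinD leeD.
Qed.

Lemma approximableU (b : R) A B : approximable b A -> approximable b B -> approximable b (A `|` B).
Proof.
move=> [mA HA] [mB HB]; split; first exact: measurableU.
move=> eps e0; have e2 : 0 < eps / 2 by rewrite divr_gt0.
have [M0 H] := HA _ e2; have [M0' H'] := HB _ e2; exists (maxn M0 M0') => M.
rewrite geq_max => /andP[/H[s [D [mD vD HD]]] /H'[s' [D' [mD' vD' HD']]]].
have [mU] := volU mD mD' vD vD'; rewrite -splitr => vU.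
exists (s `|` s'), (D `|` D'); split => // x P bx Dx tx.
have {}HD := HD x P bx (fun h => Dx (or_introl h)) tx.
have {}HD' := HD' x P bx (fun h => Dx (or_intror h)) tx.
by split=> -[/HD|/HD']; by [left|right].
Qed.

(** Inside the box, which has finite volume, the part of the union missed by the first m sets has
    volume tending to 0; half of eps pays for it, the other half for the finite union. *)
Lemma approximable_bigcup (b : R) (F : (set V)^nat) : 0 <= b -> (forall i, approximable b (F i)) ->
  approximable b (\bigcup_i F i).
Proof.
move=> b0 HF; have mF i : mset (F i) by have [] := HF i.
have mU : mset (\bigcup_i F i).
  by rewrite /mset preimage_bigcup; apply: bigcup_measurable => i _; exact: mF.
split => // eps e0; have e2 : 0 < eps / 2 by rewrite divr_gt0.
have HFm m : approximable b (\big[setU/set0]_(i < m) F i).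
  elim: m => [|m IH]; first by rewrite big_ord0; exact: approximable0.
  by rewrite big_ord_recr; exact: approximableU.
pose U m : set V := cbox b 1 `&` (\bigcup_i F i `\` \big[setU/set0]_(i < m) F i).
have E : [set x | cbox b 1 (mul 0 x)] = cbox b 1 :> set V.
  by apply/seteqP; split=> x /=; rewrite mul0.
have [mB vB] := vol_cbox (0 : V) b0 (ler01 : 0 <= 1 :> R); rewrite E in mB vB.
have mUm m : mset (U m).
  by apply: measurableI => //; apply: measurableD => //; exact: (HFm m).1.
have [m Um] : exists m, (vol (U m) <= (eps / 2)%:E)%E.
  apply: contrapT => noU.
  have big m : ((eps / 2)%:E <= vol (U m))%E.
    by rewrite ltW// ltNge; apply/negP => h; apply: noU; exists m.
  have : (fun m => vol (U m)) @ \oo --> lebesgue_tuple R n (\bigcap_m (point_of_tuple (G := G) @^-1` U m)).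
    apply: nonincreasing_cvg_mu => //.
    - apply: (@le_lt_trans _ _ (vol (cbox b 1 : set V))); last by rewrite vB ltry.
      by apply: le_measure; rewrite ?inE; [exact: mUm|exact: mB|move=> t []].
    - by apply: bigcap_measurable => // m _; exact: mUm.
    move=> m m' mm; apply/subsetPset => t [bt [Ft nt]]; split => //; split => // h; apply: nt.
    by move: h; apply: subset_bigsetU.
  rewrite (_ : \bigcap_m _ = set0) ?measure0; last first.
    apply/seteqP; split => // t ht; have [_ [[i _ Fi] _]] := ht 0%N I.
    have [_ [_ nF]] := ht i.+1 I; apply: nF.
    by rewrite big_ord_recr; right.
  move=> cvg0; have : ((eps / 2)%:E <= 0 :> \bar R)%E.
    rewrite -(cvg_lim _ cvg0)//; apply: lime_ge; first by apply/cvg_ex; exists 0%E.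
    by apply: nearW => m; exact: big.
  by rewrite lee_fin leNgt e2.
have [_ /(_ _ e2)[M0 H]] := HFm m; exists M0 => M /H[s [D [mD vD HD]]].
have [mUD] := volU (mUm m) mD Um vD; rewrite -splitr => vUD.
exists s, (U m `|` D); split => // x P bx Dx tx.
have [h1 h2] := HD x P bx (fun h => Dx (or_intror h)) tx; split=> [Fx|/h2].
  by apply: h1; apply: contrapT => nF; apply: Dx; left; split.
by rewrite -bigcup_mkord => -[i _ Fi]; exists i.
Qed.

Lemma mset_approximable (b : R) A : 0 < b -> mset A -> approximable b A.
Proof.
move=> b0; apply: mset_ind.
- exact: approximable0.
- by move=> ?; exact: approximableC.
- by move=> ?; apply: approximable_bigcup; exact: ltW.
- by move=> j c; exact: approximable_halfspace.
Qed.
End Approximation.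

(** * The limsup set has full measure *)

Section FullMeasure.
Context {R : realType} (G : carnotGroup R).
Local Notation n := (carnot_dim G).
Local Notation w := (@carnot_weight _ G).
Local Notation corr := (@carnot_corr _ G).
Local Notation V := 'rV[R]_n.
Local Notation mul := (group_mul corr).
Local Notation dil r := (carnot_dilation (G := G) r).
Implicit Types (x y z u v a b : V) (j k l : 'I_n).
Local Opaque frame dframe ev lie_bracket.

Context (ip : {dot (subvs_of (horizontal_space G)) for idfun}).
Local Notation Q := (hdim G).

(** Up to a set of volume eps, W of volume v is described by tiles of total volume at most v + eps,
    and the complement takes at most the share 1 - kappa of each tile. Hence v <= eps + (1 -
    kappa)(v + eps) for every eps, which forces v = 0. This plays the role of the Lebesgue density
    theorem. *)
Lemma unit_cube_complement_null c : rational_carnot G -> 0 < c ->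
  vol (~` well_approximable c `&` @unit_cube R G) = 0%E.
Proof.
move=> Grat c0; have [kappa /andP[k0 k1] Hk] := tile_density Grat.
pose Z : set V := ~` well_approximable c.
have mL := mset_well_approximable (G := G) c0.
have mZ : mset Z by exact: (measurableC mL).
have [mI vI] := vol_unit_cube G.
pose W : set V := Z `&` @unit_cube R G.
have mW : mset W by exact: measurableI.
have vW1 : (vol W <= 1)%E.
  by rewrite -vI; apply: le_measure; rewrite ?inE; [exact: mW|exact: mI|move=> t []].
have vW0 : (0 <= vol W)%E by exact: measure_ge0.
have vWfin : vol W = (fine (vol W))%:E.
  by rewrite fineK// ge0_fin_numE//; exact: le_lt_trans vW1 (ltry _).
pose v := fine (vol W).
have v0 : 0 <= v by rewrite -lee_fin -vWfin.
have vWle : (vol W <= v%:E)%E by rewrite vWfin.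
have [K K0 HK] := tile_close G.
(* Every tile containing a point of the unit cube lies in the box of size K1, where the
   approximation of W by tiles is taken. *)
have [K1 K10 HK1] := mul_hbounded G (Num.max 1 K).
have [K2 K20 HK2] := mul_hbounded G 1.
have small eps : 0 < eps -> v <= eps + (1 - kappa) * (v + eps).
  move=> e0; have [_ /(_ _ e0)[M0 HM]] := mset_approximable K10 mW.
  pose M := maxn 1 M0; have Mgt0 : (0 < M)%N by rewrite leq_maxl.
  have [s [D [mD vD HD]]] := HM M (leq_maxr _ _).
  have MR : 0 < M%:R :> R by rewrite ltr0n.
  have M1 : 1 <= M%:R :> R by rewrite ler1n.
  have tile_bounded P x y : tile M P x -> unit_cube x -> tile M P y -> cbox K1 1 y.
    move=> tx ux ty; rewrite -(mulVKx x y); apply: HK1 => // j.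
      have := unit_cube_cbox (lexx 1) ux j; move/le_trans; apply.
      by rewrite ler_wpM2r ?exprn_ge0// le_max lexx.
    apply: le_trans (HK _ _ _ _ Mgt0 tx ty j) _.
    apply: (@le_trans _ _ (K * 1 ^+ w j)).
      by rewrite ler_wpM2l ?(ltW K0)// lerXn2r ?nnegrE ?invr_ge0 ?(ltW MR)// invf_le1.
    by rewrite ler_wpM2r ?exprn_ge0// le_max lexx orbT.
  have [s0 [us0 _ s0P]] := intbox_real G (ltW K20) M1.
  have tile_index P x : tile M P x -> unit_cube x -> P \in s0.
    move=> tx ux; apply/s0P.
    have -> : iv P = mul (dil M%:R x) (- mul (- iv P) (dil M%:R x)).
      by rewrite -mul_inv opprK mulA mulxV mul0.
    apply: HK2 => //; last exact/cboxN/unit_cube_cbox.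
    move=> j; rewrite dilE normrM (ger0_norm (exprn_ge0 _ (ltW MR))) mulrC.
    rewrite ler_wpM2r ?exprn_ge0 ?(ltW MR)//.
    by have := unit_cube_cbox (lexx 1) ux j; rewrite expr1n mulr1.
  pose r := [seq P <- s0 | `[< s P /\ exists2 y, tile M P y & @unit_cube R G y >]].
  have rP P : P \in r -> s P /\ exists2 y, tile M P y & @unit_cube R G y.
    by rewrite mem_filter => /andP[/asboolP].
  have MQ : 0 < M%:R ^- Q :> R by rewrite invr_gt0 exprn_gt0.
  pose m := (size r)%:R * M%:R ^- Q : R.
  have lower : m <= v + eps.
    have vU := vol_bigcup_disjoint (fun P => vol_tile P Mgt0) (filter_uniq _ us0 : uniq r)
      (fun P P' x => @tile_inj _ _ Grat M P P' x).
    have [mWD vWD] := volU mW mD vWle vD.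
    rewrite -lee_fin -vU (le_trans _ vWD)//.
    have [mU _] := vol_bigcup_seq r (fun P => vol_tile P Mgt0).
    apply: le_measure; rewrite ?inE; [exact: mU|exact: mWD|].
    move=> t [P /= /rP[sP [y ty uy]] tP].
    have [Dt|nDt] := pselect (D (point_of_tuple t)); [by right|left].
    by have [_] := HD _ _ (tile_bounded _ _ _ ty uy tP) nDt tP; exact.
  have upper : v <= eps + (1 - kappa) * m.
    have tZ P : mset (tile M P `&` Z) /\ (vol (tile M P `&` Z) <= ((1 - kappa) * M%:R ^- Q)%:E)%E.
      have [mT vT] := vol_tile P Mgt0; split; first exact: measurableI.
      have mTL : mset (tile M P `&` well_approximable c) by exact: measurableI.
      have e : ((M%:R ^- Q)%:E = vol (tile M P `&` Z) + vol (tile M P `&` well_approximable c : set V))%E.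
        by rewrite -vT; exact: (measureDI (lebesgue_tuple R n) mT mL).
      have := leeD2l (vol (tile M P `&` Z)) (Hk c M P c0 Mgt0).
      by rewrite -e -leeBrDr// => /le_trans; apply; rewrite -EFinB lee_fin mulrBl mul1r.
    have [mU vU] := vol_bigcup_seq_le r tZ.
    have [mDU vDU] := volU mD mU vD vU.
    rewrite -lee_fin -vWfin (le_trans _ (le_trans vDU _))//; last first.
      by rewrite lee_fin /m mulrCA.
    apply: le_measure; rewrite ?inE; [exact: mW|exact: mDU|].
    move=> t Wt; have [Zt ut] := Wt.
    have [Dt|nDt] := pselect (D (point_of_tuple t)); [by left|right].
    have [P tP] := tile_exists Grat M (point_of_tuple t); exists P => //=.
    rewrite mem_filter (tile_index _ _ tP ut) andbT; apply/asboolP; split.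
      have [h _] := HD _ _ (tile_bounded _ _ _ tP ut tP) nDt tP; exact: h.
    by exists (point_of_tuple t).
  by rewrite (le_trans upper)// lerD2l ler_wpM2l// subr_ge0.
apply/eqP; rewrite -/W vWfin -/v eqe eq_le v0 andbT leNgt; apply/negP => vp.
have A0 : 0 < kappa * v by rewrite mulr_gt0.
have e0 : 0 < kappa * v / 4 by rewrite divr_gt0.
have := small _ e0; have := mulr_ge0 (ltW k0) (ltW A0).
rewrite (_ : (1 - kappa) * (v + kappa * v / 4) =
  v - kappa * v + (kappa * v / 4) - kappa * (kappa * v) / 4); last by field.
move: A0; move: (kappa * (kappa * v)) (kappa * v) => A B; lra.
Qed.

(** The complement is invariant under integer points, so countably many translates of its null part
    in the unit cube cover it. *)
Lemma well_approximable_full c : rational_carnot G -> 0 < c ->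
  vol (~` well_approximable c : set V) = 0%E.
Proof.
move=> Grat c0; pose W : set V := ~` well_approximable c `&` @unit_cube R G.
have mL := mset_well_approximable (G := G) c0.
have mZ : mset (~` well_approximable c : set V) by exact: (measurableC mL).
have [mI _] := vol_unit_cube G.
have mW : mset W by exact: measurableI.
pose F (i : nat) : set V :=
  if (unpickle i : option 'rV[int]_n) is Some p then [set x | W (mul (- iv p) x)] else set0.
have FP i : mset (F i) /\ vol (F i) = 0%E.
  rewrite /F; case: (unpickle i) => [p|]; last first.
    by rewrite /mset /vol preimage_set0 measure0; split => //; exact: measurable0.
  rewrite vol_mul// unit_cube_complement_null//; split => //.
  apply: (mset_preimage (f := mul (- iv p))) mW => j.
  by apply: mfun_mul => i'; [exact: mfun_cst|exact: mfun_coord].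
apply/eqP; rewrite eq_le measure_ge0 andbT.
have cov : ~` well_approximable c `<=` \bigcup_i F i.
  move=> x nx; have [z zi uz] := fundamental_domain x Grat.
  have [p pE] := integer_pointP zi; exists (pickle p) => //.
  rewrite /F pickleK /= -pE; split => // h; apply: nx.
  by have := well_approximable_mul Grat zi h; rewrite mulVKx.
apply: le_trans (vol_cover mZ (fun i => (FP i).1) cov) _.
by rewrite eseries0// => i _ _; exact: (FP i).2.
Qed.

Lemma divergence_half alpha : rational_carnot G -> alpha <= critical_exponent ip ->
  {ae lebesgue_tuple R n, forall t, infinite_set (approximations ip alpha (point_of_tuple t))}.
Proof.
move=> Grat; rewrite critical_exponentE// => halpha.
have Q0 : 0 < Q%:R :> R by rewrite ltr0n hdim_gt0.
have [C C0 HC] := dist_upper ip.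
(* As C c < 1, lying in the box of radius c q^-(1 + 1/Q) gives a distance strictly below q^-(1 +
   1/Q). *)
pose c := (C + 1)^-1; have c0 : 0 < c by rewrite invr_gt0 addr_gt0.
have mL := mset_well_approximable (G := G) c0.
exists (point_of_tuple (G := G) @^-1` (~` well_approximable c)); split.
- exact: (measurableC mL).
- exact: well_approximable_full.
move=> t /=; apply: contra_not; rewrite well_approximableE => ht.
move: (point_of_tuple t) ht => x hx /finite_seqP[s sE].
(* A denominator beyond all those in the supposed finite list of solutions gives the
   contradiction. *)
pose N := (\max_(z <- s) z.2)%N.
have [q qN /near_ptsP[p hp]] := hx N I.
have : (iv p, q.+1) \in s.
  suff : approximations ip alpha x (iv p, q.+1) by rewrite sE.
  split => //=; first exact: iv_integer.
  rewrite dist_left0; have r0 : 0 < rad G c q.+1 by exact: rad_gt0.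
  apply: (@le_lt_trans _ _ (C * rad G c q.+1)%:E).
    apply: HC => // j; have := cboxN hp j; rewrite mul1r -mul_inv opprK; exact.
  rewrite lte_fin; apply: (@lt_le_trans _ _ (q.+1%:R `^ (- (1 + Q%:R^-1)))).
    rewrite /rad mulrA -ltr_pdivlMr ?powR_gt0// divff ?gt_eqF ?powR_gt0//.
    by rewrite /c ltr_pdivrMr ?addr_gt0// mul1r ltrDl.
  apply: ler_powR; rewrite ?ler1n// lerN2 (le_trans halpha)//.
  by rewrite mulrDl divff ?gt_eqF// mul1r.
move=> qs; have : (q.+1 <= N)%N.
  by rewrite /N (big_rem _ qs)/= leq_maxl.
by rewrite leqNgt ltnS; move: qN => /= ->.
Qed.
End FullMeasure.

Theorem theorem1p1 (R : realType) (G : carnotGroup R)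
    (Grat : rational_carnot G)
    (ip : {dot (subvs_of (horizontal_space G)) for idfun}) (alpha : R) :
  (alpha <= critical_exponent ip ->
     {ae lebesgue_tuple R (carnot_dim G), forall t,
        infinite_set (approximations ip alpha (point_of_tuple t))}) /\
  (critical_exponent ip < alpha ->
     (lebesgue_tuple R (carnot_dim G)).-negligible
       [set t | infinite_set (approximations ip alpha (point_of_tuple t))]).
Proof.
by split => h; [exact: divergence_half|exact: convergence_half].
Qed.
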